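(* Let $d\in\mathbb{N}$, $f\in L^2(\mathbb{R}^d)$ and $\gamma\in(0,2)$. There exist $c_1=c_1(f)>0$ and $c_2=c_2(f)>0$ such that $$c_1\,\varepsilon^\gamma\le\int_{\mathbb{S}^{d-1}}\|f(\cdot+\varepsilon y)-f(\cdot)\|_{2,\mathbb{R}^d}^2\,dS_y\le c_2\,\varepsilon^\gamma,\qquad 0\le\varepsilon\le 1,$$ if and only if there exist $b_1=b_1(f)>0$ and $b_2=b_2(f)>0$ such that $$b_1\,t^{-\gamma}\le\int_{|\xi|\ge t}|\hat f(\xi)|^2\,d\xi\le b_2\,t^{-\gamma},\qquad t\ge 1.$$
   Context: $\hat f(\xi)=\int_{\mathbb{R}^d}e^{-i\xi\cdot x}f(x)\,dx$ is the Fourier transform, extended in the standard way to $L^2(\mathbb{R}^d)$; $\|\cdot\|_{2,\mathbb{R}^d}$ is the $L^2(\mathbb{R}^d)$ norm. $\mathbb{S}^{d-1}$ is the unit sphere in $\mathbb{R}^d$ with its standard surface measure $dS$; for $d=1$ the integral over $\mathbb{S}^{0}$ is interpreted as the sum over $y\in\{\pm1\}$. *)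

(* Defs.v *)
From HB Require Import structures.
From mathcomp Require Export all_boot all_order all_algebra.
From mathcomp Require Export complex.
From mathcomp Require Export all_classical all_reals all_analysis.
From mathcomp Require Export measurable_realfun.
Export Order.TTheory GRing.Theory Num.Theory numFieldNormedType.Exports.

Set Implicit Arguments.
Unset Strict Implicit.
Unset Printing Implicit Defensive.

Local Open Scope ring_scope.
Local Open Scope classical_set_scope.

(* R^d is d.-tuple R with the library's product sigma-algebra (the Borel sets). *)

Lemma measurable_invr {R : realType} : measurable_fun setT (@GRing.inv R).
Proof.
rewrite -(setUv [set 0]); apply/measurable_funU => //.
  exact: measurableC.
split.
  apply/(eq_measurable_fun (fun=> 0 : R)); last exact: measurable_cst.
  by move=> x; rewrite inE/= => ->; rewrite invr0.
apply: open_continuous_measurable_fun; first exact/closed_openC/closed_eq.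
by move=> x; rewrite inE/= => /eqP x0; exact: inv_continuous.
Qed.

Section euclidean.
Context {R : realType} {d : nat}.
Implicit Types x y : d.-tuple R.

Definition addt x y : d.-tuple R := [tuple tnth x i + tnth y i | i < d].
Definition scalet (a : R) x : d.-tuple R := [tuple a * tnth x i | i < d].
Definition dott x y : R := \sum_(i < d) tnth x i * tnth y i.
Definition normt x : R := Num.sqrt (dott x x).
Definition sphere : set (d.-tuple R) := [set x | normt x = 1].
Definition normalize x : d.-tuple R := scalet (normt x)^-1 x.

Lemma measurable_normt : measurable_fun setT normt.
Proof.
apply: measurableT_comp.
  by apply: continuous_measurable_fun; exact: sqrt_continuous.
rewrite /dott; apply: measurable_sum => i.
by apply: measurable_funM; exact: measurable_tnth.
Qed.

Lemma measurable_normalize : measurable_fun setT normalize.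
Proof.
apply/measurable_fun_tnthP => i.
rewrite (_ : _ \o _ = (fun x => (normt x)^-1 * tnth x i)); last first.
  by apply/funext => x /=; rewrite tnth_mktuple.
apply: measurable_funM; last exact: measurable_tnth.
by apply: measurableT_comp measurable_normt; exact: measurable_invr.
Qed.

Lemma measurable_punctured_ball :
  measurable [set x : d.-tuple R | 0 < normt x <= 1].
Proof.
rewrite (_ : mkset _ = setT `&` normt @^-1` `]0, 1]%classic); last first.
  by apply/seteqP; split=> x /=; rewrite in_itv/=; [|case].
by apply: measurable_normt => //; exact: measurable_itv.
Qed.

End euclidean.
Arguments sphere {R} d.

Section lebesgue_cons.
Context {R : realType}.

(* measurableTypeR R is R with the sigma-algebra on which lebesgue_measure is
   declared. *)
Definition cons_pair n (p : measurableTypeR R * n.-tuple R) : n.+1.-tuple R :=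
  [tuple of p.1 :: p.2].

Lemma measurable_cons_pair n : measurable_fun setT (@cons_pair n).
Proof. exact: (@measurable_cons _ _ _ R fst n snd). Qed.

Variables (n : nat) (mu : {sigma_finite_measure set (n.-tuple R) -> \bar R}).

Definition lebesgue_cons : set (n.+1.-tuple R) -> \bar R :=
  pushforward (lebesgue_measure \x mu)%E (@cons_pair n).

Let lebesgue_cons0 : lebesgue_cons set0 = 0%E.
Proof. by rewrite /lebesgue_cons /pushforward preimage_set0 measure0. Qed.

Let lebesgue_cons_ge0 A : (0 <= lebesgue_cons A)%E.
Proof. by rewrite /lebesgue_cons /pushforward measure_ge0. Qed.

Let mpre (A : set (n.+1.-tuple R)) :
  measurable A -> measurable (@cons_pair n @^-1` A).
Proof.
by move=> mA; rewrite -[X in measurable X]setTI; exact: measurable_cons_pair.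
Qed.

Let lebesgue_cons_sigma_additive : semi_sigma_additive lebesgue_cons.
Proof.
move=> F mF tF mUF; rewrite /lebesgue_cons /pushforward preimage_bigcup.
apply: measure_semi_sigma_additive.
- by move=> i; exact: mpre.
- apply/trivIsetP => /= i j _ _ ij; rewrite -preimage_setI.
  by move/trivIsetP : tF => /(_ _ _ _ _ ij) ->//; rewrite preimage_set0.
- by rewrite -preimage_bigcup; exact: mpre.
Qed.

HB.instance Definition _ := isMeasure.Build _ _ _ lebesgue_cons
  lebesgue_cons0 lebesgue_cons_ge0 lebesgue_cons_sigma_additive.

Let lebesgue_cons_sigma_finite : sigma_finite setT lebesgue_cons.
Proof.
have /sigma_finiteP[F [TF ndF Foo]] := sigma_finiteT (@lebesgue_measure R).
have /sigma_finiteP[G [TG ndG Goo]] := sigma_finiteT mu.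
pose hd (t : n.+1.-tuple R) : measurableTypeR R := tnth t ord0.
pose tl (t : n.+1.-tuple R) : n.-tuple R := [tuple of behead t].
exists (fun k => hd @^-1` F k `&` tl @^-1` G k).
  apply/esym; rewrite -subTset => t _.
  have [i _ Fi] : (\bigcup_i F i) (hd t) by rewrite -TF.
  have [j _ Gj] : (\bigcup_i G i) (tl t) by rewrite -TG.
  exists (maxn i j) => //; split.
    by move/subsetPset : (ndF _ _ (leq_maxl i j)); exact.
  by move/subsetPset : (ndG _ _ (leq_maxr i j)); exact.
move=> k; have [mF Fk] := Foo k; have [mG Gk] := Goo k; split.
  apply: measurableI; rewrite -[X in measurable X]setTI.
    exact: (@measurable_tnth _ R).
  exact: measurable_behead.
rewrite /lebesgue_cons /pushforward.
rewrite (_ : _ @^-1` _ = F k `*` G k); last first.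
  apply/seteqP; split=> -[r t] /= [Fr Gt]; split=> //.
    by move: Gt; congr (G k _); exact/val_inj.
  by move: Gt; congr (G k _); exact/val_inj.
by rewrite product_measure1E// lte_mul_pinfty// ge0_fin_numE.
Qed.

HB.instance Definition _ := Measure_isSigmaFinite.Build _ _ _ lebesgue_cons
  lebesgue_cons_sigma_finite.

End lebesgue_cons.

Fixpoint lebesgue_tuple {R : realType} (d : nat) :
    {sigma_finite_measure set (d.-tuple R) -> \bar R} :=
  match d return {sigma_finite_measure set (d.-tuple R) -> \bar R} with
  | 0 => @dirac _ (0.-tuple R) [tuple] R
  | d'.+1 => lebesgue_cons (lebesgue_tuple d')
  end.

(* In polar coordinates dx = r^(d-1) dr dS, so the surface measure of A is
   d times the Lebesgue measure of the cone { r y | y \in A, 0 < r <= 1 }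
   (for A in the sphere; the complement of the sphere gets measure 0).
   For d = 1 this is the counting measure on {1, -1}: see sphere_measure1. *)
Section sphere_measure.
Context {R : realType} (d : nat).

Definition sphere_measure (A : set (d.-tuple R)) : \bar R :=
  (d%:R%:E * lebesgue_tuple d
     ([set x | (0 < normt x <= 1)%R] `&` normalize @^-1` A))%E.

Let sphere_measure0 : sphere_measure set0 = 0%E.
Proof. by rewrite /sphere_measure preimage_set0 setI0 measure0 mule0. Qed.

Let sphere_measure_ge0 A : (0 <= sphere_measure A)%E.
Proof. by rewrite /sphere_measure mule_ge0// lee_fin. Qed.

Let sphere_measure_sigma_additive : semi_sigma_additive sphere_measure.
Proof.
have mpre (A : set (d.-tuple R)) : measurable A ->
    measurable ([set x | 0 < normt x <= 1] `&` normalize @^-1` A).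
  move=> mA; apply: measurableI; first exact: measurable_punctured_ball.
  by rewrite -[X in measurable X]setTI; exact: measurable_normalize.
move=> F mF tF mUF; rewrite [X in X @ \oo --> _](_ : _ =
  (fun n => d%:R%:E * \sum_(0 <= i < n) lebesgue_tuple d
     ([set x | (0 < normt x <= 1)%R] `&` normalize @^-1` F i))%E); last first.
  by apply/funext => k; rewrite ge0_sume_distrr.
apply: cvgeZl => //; rewrite preimage_bigcup setI_bigcupr.
apply: measure_semi_sigma_additive.
- by move=> i; exact: mpre.
- apply/trivIsetP => /= i j _ _ ij; rewrite setIACA -preimage_setI.
  by move/trivIsetP : tF => /(_ _ _ _ _ ij) ->//; rewrite preimage_set0 setI0.
- by rewrite -setI_bigcupr -preimage_bigcup; exact: mpre.
Qed.

HB.instance Definition _ := isMeasure.Build _ _ _ sphere_measure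
  sphere_measure0 sphere_measure_ge0 sphere_measure_sigma_additive.

End sphere_measure.
Arguments sphere_measure {R} d.

Section sphere_measure1.
Context {R : realType}.

Lemma lebesgue_tuple1 (B : set (1.-tuple R)) : measurable B ->
  lebesgue_tuple 1 B = lebesgue_measure [set r : R | B [tuple r]].
Proof.
move=> mB.
have mg : measurable_fun [set: R] (fun r => [tuple r] : 1.-tuple R).
  apply/measurable_fun_tnthP => i; rewrite (_ : _ \o _ = id)//.
  by apply/funext => r; rewrite /= (tnth_nth 0) ord1.
have mC : measurable [set r : R | B [tuple r]].
  by rewrite -[X in measurable X]setTI; exact: mg.
rewrite /= /lebesgue_cons /pushforward /product_measure1.
rewrite -[in RHS](setIT [set r | _]) -integral_indic//.
apply: eq_integral => r _ /=; rewrite /dirac !indicE; congr (_%:R%:E).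
congr nat_of_bool; apply/idP/idP; rewrite !inE /xsection/= !inE /cons_pair/=;
  by congr (B _); exact/val_inj.
Qed.

Lemma sphere_measure1 (A : set (1.-tuple R)) : measurable A ->
  sphere_measure 1 A = (\d_[tuple 1%R : R] A + \d_[tuple (-1)%R : R] A)%E.
Proof.
move=> mA; rewrite /sphere_measure mul1e lebesgue_tuple1; last first.
  apply: measurableI; first exact: measurable_punctured_ball.
  by rewrite -[X in measurable X]setTI; exact: measurable_normalize.
have nE (r : R) : normt [tuple r] = `|r|.
  by rewrite /normt /dott big_ord1 -expr2 sqrtr_sqr.
have sE (r : R) : normalize [tuple r] = [tuple `|r|^-1 * r].
  apply/eq_from_tnth => i; rewrite tnth_mktuple nE.
  by rewrite !(tnth_nth 0) ord1.
pose P := [set r : R | A [tuple 1] /\ r \in `]0, 1]%R].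
pose N := [set r : R | A [tuple -1] /\ r \in `[(-1)%R, 0[%R].
rewrite (_ : [set r : R | _] = P `|` N); last first.
  apply/seteqP; split=> r /=; rewrite /P /N /= !in_itv/= nE sE.
    have [r0|r0|->] := ltgtP r 0; last by rewrite normr0 ltxx => -[].
      rewrite ltr0_norm// invrN mulNr mulVf ?lt_eqF// => -[/andP[_ r1] Ar].
      by right; split => //; rewrite andbT lerNl.
    rewrite gtr0_norm// mulVf ?gt_eqF// => -[/andP[_ r1] Ar].
    by left.
  move=> [[Ar /andP[r0 r1]]|[Ar /andP[r1 r0]]].
    by rewrite gtr0_norm// r0 r1 mulVf ?gt_eqF.
  by rewrite ltr0_norm// oppr_gt0 r0 lerNl r1 invrN mulNr mulVf ?lt_eqF.
have PE : P = if [tuple 1] \in A then `]0, 1]%classic else set0.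
  rewrite /P; case: ifPn; rewrite ?inE ?notin_setE => A1.
    by apply/seteqP; split=> r /=; [case|].
  by apply/seteqP; split=> r //= [].
have NE : N = if [tuple -1] \in A then `[-1, 0[%classic else set0.
  rewrite /N; case: ifPn; rewrite ?inE ?notin_setE => A1.
    by apply/seteqP; split=> r /=; [case|].
  by apply/seteqP; split=> r //= [].
rewrite measureU//=.
- rewrite !diracE; congr (_ + _)%E; rewrite ?PE ?NE.
    case: ifP => _; last by rewrite measure0.
    by rewrite lebesgue_measure_itv/= lte_fin ltr01 oppr0 adde0.
  case: ifP => _; last by rewrite measure0.
  by rewrite lebesgue_measure_itv/= lte_fin ltrN10 opprK add0e.
- by rewrite PE; case: ifP.
- by rewrite NE; case: ifP.
- rewrite -subset0 => r [[_ +] [_]]; rewrite !in_itv/= => /andP[r0 _] /andP[_].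
  by rewrite ltNge (ltW r0).
Qed.

End sphere_measure1.

Section Lp_complex.
Context {R : realType} {d : nat}.
Implicit Types f g : d.-tuple R -> R[i].

Definition Lnormc (p : \bar R) f : \bar R :=
  ('N[lebesgue_tuple d]_p [EFin \o (@Normc.normc R \o f)])%E.

Definition inLp (p : \bar R) f : Prop :=
  [/\ measurable_fun setT (fun x => complex.Re (f x)),
      measurable_fun setT (fun x => complex.Im (f x)) &
      (Lnormc p f < +oo)%E].

Definition Cintegral f : R[i] :=
  Complex (Rintegral (lebesgue_tuple d) setT (fun x => complex.Re (f x)))
          (Rintegral (lebesgue_tuple d) setT (fun x => complex.Im (f x))).

End Lp_complex.

Section fourier.
Context {R : realType} {d : nat}.
Implicit Types f g : d.-tuple R -> R[i].

Definition expi (t : R) : R[i] := Complex (cos t) (sin t).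

Definition fourierL1 f : d.-tuple R -> R[i] :=
  fun xi => Cintegral (fun x => expi (- dott xi x) * f x).

(* Extension of fourierL1 by L^2-continuity from the dense subspace
   L^1 \cap L^2; g is determined by f up to a null set. *)
Definition is_fourierL2 f g : Prop :=
  inLp 2%:E g /\
  exists h : nat -> d.-tuple R -> R[i],
    [/\ forall n, inLp 1%:E (h n) /\ inLp 2%:E (h n),
        Lnormc 2%:E (fun x => h n x - f x) @[n --> \oo] --> 0%E &
        Lnormc 2%:E (fun xi => fourierL1 (h n) xi - g xi) @[n --> \oo] --> 0%E].

Definition fourier f : d.-tuple R -> R[i] :=
  xget (fun=> 0) [set g | is_fourierL2 f g].

End fourier.

(* Main.v *)
Require Import Defs.
From mathcomp Require Import ring lra.

(** Let D(h) be the squared L2 norm of f(. + h) - f, and W the squared modulus of the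
    Fourier transform of f. A translation by h multiplies the transform by exp (i xi.h),
    so Plancherel's formula gives
      (2 pi)^d D(h) = int 2 (1 - cos (xi.h)) W(xi) d xi
    ([L2sq_difference]). Integrating over h = e y with y on the sphere expresses the
    spherical modulus I(e) as a constant times int k(e, xi) W(xi) d xi, where k(e, xi) is
    an average of 2 (1 - cos (e xi.y)) over the directions y ([spherical_modulusE]). This
    average is bounded, is at most a multiple of e^2 |xi|^2, and is at least a multiple
    of it when e |xi| <= 1. With the tail J(t) and the second moment F(t) of W beyond and
    below the radius t, I(e) therefore lies, up to constants, above e^2 F(1/e) and below
    e^2 F(t) + J(t) for every t.

    What remains concerns real functions only ([power_law_equivalence]). Over a dyadic
    shell the increments of F and of J are comparable, so upper bounds pass between I
    and J by summing geometric series: those for J from I converge because gamma > 0,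
    those for F from J because gamma < 2. Lower bounds follow from upper ones by
    comparing two scales with a large fixed ratio A, at which the unwanted part of I or
    of J is smaller by a power of A. For scales e between 1/A and 1 this comparison is
    void; there I is bounded below because it grows at most by the factor 4 when e
    doubles, while it stays away from 0 for large e, distant translates of f being nearly
    orthogonal to f ([L2sq_difference_lower_bound]).

    Plancherel's formula is obtained as follows. For a real function p on the line,
    integrable and square integrable, the Abel means of its squared transform are
    averages of the autocorrelation of p against the Poisson kernel, an approximate
    identity of mass 2 pi; they tend to 2 pi times the autocorrelation at 0 because
    translations are continuous in L2 ([plancherel_line_real]). Complex functions follow
    by symmetry in the frequency, and several variables by integrating one variable at a
    time ([plancherel_tuple]). The formula then passes to the L2 transform along any
    approximating sequence ([plancherel_L2]); such a transform exists by truncation and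
    completeness ([fourierP]). *)

Set Implicit Arguments.
Unset Strict Implicit.
Unset Printing Implicit Defensive.

Local Open Scope ring_scope.
Local Open Scope classical_set_scope.

(** * Fubini's theorem and rules for real-valued integrals *)

Section prod.
Context d1 d2 (T1 : measurableType d1) (T2 : measurableType d2) (R : realType).
Variables (m1 : {sigma_finite_measure set T1 -> \bar R})
  (m2 : {sigma_finite_measure set T2 -> \bar R}).

Lemma measurable_Rintegral_param (F : T1 * T2 -> R) :
  measurable_fun setT F ->
  measurable_fun setT (fun x => Rintegral m2 setT (fun y => F (x, y))).
Proof.
move=> mF.
have mE : measurable_fun setT (EFin \o F) by exact/measurable_EFinP.
rewrite (_ : (fun x => _) = fine \o
   (fun x => fubini_F m2 (EFin \o F)^\+ x - fubini_F m2 (EFin \o F)^\- x)%E).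
  apply: measurableT_comp => //; apply: emeasurable_funB.
    by apply: measurable_fun_fubini_tonelli_F => //; exact: measurable_funepos.
  by apply: measurable_fun_fubini_tonelli_F => //; exact: measurable_funeneg.
apply/funext => x /=; congr fine; rewrite integralE.
by congr (_ - _)%E; apply: eq_integral => y _; rewrite !(funeposE, funenegE).
Qed.

Section fubini.
Variable F : T1 * T2 -> R.
Hypothesis iF : (m1 \x m2)%E.-integrable setT (EFin \o F).

Lemma ae_Rintegral1 :
  ae_eq m1 setT (fubini_F m2 (EFin \o F))
    (fun x => (Rintegral m2 setT (fun y => F (x, y)))%:E).
Proof.
by apply: filterS (ae_integrable1 iF) => x ix _; rewrite fineK// integrable_fin_num.
Qed.

Lemma ae_Rintegral2 :
  ae_eq m2 setT (fubini_G m1 (EFin \o F))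
    (fun y => (Rintegral m1 setT (fun x => F (x, y)))%:E).
Proof.
by apply: filterS (ae_integrable2 iF) => y iy _; rewrite fineK// integrable_fin_num.
Qed.

Let mF : measurable_fun setT F.
Proof. by apply/measurable_EFinP; exact: measurable_int iF. Qed.

Lemma Rintegral_prod12 : Rintegral (m1 \x m2)%E setT F =
  Rintegral m1 setT (fun x => Rintegral m2 setT (fun y => F (x, y))).
Proof.
rewrite /Rintegral -integral12_prod_meas1//; congr fine.
apply: ae_eq_integral => //.
- exact: (measurable_fubini_F iF).
- exact/measurable_EFinP/measurable_Rintegral_param.
- exact: ae_Rintegral1.
Qed.

Lemma integrable_Rintegral1 :
  m1.-integrable setT (fun x => (Rintegral m2 setT (fun y => F (x, y)))%:E).
Proof.
have [mf lf] := integrableP _ _ _ (integrable_fubini_F iF).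
apply/integrableP; split.
  exact/measurable_EFinP/measurable_Rintegral_param.
rewrite (le_lt_trans _ lf)// le_eqVlt; apply/orP; left; apply/eqP.
apply: ae_eq_integral => //.
- by apply: measurableT_comp => //; exact/measurable_EFinP/measurable_Rintegral_param.
- exact: measurableT_comp.
- by have := ae_Rintegral1; apply: filterS => x /= H _; rewrite H.
Qed.
End fubini.
End prod.

Section prod2.
Context d1 d2 (T1 : measurableType d1) (T2 : measurableType d2) (R : realType).
Variables (m1 : {sigma_finite_measure set T1 -> \bar R})
  (m2 : {sigma_finite_measure set T2 -> \bar R}).

Lemma Rintegral_fubini (F : T1 * T2 -> R) :
  (m1 \x m2)%E.-integrable setT (EFin \o F) ->
  Rintegral m1 setT (fun x => Rintegral m2 setT (fun y => F (x, y))) =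
  Rintegral m2 setT (fun y => Rintegral m1 setT (fun x => F (x, y))).
Proof.
move=> iF; rewrite -(Rintegral_prod12 iF) /Rintegral -integral21_prod_meas1//.
have mF : measurable_fun setT F.
  by apply/measurable_EFinP; exact: measurable_int iF.
congr fine; apply: ae_eq_integral => //.
- exact: (measurable_fubini_G iF).
- apply/measurable_EFinP.
  apply: (@measurable_Rintegral_param _ _ _ _ _ m1 (F \o (fun z => (z.2, z.1)))).
  by apply: measurableT_comp => //; exact: measurable_swap.
- exact: ae_Rintegral2.
Qed.

(** Tonelli: the double integral of the absolute value is at most the product of the
    two norms. *)
Lemma integrable_le_prod (a : T1 -> R) (b : T2 -> R) (F : T1 * T2 -> R) :
  m1.-integrable setT (EFin \o a) -> m2.-integrable setT (EFin \o b) ->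
  measurable_fun setT F -> (forall x y, `|F (x, y)| <= `|a x| * `|b y|) ->
  (m1 \x m2)%E.-integrable setT (EFin \o F).
Proof.
move=> ia ib mF leF; apply/integrable12ltyP; first exact/measurable_EFinP.
have /integrableP[ma la] := ia; have /integrableP[mb lb] := ib.
apply: (@le_lt_trans _ _ (\int[m1]_x ((\int[m2]_y `|b y|%:E) * `|a x|%:E))%E); last first.
  rewrite ge0_integralZl//; last 2 first.
    by apply/measurable_EFinP/measurableT_comp => //; exact/measurable_EFinP.
    by apply: integral_ge0.
  rewrite lte_mul_pinfty//.
  - exact: integral_ge0.
  - by rewrite ge0_fin_numE; last exact: integral_ge0.
have mb' : measurable_fun setT (fun y => `|b y|%:E).
  by apply/measurable_EFinP/measurableT_comp => //; exact/measurable_EFinP.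
apply: ge0_le_integral => //.
- by move=> x _; exact: integral_ge0.
- apply: (@measurable_fun_fubini_tonelli_F _ _ _ _ _ m2 (abse \o (EFin \o F))) => //.
    by apply: measurableT_comp => //; exact/measurable_EFinP.
  by move=> z; exact: abse_ge0.
- apply: measurable_funeM => //.
  by apply/measurable_EFinP/measurableT_comp => //; exact/measurable_EFinP.
move=> x _; rewrite muleC -ge0_integralZl//.
apply: ge0_le_integral => //.
- apply/measurable_EFinP/measurableT_comp => //.
  exact: (measurableT_comp mF (measurable_pair1 _)).
- exact: measurable_funeM.
- by move=> y _; rewrite /= -EFinM lee_fin.
Qed.

End prod2.

(** Real-valued integrals over the whole space, with every integrand eta-expanded so
    that rewriting with the rules leaves readable integrands. *)
Section Rint.
Context d (T : measurableType d) (R : realType) (mu : {measure set T -> \bar R}).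
Implicit Types f g : T -> R.
Local Notation int f := (mu.-integrable setT (fun x => (f x)%:E)).

Lemma RintZl r f : int f ->
  r * Rintegral mu setT f = Rintegral mu setT (fun x => r * f x).
Proof. by move=> ?; rewrite RintegralZl. Qed.

Lemma RintD f g : int f -> int g ->
  Rintegral mu setT f + Rintegral mu setT g = Rintegral mu setT (fun x => f x + g x).
Proof. by move=> ? ?; rewrite RintegralD. Qed.

Lemma RintB f g : int f -> int g ->
  Rintegral mu setT f - Rintegral mu setT g = Rintegral mu setT (fun x => f x - g x).
Proof. by move=> ? ?; rewrite RintegralB. Qed.

Lemma Rint_le f g : int f -> int g -> (forall x, f x <= g x) ->
  Rintegral mu setT f <= Rintegral mu setT g.
Proof. by move=> ? ? fg; apply: le_Rintegral. Qed.

Lemma integrable_Zl r f : int f -> int (fun x => r * f x).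
Proof. by move=> intf; apply: (integrableZl measurableT r intf). Qed.

Lemma integrable_D f g : int f -> int g -> int (fun x => f x + g x).
Proof. by move=> intf intg; apply: (integrableD measurableT intf intg). Qed.

Lemma integrable_B f g : int f -> int g -> int (fun x => f x - g x).
Proof. by move=> intf intg; apply: (integrableB measurableT intf intg). Qed.

Lemma integrable_N f : int f -> int (fun x => - f x).
Proof. by move=> intf; apply: (integrableN intf). Qed.

Lemma integrable_bounded_mul (M : R) f g : measurable_fun setT f ->
  (forall x, `|f x| <= M) -> int g -> int (fun x => f x * g x).
Proof.
move=> mf fM ig; have mg : measurable_fun setT g.
  by apply/measurable_EFinP; exact: measurable_int ig.
apply: le_integrable (integrable_Zl `|M| (integrable_norm ig)) => //.
  by apply/measurable_EFinP; exact: measurable_funM.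
move=> x _ /=; rewrite lee_fin !normrM !normr_id ler_wpM2r//.
by rewrite (le_trans (fM x))// ler_norm.
Qed.

Lemma integrable_EFin_fine f : (forall x, 0 <= f x) -> int f ->
  (\int[mu]_x (f x)%:E = (Rintegral mu setT f)%:E)%E.
Proof. by move=> f0 intf; rewrite /Rintegral fineK// integrable_fin_num. Qed.

Lemma integrable_of_ge0_lty f : measurable_fun setT f -> (forall x, 0 <= f x) ->
  (\int[mu]_x (f x)%:E < +oo)%E -> int f.
Proof.
move=> mf f0 lf; apply/integrableP; split; first exact/measurable_EFinP.
by under eq_integral do rewrite abse_EFin ger0_norm//.
Qed.

End Rint.

(** * Affine changes of variable on the line *)

Section affine.
Context {R : realType}.
Local Notation mR := (measurableTypeR R).
Local Notation lam := (@lebesgue_measure R).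
Implicit Types a b : R.

Definition affine a b : mR -> mR := fun x => a * x + b.

Lemma measurable_affine a b : measurable_fun [set: mR] (affine a b).
Proof. by apply: measurable_funD => //; exact: measurable_funM. Qed.

(** Lebesgue measure is determined by its values on half-open intervals; whether the
    preimage of such an interval is closed on the left or on the right depends on the
    sign of a, which its measure does not see. *)
Lemma lebesgue_measure_affine a b (A : set mR) : a != 0 -> measurable A ->
  lam A = (`|a|%:E * lam (affine a b @^-1` A))%E.
Proof.
move=> a0 mA.
have ma := measurable_affine a b.
pose na : {nonneg R} := NngNum (normr_ge0 a).
pose m := measure_function_pushforward__canonical__measure_function_Measure
  lam ma.
suff -> : lam A = mscale na m A by [].
apply: lebesgue_measure_unique => //= _ [[u v]] _ <-.
rewrite /mscale/= /pushforward.
have e0 (z : R) : `|a| * (z / `|a|) = z by rewrite mulrC divfK// normr_eq0.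
have [ap|an|az] := ltgtP a 0; last by rewrite az eqxx in a0.
- have -> : affine a b @^-1` `]u, v] = `[(v - b) / a, (u - b) / a[%classic.
    apply/seteqP; split => x; rewrite /affine /= !in_itv/= => /andP[h1 h2];
      apply/andP; split.
    + by rewrite ler_ndivrMr// mulrC; lra.
    + by rewrite ltr_ndivlMr// mulrC; lra.
    + by move: h2; rewrite ltr_ndivlMr// mulrC; lra.
    + by move: h1; rewrite ler_ndivrMr// mulrC; lra.
  rewrite !lebesgue_measure_itv/= !lte_fin ltr_nM2r ?invr_lt0//.
  rewrite ltrD2r; case: ifPn => uv; last by rewrite mule0.
  rewrite -!EFinD -EFinM; congr EFin; rewrite ltr0_norm//.
  by field; rewrite lt_eqF.
- have -> : affine a b @^-1` `]u, v] = `](u - b) / a, (v - b) / a]%classic.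
    apply/seteqP; split => x; rewrite /affine /= !in_itv/= => /andP[h1 h2];
      apply/andP; split.
    + by rewrite ltr_pdivrMr// mulrC; lra.
    + by rewrite ler_pdivlMr// mulrC; lra.
    + by move: h1; rewrite ltr_pdivrMr// mulrC; lra.
    + by move: h2; rewrite ler_pdivlMr// mulrC; lra.
  rewrite !lebesgue_measure_itv/= !lte_fin ltr_pM2r ?invr_gt0//.
  rewrite ltrD2r; case: ifPn => uv; last by rewrite mule0.
  rewrite -!EFinD -EFinM; congr EFin; rewrite gtr0_norm//.
  by field; rewrite gt_eqF.
Qed.

Lemma ge0_integral_affine a b (f : mR -> \bar R) : a != 0 ->
  measurable_fun setT f -> (forall x, 0 <= f x)%E ->
  (\int[lam]_x f x = `|a|%:E * \int[lam]_x f (a * x + b)%R)%E.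
Proof.
move=> a0 mf f0.
have ma := measurable_affine a b.
pose na : {nonneg R} := NngNum (normr_ge0 a).
pose m := measure_function_pushforward__canonical__measure_function_Measure
  lam ma.
rewrite (@eq_measure_integral _ _ _ _ (mscale na m)); last first.
  by move=> A mA _; exact: (lebesgue_measure_affine b a0 mA).
rewrite ge0_integral_mscale//; congr (_ * _)%E.
by rewrite ge0_integral_pushforward.
Qed.

Lemma integrable_affine a b (f : mR -> R) : a != 0 ->
  lam.-integrable setT (EFin \o f) ->
  lam.-integrable setT (fun x => (f (a * x + b))%:E).
Proof.
move=> a0 /integrableP[mE lf].
have ma := measurable_affine a b.
apply/integrableP; split; first exact: (measurableT_comp mE ma).
move: lf; rewrite (@ge0_integral_affine a b) //; last exact: measurableT_comp.
rewrite !ltey; apply: contraNneq => /= h.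
rewrite -[X in (_ * X)%E]/(\int[lam]_x `|(f (a * x + b))%:E|)%E h.
by rewrite gt0_muley ?lte_fin ?normr_gt0.
Qed.

Lemma Rintegral_affine a b (f : mR -> R) : a != 0 ->
  lam.-integrable setT (EFin \o f) ->
  Rintegral lam setT f = `|a| * Rintegral lam setT (fun x => f (a * x + b)).
Proof.
move=> a0 intf.
have /integrableP[mE lf] := intf.
have ma := measurable_affine a b.
have intg := integrable_affine b a0 intf.
have gp := integrable_pos_fin_num measurableT intg.
have gn := integrable_neg_fin_num measurableT intg.
rewrite /Rintegral integralE [in RHS]integralE.
rewrite (@ge0_integral_affine a b _ a0 (measurable_funepos mE))//.
rewrite (@ge0_integral_affine a b _ a0 (measurable_funeneg mE))//.
rewrite -[`|a| in RHS]/(fine `|a|%:E) -fineM//; last by rewrite fin_numB gp gn.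
rewrite [in RHS]muleBr ?fin_num_adde_defr//.
congr (fine (_ - _))%E; congr (_ * _)%E; apply: eq_integral => x _;
  by rewrite !(funeposE, funenegE).
Qed.

End affine.

(** * Tails of integrals *)

Section tail.
Context d (T : measurableType d) (R : realType).
Variable mu : {measure set T -> \bar R}.

Lemma measurable_superlevel (r : T -> R) (t : R) : measurable_fun setT r ->
  measurable [set x | t <= r x].
Proof.
move=> mr; rewrite (_ : mkset _ = setT `&` r @^-1` `[t, +oo[%classic).
  exact: mr.
by apply/seteqP; split=> x /=; rewrite in_itv/= andbT; [|case].
Qed.

(** Dominated convergence: at each point the restriction to the superlevel set
    eventually vanishes. According to the choice of r, the tail is the part of F near
    infinity (r a norm), or where a function is large (r its absolute value) or small
    (r the inverse of its size). *)
Lemma tail_integral_cvg0 (F r : T -> R) :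
  measurable_fun setT F -> measurable_fun setT r -> (forall x, 0 <= F x) ->
  (\int[mu]_x (F x)%:E < +oo)%E ->
  (\int[mu]_(x in [set x | (n%:R <= r x)%R]) (F x)%:E)%E @[n --> \oo] --> 0%E.
Proof.
move=> mF mr F0 lF.
have mS n : measurable [set x | (n%:R <= r x)%R] by exact: measurable_superlevel.
have mE : measurable_fun setT (EFin \o F) by exact/measurable_EFinP.
have iF : mu.-integrable setT (EFin \o F).
  by apply/integrableP; split=> //=; under eq_integral do rewrite ger0_norm//.
pose f_ n := (EFin \o F) \_ [set x | (n%:R <= r x)%R].
have [||||_ _] := @dominated_convergence _ _ _ mu setT measurableT f_ (cst 0%E)
  (EFin \o F) _ _ _ iF.
- by move=> n; apply/(measurable_restrictT _ _).1 => //; exact: measurable_funTS.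
- exact: measurable_cst.
- apply: aeW => x _; apply: cvg_near_cst.
  near=> n; rewrite /f_ patchE ifF//; apply/negbTE; rewrite notin_setE/=.
  apply/negP; rewrite -ltNge; near: n; exact: nbhs_infty_gtr.
- apply: aeW => x n _; rewrite /f_ patchE; case: ifP => _.
    by rewrite /= ger0_norm.
  by rewrite abse0 lee_fin.
rewrite integral_cst// mul0e; apply: cvg_trans.
rewrite [X in X @ _](_ : _ = (fun n => \int[mu]_x f_ n x))%E//.
by apply/funext => n; rewrite integral_mkcond.
Unshelve. all: by end_near. Qed.

End tail.

Section ereal_cvg0.
Context {R : realType}.

Lemma ereal_cvg0_lt (f : nat -> \bar R) (e : R) : f n @[n --> \oo] --> 0%E ->
  0 < e -> \forall n \near \oo, (f n < e%:E)%E.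
Proof.
move=> f0 e0; apply: (f0 [set x | (x < e%:E)%E]).
by apply: open_nbhs_nbhs; split; [exact: open_ereal_lt_ereal|rewrite /= lte_fin].
Qed.

Lemma ereal_cvg0P (f : nat -> \bar R) : (forall n, (0 <= f n)%E) ->
  (forall e : R, 0 < e -> \forall n \near \oo, (f n <= e%:E)%E) ->
  f n @[n --> \oo] --> 0%E.
Proof.
move=> f0 fe.
apply/fine_cvgP; split.
  have := fe 1 ltr01; apply: filterS => n fn.
  by rewrite ge0_fin_numE// (le_lt_trans fn)// ltry.
apply/cvgr0Pnorm_le => e e0; have := fe e e0; apply: filterS => n fn /=.
rewrite ger0_norm ?fine_ge0// -lee_fin fineK//.
by rewrite ge0_fin_numE// (le_lt_trans fn)// ltry.
Qed.

End ereal_cvg0.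

(** * Continuity of translations in L2 *)

Section translation.
Context {R : realType}.
Local Notation mR := (measurableTypeR R).
Local Notation lam := (@lebesgue_measure R).
Variable u : nat -> R.
Hypothesis u0 : u n @[n --> \oo] --> 0.

Lemma measurable_shift (f : mR -> R) (a : R) : measurable_fun setT f ->
  measurable_fun [set: mR] (fun x : mR => f (x + a)).
Proof.
move=> mf; apply: (measurableT_comp mf (_ : measurable_fun setT (fun x : mR => x + a : mR))).
exact: measurable_funD.
Qed.

Lemma ge0_integral_shift (f : mR -> \bar R) (a : R) :
  measurable_fun setT f -> (forall x, 0 <= f x)%E ->
  (\int[lam]_x f (x + a)%R = \int[lam]_x f x)%E.
Proof.
move=> mf f0; rewrite [RHS](ge0_integral_affine a (oner_neq0 R))// normr1 mul1e.
by apply: eq_integral => x _; rewrite mul1r.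
Qed.

(** The function q is close in L1 to a continuous one, whose increments over a compact
    interval tend to 0 by dominated convergence; the approximation error enters twice,
    once translated. *)
Lemma L1_translation_bounded (q : mR -> R) (M e : R) : measurable_fun setT q ->
  0 < M -> (forall x, `|q x| <= M) -> (forall x, M < `|x| -> q x = 0) -> 0 < e ->
  \forall n \near \oo, (\int[lam]_x `|q (x + u n) - q x|%:E <= e%:E)%E.
Proof.
move=> mq M0 qM qs e0.
(* Off E both q x and its translate by at most 1 vanish; the larger E' contains
   the translates of the points of E. *)
pose E : set mR := `[- (M + 1), M + 1]%classic.
pose E' : set mR := `[- (M + 2), M + 2]%classic.
have mE : measurable E by exact: measurable_itv.
have mE' : measurable E' by exact: measurable_itv.
have lE : (lam E < +oo)%E.
  by rewrite lebesgue_measure_itv/=; case: ifP => _; rewrite ?ltry.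
have lE' : (lam E' < +oo)%E.
  by rewrite lebesgue_measure_itv/=; case: ifP => _; rewrite ?ltry.
have iq : lam.-integrable E' (EFin \o q).
  apply: measurable_bounded_integrable => //; first exact: measurable_funTS.
  by exists M; split; [exact: num_real|move=> y My x _; exact: (le_trans (qM x) (ltW My))].
have [g_ [cg ig gq]] := approximation_continuous_integrable mE' lE' iq.
have : \forall n \near \oo, (\int[lam]_(z in E') `|(q z - g_ n z)%:E| < (e / 4)%:E)%E.
  by apply: (ereal_cvg0_lt gq); rewrite divr_gt0.
case=> N _ /(_ N (leqnn N)) /= gN.
set g := g_ N in gN; have {cg}cg : continuous g by exact: cg.
have mg : measurable_fun [set: mR] (g : mR -> R) by exact: continuous_measurable_fun.
have [B B0 gB] : exists2 B, 0 < B & forall x, E' x -> `|g x| <= B.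
  have cE' : compact E' by exact: segment_compact.
  have := @continuous_compact _ _ g E' (continuous_subspaceT cg) cE'.
  move/compact_bounded => [B [_ HB]]; exists (`|B| + 1); first by rewrite ltr_wpDl.
  move=> x Ex; apply: HB; first by rewrite ltr_pwDr// ler_norm.
  by exists x.
pose k (x : mR) := `|q x - g x| * \1_E' x.
have mk : measurable_fun setT k.
  by apply: measurable_funM => //; apply: measurableT_comp => //; exact: measurable_funB.
have k0 x : 0 <= k x by rewrite mulr_ge0.
have ik : (\int[lam]_x (k x)%:E < (e / 4)%:E)%E.
  rewrite (le_lt_trans _ gN)//= le_eqVlt; apply/orP; left; apply/eqP; rewrite [RHS]integral_mkcond.
  apply: eq_integral => x _; rewrite patchE /k indicE.
  by case: ifP => _; rewrite ?mulr1 ?mulr0.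
have dom : (\int[lam]_(x in E) `|g (x + u n) - g x|%:E)%E @[n --> \oo] --> 0%E.
  have u1 : \forall n \near \oo, `|u n| <= 1.
    by have /cvgr0Pnorm_le := u0; apply.
  case: u1 => N1 _ u1; rewrite -(cvg_shiftn N1)/=.
  have ic : lam.-integrable E (cst (2 * B)%:E).
    apply: measurable_bounded_integrable => //.
    by exists `|2 * B|; split => // y By x _ /=; exact: ltW.
  have [||||_ _] := @dominated_convergence _ _ _ lam E mE
     (fun n x => `|g (x + u (n + N1)%N) - g x|%:E) (cst 0%E)
     (cst (2 * B)%:E) _ _ _ ic.
  - move=> n; apply/measurable_EFinP/measurableT_comp => //.
    apply: measurable_funTS; apply: measurable_funB => //.
    exact: measurable_shift.
  - exact: measurable_cst.
  - apply: aeW => x _; apply: cvg_EFin; first exact: nearW.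
    have xu : x + u (n + N1)%N @[n --> \oo] --> x.
      have : x + u (n + N1)%N @[n --> \oo] --> x + 0.
        apply: cvgD; first exact: cvg_cst.
        by rewrite (cvg_shiftn N1 u).
      by rewrite addr0.
    have : g (x + u (n + N1)%N) - g x @[n --> \oo] --> g x - g x.
      apply: cvgB; last exact: cvg_cst.
      exact: (cvg_comp _ _ xu (cg x)).
    by rewrite subrr => /cvg_norm; rewrite normr0.
  - apply: aeW => x n Ex /=; rewrite lee_fin normr_id (le_trans (ler_normB _ _))//.
    have /(_ (n + N1)%N) := u1; rewrite /= leq_addl => /(_ isT) un.
    have xE' : E' x.
      by move: Ex; rewrite /E /E' /= !in_itv/= => /andP[? ?]; apply/andP; split; lra.
    have xE'' : E' (x + u (n + N1)%N).
      move: Ex un; rewrite /E /E' /= !in_itv/= ler_norml => /andP[? ?] /andP[? ?].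
      by apply/andP; split; lra.
    by have := gB _ xE'; have := gB _ xE''; lra.
  by rewrite integral0.
have dom2 : \forall n \near \oo, (\int[lam]_(x in E) `|g (x + u n) - g x|%:E < (e / 4)%:E)%E.
  by apply: ereal_cvg0_lt dom _; rewrite divr_gt0.
have un1 : \forall n \near \oo, `|u n| <= 1.
  by have /cvgr0Pnorm_le := u0; apply.
apply: filterS2 dom2 un1 => n domn un.
have pw x : `|q (x + u n) - q x| <= k (x + u n) + `|g (x + u n) - g x| * \1_E x + k x.
  rewrite /k !indicE.
  have [xE|xE] := boolP (x \in E).
    have -> : x \in E'.
      move: xE; rewrite !inE /E /E' /= !in_itv/= => /andP[? ?]; apply/andP; split; lra.
    have -> : x + u n \in E'.
      move: xE un; rewrite !inE /E /E' /= !in_itv/= ler_norml => /andP[? ?] /andP[? ?].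
      by apply/andP; split; lra.
    rewrite !mulr1.
    have -> : q (x + u n) - q x = (q (x + u n) - g (x + u n)) + (g (x + u n) - g x) - (q x - g x) by ring.
    by rewrite (le_trans (ler_normB _ _))// lerD2r ler_normD.
  have xM : M + 1 < `|x|.
    rewrite ltNge; apply: contra xE; rewrite inE /E/= in_itv/= ler_norml => /andP[-> ->//].
  rewrite (qs x) ?(qs (x + u n)) ?subrr ?normr0.
  - by rewrite mulr0 addr0 addr_ge0// mulr_ge0.
  - have : `|x| <= `|x + u n| + `|u n|.
      by rewrite -{1}(addrK (u n) x) ler_normB.
    lra.
  - by lra.
have mk' : measurable_fun [set: mR] (fun x : mR => k (x + u n)) by exact: measurable_shift.
have mgg : measurable_fun [set: mR] (fun x : mR => `|g (x + u n) - g x| * \1_E x).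
  apply: measurable_funM => //; apply: measurableT_comp => //.
  by apply: measurable_funB => //; exact: measurable_shift.
apply: (@le_trans _ _ (\int[lam]_x ((k (x + u n))%:E +
    (`|g (x + u n) - g x| * \1_E x)%:E + (k x)%:E))%E).
  apply: ge0_le_integral => //.
  - apply/measurable_EFinP/measurableT_comp => //; apply: measurable_funB => //.
    exact: measurable_shift.
  - by apply/measurable_EFinP; apply: measurable_funD => //; exact: measurable_funD.
  - by move=> x _; rewrite -!EFinD lee_fin.
have g0 x : 0 <= `|g (x + u n) - g x| * \1_E x by rewrite mulr_ge0.
rewrite ge0_integralD; [|by []| | | |]; last 4 first.
- by move=> x _; rewrite -EFinD lee_fin addr_ge0.
- by apply/measurable_EFinP; exact: measurable_funD.
- by move=> x _; rewrite lee_fin.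
- exact/measurable_EFinP.
rewrite ge0_integralD; [|by []| | | |]; last 4 first.
- by move=> x _; rewrite lee_fin.
- exact/measurable_EFinP.
- by move=> x _; rewrite lee_fin.
- exact/measurable_EFinP.
rewrite (@ge0_integral_shift (EFin \o k))//; last exact/measurable_EFinP.
have -> : (\int[lam]_x (`|g (x + u n) - g x| * \1_E x)%:E =
    \int[lam]_(x in E) `|g (x + u n) - g x|%:E)%E.
  rewrite [RHS]integral_mkcond; apply: eq_integral => x _.
  by rewrite patchE indicE; case: ifP => _; rewrite ?mulr1 ?mulr0.
rewrite (_ : e%:E = ((e / 4)%:E + (e / 4)%:E + (e / 4)%:E) + (e / 4)%:E)%E; last first.
  by rewrite -!EFinD; congr EFin; field.
rewrite -[leLHS]adde0; apply: leeD; last by rewrite lee_fin ltW// divr_gt0.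
by apply: leeD; [apply: leeD|]; exact: ltW.
Qed.

(** If q is bounded by M, the square of its increment is at most 2 M times the absolute
    value of the increment, which brings in the L1 statement; cutting p off where it is
    large or far away changes it little in L2. *)
Lemma L2_translation_cvg (p : mR -> R) : measurable_fun setT p ->
  (\int[lam]_x ((p x) ^+ 2)%:E < +oo)%E ->
  (\int[lam]_x ((p (x + u n) - p x) ^+ 2)%:E)%E @[n --> \oo] --> 0%E.
Proof.
move=> mp p2.
apply: ereal_cvg0P => [n|e e0].
  by apply: integral_ge0 => x _; rewrite lee_fin sqr_ge0.
pose r (x : mR) := Num.max `|x| `|p x|.
have mr : measurable_fun setT r.
  by apply: measurable_maxr => //; exact: (measurableT_comp (@normr_measurable R setT) mp).
have mp2 : measurable_fun setT (fun x => p x ^+ 2) by exact: measurable_funX.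
have tc := tail_integral_cvg0 mp2 mr (fun x => sqr_ge0 _) p2.
have : \forall n \near \oo, (\int[lam]_(x in [set x | (n%:R <= r x)%R]) (p x ^+ 2)%:E < (e / 12)%:E)%E.
  by apply: ereal_cvg0_lt tc _; rewrite divr_gt0.
case=> N _ /(_ N.+1 (leqW (leqnn _))) /=; set S := [set x | _] => pS.
have mS : measurable S by exact: measurable_superlevel.
pose q x := if N.+1%:R <= r x then 0 else p x.
have mq : measurable_fun setT q.
  rewrite (_ : q = p \_ (~` S)).
    apply/(measurable_restrictT _ _).1; first exact: measurableC.
    exact: measurable_funTS.
  apply/funext => x; rewrite /q patchE in_setC.
  by case: ifPn => h; [rewrite mem_set|rewrite memNset//; exact/negP].
have rq x : (p x - q x) ^+ 2 = if N.+1%:R <= r x then p x ^+ 2 else 0.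
  by rewrite /q; case: ifPn => _; rewrite ?subr0// subrr expr0n.
have pq : (\int[lam]_x ((p x - q x) ^+ 2)%:E < (e / 12)%:E)%E.
  rewrite (le_lt_trans _ pS)// le_eqVlt; apply/orP; left; apply/eqP.
  rewrite [RHS]integral_mkcond; apply: eq_integral => x _; rewrite patchE rq.
  by case: ifPn => h; [rewrite mem_set|rewrite memNset//; exact/negP].
have qM x : `|q x| <= N.+1%:R.
  rewrite /q; case: ifPn; rewrite ?normr0// -ltNge gt_max => /andP[_ /ltW]//.
have qs x : N.+1%:R < `|x| -> q x = 0.
  by rewrite /q => Nx; rewrite ifT// le_max ltW.
have e1 : 0 < e / 6 / (2 * N.+1%:R) by rewrite !divr_gt0// mulr_gt0.
have := L1_translation_bounded mq (ltr0Sn _ N) qM qs e1.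
apply: filterS => n qn.
have mqu : measurable_fun [set: mR] (fun x : mR => q (x + u n)) by exact: measurable_shift.
have mpu : measurable_fun [set: mR] (fun x : mR => p (x + u n)) by exact: measurable_shift.
have mpq : measurable_fun [set: mR] (fun x : mR => (p x - q x) ^+ 2).
  by apply: measurable_funX; exact: measurable_funB.
have mpqu : measurable_fun [set: mR] (fun x : mR => (p (x + u n) - q (x + u n)) ^+ 2).
  by apply: measurable_funX; exact: measurable_funB.
have mqq : measurable_fun [set: mR] (fun x : mR => `|q (x + u n) - q x|).
  by apply: measurableT_comp => //; exact: measurable_funB.
have i1 : (\int[lam]_x ((p (x + u n) - q (x + u n)) ^+ 2)%:E =
           \int[lam]_x ((p x - q x) ^+ 2)%:E)%E.
  rewrite (@ge0_integral_shift (EFin \o (fun x => (p x - q x) ^+ 2)))//.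
    exact/measurable_EFinP.
  by move=> x; rewrite lee_fin sqr_ge0.
(* The increment of p is that of q plus two errors p - q. From
   (a + b - c)^2 <= 3 (a^2 + b^2 + c^2) the three parts contribute e/4, e/2 and e/4. *)
apply: (@le_trans _ _ (\int[lam]_x (3%:E * ((p (x + u n) - q (x + u n)) ^+ 2)%:E +
    (3 * (2 * N.+1%:R))%:E * `|q (x + u n) - q x|%:E + 3%:E * ((p x - q x) ^+ 2)%:E))%E).
  apply: ge0_le_integral => //.
  - by move=> x _; rewrite lee_fin sqr_ge0.
  - by apply/measurable_EFinP; apply: measurable_funX; exact: measurable_funB.
  - apply/measurable_EFinP; apply: measurable_funD; last exact: measurable_funM.
    by apply: measurable_funD; exact: measurable_funM.
  - move=> x _; rewrite -!EFinM -!EFinD lee_fin.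
    have h1 : `|q (x + u n) - q x| ^+ 2 <= (2 * N.+1%:R) * `|q (x + u n) - q x|.
      rewrite expr2 ler_wpM2r// (le_trans (ler_normB _ _))//.
      by have := qM x; have := qM (x + u n); lra.
    rewrite real_normK ?num_real// in h1.
    have h2 (A B C : R) : (A + B - C) ^+ 2 <= 3 * A ^+ 2 + 3 * B ^+ 2 + 3 * C ^+ 2.
      have := sqr_ge0 (A - B); have := sqr_ge0 (A + C); have := sqr_ge0 (B + C).
      by nra.
    have := h2 (p (x + u n) - q (x + u n)) (q (x + u n) - q x) (p x - q x).
    have -> : p (x + u n) - q (x + u n) + (q (x + u n) - q x) - (p x - q x) =
      p (x + u n) - p x by ring.
    by move/le_trans; apply; rewrite lerD2r lerD2l -mulrA ler_wpM2l.
have ge3 : (0 <= 3 :> R) by [].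
have geN : (0 <= 3 * (2 * N.+1%:R) :> R) by rewrite mulr_ge0// mulr_ge0.
have m1 := proj2 (measurable_EFinP _ _) mpqu.
have m2 := proj2 (measurable_EFinP _ _) mqq.
have m3 := proj2 (measurable_EFinP _ _) mpq.
have sq0 (z : R) : (0 <= (z ^+ 2)%:E)%E by rewrite lee_fin sqr_ge0.
rewrite ge0_integralD; [|by []| | | |]; last 4 first.
- by move=> x _; rewrite adde_ge0// mule_ge0.
- by apply: emeasurable_funD; exact: measurable_funeM.
- by move=> x _; rewrite mule_ge0.
- exact: measurable_funeM.
rewrite ge0_integralD; [|by []| | | |]; last 4 first.
- by move=> x _; rewrite mule_ge0.
- exact: measurable_funeM.
- by move=> x _; rewrite mule_ge0.
- exact: measurable_funeM.
rewrite !ge0_integralZl //.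
rewrite i1.
rewrite (_ : e%:E = 3%:E * (e / 12)%:E +
    (3 * (2 * N.+1%:R))%:E * (e / 6 / (2 * N.+1%:R))%:E + 3%:E * (e / 12)%:E)%E; last first.
  rewrite -!EFinM -!EFinD; congr EFin.
  by have := ltr0Sn R N; move: (N.+1%:R) => c c0; field; rewrite gt_eqF.
by apply: leeD; [apply: leeD|]; apply: lee_wpmul2l => //; exact: ltW.
Qed.

End translation.

(** * The Poisson kernel *)

Section trig_comp.
Context {R : realType}.

Lemma measurable_cos_comp d (T : measurableType d) (g : T -> R) :
  measurable_fun setT g -> measurable_fun setT (fun x => cos (g x)).
Proof.
apply: (measurableT_comp (f := (cos : R -> R))).
by apply: continuous_measurable_fun; exact: continuous_cos.
Qed.

Lemma measurable_sin_comp d (T : measurableType d) (g : T -> R) :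
  measurable_fun setT g -> measurable_fun setT (fun x => sin (g x)).
Proof.
apply: (measurableT_comp (f := (sin : R -> R))).
by apply: continuous_measurable_fun; exact: continuous_sin.
Qed.

End trig_comp.

Section poisson.
Context {R : realType}.
Local Notation mR := (measurableTypeR R).
Local Notation lam := (@lebesgue_measure R).
Implicit Types d u x : R.

Definition abel d x : R := expR (- (d * `|x|)).

Definition poisson d u : R := 2 * d / (d ^+ 2 + u ^+ 2).

Lemma continuous_abel d : continuous (abel d).
Proof.
move=> x; apply: (@continuous_comp _ _ _ (fun x => - (d * `|x|)) expR); last exact: continuous_expR.
apply: continuousN; apply: continuousM; first exact: cst_continuous.
exact: norm_continuous.
Qed.

Lemma measurable_abel d : measurable_fun [set: mR] (abel d : mR -> R).
Proof. apply: continuous_measurable_fun; exact: continuous_abel. Qed.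

Lemma abel_ge0 d x : 0 <= abel d x. Proof. exact: expR_ge0. Qed.

(** Adding 1 to the cosine makes the integrand nonnegative, as the fundamental theorem
    of calculus on a half-line requires; the integral of the cosine part is recovered
    later by subtracting that of the weight. *)
Lemma integral_half_abel d u : 0 < d ->
  (\int[lam]_(x in `[0%R, +oo[) (expR (- (d * x)) * (1 + cos (u * x)))%:E =
   (d^-1 + d / (d ^+ 2 + u ^+ 2))%:E)%E.
Proof.
move=> d0.
have du0 : 0 < d ^+ 2 + u ^+ 2 by rewrite ltr_wpDr ?sqr_ge0// exprn_gt0.
pose f x := expR (- (d * x)) * (1 + cos (u * x)).
pose F x := - d^-1 * expR (- (d * x)) +
  (d ^+ 2 + u ^+ 2)^-1 * (expR (- (d * x)) * (u * sin (u * x) - d * cos (u * x))).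
have dF x : is_derive x (1:R) F (f x).
  apply: is_derive_eq; rewrite /f /GRing.scale/=.
  by field; rewrite !gt_eqF.
have cF : continuous F.
  by move=> x; apply/differentiable_continuous/derivable1_diffP; have [] := dF x.
have cf : continuous f.
  move=> x; apply: (@continuousM _ _ (fun x => expR (- (d * x))) (fun x => 1 + cos (u * x))).
    apply: (@continuous_comp _ _ _ (fun x => - (d * x)) expR); last exact: continuous_expR.
    apply: (@continuousN _ _ _ (fun x => d * x)); exact: mulrl_continuous.
  apply: cvgD; first exact: cvg_cst.
  apply: (@continuous_comp _ _ _ (fun x => u * x) cos); last exact: continuous_cos.
  exact: mulrl_continuous.
have edl : expR (- (d * x)) @[x --> +oo] --> 0.
  have h : (d * x) @[x --> +oo] --> +oo by apply: gt0_cvgMry => //; exact: cvg_id.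
  exact: (@cvg_comp _ _ _ (fun x => d * x) (fun x => expR (- x)) _ _ _ h (@cvgr_expR R)).
have Fl : F x @[x --> +oo] --> 0.
  apply/cvgr0Pnorm_le => e e0.
  pose K := d^-1 + (d ^+ 2 + u ^+ 2)^-1 * (`|u| + d).
  have K0 : 0 < K.
    rewrite ltr_wpDr ?invr_gt0//; apply: mulr_ge0; first by rewrite invr_ge0 ltW.
    by rewrite addr_ge0// ltW.
  have := edl; move/cvgr0Pnorm_le => /(_ (e / K)); rewrite divr_gt0// => /(_ isT).
  apply: filterS => x ex; rewrite /F.
  have -> : e = K * (e / K) by rewrite mulrC divfK// gt_eqF.
  rewrite ger0_norm ?expR_ge0// in ex.
  apply: (@le_trans _ _ (K * expR (- (d * x)))); last by rewrite ler_pM2l.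
  rewrite /K mulrDl (le_trans (ler_normD _ _))// lerD//.
    by rewrite normrM normrN normfV !gtr0_norm// expR_gt0.
  rewrite normrM normfV (gtr0_norm du0). rewrite -mulrA ler_pM2l ?invr_gt0// normrM mulrC.
  rewrite (ger0_norm (expR_ge0 _)) ler_wpM2r ?expR_ge0//.
  rewrite (le_trans (ler_normB _ _))// !normrM (gtr0_norm d0).
  by apply: lerD; rewrite ler_piMr ?sin_max ?cos_max// ltW.
transitivity (0%:E - (F 0)%:E)%E; last first.
  rewrite /F !mulr0 oppr0 expR0 sin0 cos0 -EFinB; congr EFin.
  by field; rewrite !gt_eqF.
apply: (@ge0_continuous_FTC2y _ f F 0 0) => //.
- by move=> x _; rewrite mulr_ge0 ?expR_ge0// -lerBlDl sub0r cos_geN1.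
- exact: continuous_subspaceT.
- exact: cvg_at_right_filter (cF 0).
- by move=> x _; rewrite derive1E; apply: derive_val.
Qed.

Lemma integral_abel1cos d u : 0 < d ->
  (\int[lam]_x (abel d x * (1 + cos (u * x)))%:E =
   (2 * (d^-1 + d / (d ^+ 2 + u ^+ 2)))%:E)%E.
Proof.
move=> d0; rewrite (ge0_symfun_integralT (f := fun x => abel d x * (1 + cos (u * x)))).
- rewrite EFinM -integral_half_abel//; congr (_ * _)%E; rewrite -set_itvcy.
  apply: eq_integral => x; rewrite inE/= in_itv/= andbT => x0.
  by rewrite /abel ger0_norm.
- by move=> x; rewrite mulr_ge0 ?abel_ge0// -lerBlDl sub0r cos_geN1.
- move=> x; apply: (@continuousM _ _ (abel d) (fun x => 1 + cos (u * x))).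
    exact: continuous_abel.
  apply: cvgD; first exact: cvg_cst.
  apply: (@continuous_comp _ _ _ (fun x => u * x) cos); last exact: continuous_cos.
  exact: mulrl_continuous.
- by move=> x; rewrite /abel /= normrN mulrN cosN.
Qed.

Lemma measurable_cosM u : measurable_fun [set: mR] (fun x : mR => cos (u * x)).
Proof. by apply: measurable_cos_comp; exact: measurable_funM. Qed.

Lemma measurable_sinM u : measurable_fun [set: mR] (fun x : mR => sin (u * x)).
Proof. by apply: measurable_sin_comp; exact: measurable_funM. Qed.

Lemma integrable_abel d : 0 < d -> lam.-integrable setT (EFin \o abel d).
Proof.
move=> d0; have mE : measurable_fun [set: mR] (EFin \o (abel d : mR -> R)).
  by apply/measurable_EFinP; exact: measurable_abel.
apply/integrableP; split => //.
apply: (@le_lt_trans _ _ (\int[lam]_x (abel d x * (1 + cos (0 * x)))%:E)%E).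
  apply: ge0_le_integral => //.
  - exact: measurableT_comp.
  - apply/measurable_EFinP/measurable_funM; first exact: measurable_abel.
    by apply: measurable_funD => //; exact: measurable_cosM.
  - move=> x _; rewrite /= lee_fin (ger0_norm (abel_ge0 _ _)) mul0r cos0.
    by rewrite ler_peMr ?abel_ge0// lerDl.
by rewrite integral_abel1cos// ltry.
Qed.

Lemma integrable_abel_cos d u : 0 < d ->
  lam.-integrable setT (fun x => (abel d x * cos (u * x))%:E).
Proof.
move=> d0; apply: le_integrable (integrable_abel d0) => //.
  apply/measurable_EFinP/measurable_funM; first exact: measurable_abel.
  exact: measurable_cosM.
by move=> x _ /=; rewrite lee_fin normrM ler_piMr// cos_max.
Qed.

Lemma Rintegral_abel d : 0 < d -> Rintegral lam setT (abel d) = 2 / d.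
Proof.
move=> d0; apply: (@mulrI R 2); first by rewrite unitfE.
rewrite -RintegralZl//; last exact: integrable_abel.
rewrite /Rintegral (_ : (\int[lam]_x (2 * abel d x)%:E)%E = (2 * (d^-1 + d / (d ^+ 2 + 0 ^+ 2)))%:E).
  by rewrite /=; field; rewrite gt_eqF.
rewrite -integral_abel1cos//; apply: eq_integral => x _.
by rewrite mul0r cos0 mulrC.
Qed.

(** The explicit Fourier transform on which the whole of Plancherel's formula rests:
    the weight regularizes the frequency integral, and the result is a nonnegative
    approximate identity. *)
Lemma Rintegral_abel_cos d u : 0 < d ->
  Rintegral lam setT (fun x => abel d x * cos (u * x)) = poisson d u.
Proof.
move=> d0.
have du0 : 0 < d ^+ 2 + u ^+ 2 by rewrite ltr_wpDr ?sqr_ge0// exprn_gt0.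
apply: (@addrI R (Rintegral lam setT (abel d))).
rewrite -RintegralD//; [|exact: integrable_abel|exact: integrable_abel_cos].
rewrite Rintegral_abel// /Rintegral.
rewrite (_ : (\int[lam]_x (abel d x + abel d x * cos (u * x))%:E)%E =
  (2 * (d^-1 + d / (d ^+ 2 + u ^+ 2)))%:E).
  by rewrite /poisson /=; field; rewrite !gt_eqF.
rewrite -integral_abel1cos//; apply: eq_integral => x _.
by rewrite mulrDr mulr1.
Qed.

Lemma poisson_ge0 d u : 0 < d -> 0 <= poisson d u.
Proof.
move=> d0; rewrite /poisson divr_ge0// ?mulr_ge0 ?ltW//.
by rewrite ltr_wpDr ?sqr_ge0// exprn_gt0.
Qed.

Lemma continuous_poisson d : 0 < d -> continuous (poisson d).
Proof.
move=> d0 x; apply: cvgM; first exact: cvg_cst.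
apply: cvgV; first by rewrite gt_eqF// ltr_wpDr ?sqr_ge0// exprn_gt0.
by apply: cvgD; [exact: cvg_cst|exact: exprn_continuous].
Qed.

Lemma measurable_poisson d : 0 < d -> measurable_fun [set: mR] (poisson d : mR -> R).
Proof. move=> d0; apply: continuous_measurable_fun; exact: continuous_poisson. Qed.

Lemma integral_poisson1 : (\int[lam]_x (poisson 1 x)%:E = (2 * pi)%:E)%E.
Proof.
rewrite (ge0_symfun_integralT (f := poisson 1)).
- rewrite -set_itvcy (@ge0_continuous_FTC2y _ _ (fun x => 2 * atan x) 0 pi).
  + by rewrite atan0 mulr0 sube0 -EFinM.
  + by move=> x _; exact: poisson_ge0.
  + by apply: continuous_subspaceT; exact: continuous_poisson.
  + have -> : pi = 2 * (pi / 2) :> R by rewrite mulrC divfK.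
    by apply: cvgM; [exact: cvg_cst|exact: cvgy_atan].
  + by [].
  + apply: cvg_at_right_filter; apply: cvgM; first exact: cvg_cst.
    exact: continuous_atan.
  + move=> x _; rewrite derive1E derive_val /poisson /GRing.scale/=.
    by rewrite expr1n mulr1.
- by move=> x; exact: poisson_ge0.
- exact: continuous_poisson.
- by move=> x; rewrite /poisson /= sqrrN.
Qed.

End poisson.

(** * Plancherel's formula on the line *)

Section line_transforms.
Context {R : realType}.
Local Notation mR := (measurableTypeR R).
Local Notation lam := (@lebesgue_measure R).

Definition cosint (p : mR -> R) (s : R) : R := Rintegral lam setT (fun x => cos (s * x) * p x).
Definition sinint (p : mR -> R) (s : R) : R := Rintegral lam setT (fun x => sin (s * x) * p x).

Lemma measurable_cos2 : measurable_fun [set: mR * mR] (fun z : mR * mR => cos (z.1 * z.2)).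
Proof.
apply: measurable_cos_comp.
by apply: measurable_funM; [exact: measurable_fst|exact: measurable_snd].
Qed.

Lemma measurable_sin2 : measurable_fun [set: mR * mR] (fun z : mR * mR => sin (z.1 * z.2)).
Proof.
apply: measurable_sin_comp.
by apply: measurable_funM; [exact: measurable_fst|exact: measurable_snd].
Qed.

Lemma integrable_cosM (s : R) (p : mR -> R) : lam.-integrable setT (EFin \o p) ->
  lam.-integrable setT (fun x => (cos (s * x) * p x)%:E).
Proof.
by move=> ip; exact: (integrable_bounded_mul (@measurable_cosM R s) (fun x => cos_max (s * x)) ip).
Qed.

Lemma integrable_sinM (s : R) (p : mR -> R) : lam.-integrable setT (EFin \o p) ->
  lam.-integrable setT (fun x => (sin (s * x) * p x)%:E).
Proof.
by move=> ip; exact: (integrable_bounded_mul (@measurable_sinM R s) (fun x => sin_max (s * x)) ip).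
Qed.

Lemma measurable_cosint (a : mR -> R) : measurable_fun setT a ->
  measurable_fun [set: mR] (cosint a : mR -> R).
Proof.
move=> ma.
apply: (@measurable_Rintegral_param _ _ mR mR R lam (fun z => cos (z.1 * z.2) * a z.2)).
apply: measurable_funM; first exact: measurable_cos2.
exact: (measurableT_comp ma measurable_snd).
Qed.

Lemma measurable_sinint (a : mR -> R) : measurable_fun setT a ->
  measurable_fun [set: mR] (sinint a : mR -> R).
Proof.
move=> ma.
apply: (@measurable_Rintegral_param _ _ mR mR R lam (fun z => sin (z.1 * z.2) * a z.2)).
apply: measurable_funM; first exact: measurable_sin2.
exact: (measurableT_comp ma measurable_snd).
Qed.

End line_transforms.

Section core.
Context {R : realType}.
Local Notation mR := (measurableTypeR R).
Local Notation lam := (@lebesgue_measure R).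
Implicit Types d u : R.
Variable p : mR -> R.
Hypothesis ip : lam.-integrable setT (EFin \o p).
Hypothesis p2 : (\int[lam]_x ((p x) ^+ 2)%:E < +oo)%E.

Let mp : measurable_fun setT p.
Proof. by apply/measurable_EFinP; exact: measurable_int ip. Qed.

Let icos s : lam.-integrable setT (fun x => (cos (s * x) * p x)%:E).
Proof. exact: integrable_cosM. Qed.

Let isin s : lam.-integrable setT (fun x => (sin (s * x) * p x)%:E).
Proof. exact: integrable_sinM. Qed.

Let mcosint : measurable_fun [set: mR] (cosint p : mR -> R).
Proof. exact: measurable_cosint. Qed.

Let msinint : measurable_fun [set: mR] (sinint p : mR -> R).
Proof. exact: measurable_sinint. Qed.

Let N1 := Rintegral lam setT (fun x => `|p x|).

Let iabs : lam.-integrable setT (fun x => (`|p x|)%:E).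
Proof. exact: integrable_norm ip. Qed.

Let cosint_le s : `|cosint p s| <= N1.
Proof.
rewrite (le_trans (le_normr_Rintegral _ (icos s)))//.
apply: le_Rintegral => //; first exact: integrable_norm (icos s).
by move=> x _; rewrite normrM ler_piMl// cos_max.
Qed.

Let sinint_le s : `|sinint p s| <= N1.
Proof.
rewrite (le_trans (le_normr_Rintegral _ (isin s)))//.
apply: le_Rintegral => //; first exact: integrable_norm (isin s).
by move=> x _; rewrite normrM ler_piMl// sin_max.
Qed.

Let mp2 : measurable_fun [set: mR * mR] (fun z => p z.2).
Proof. exact: (measurableT_comp mp measurable_snd). Qed.

Let cossinE s x : cos (s * x) * cosint p s + sin (s * x) * sinint p s =
  Rintegral lam setT (fun y => cos (s * (x - y)) * p y).
Proof.
rewrite /cosint /sinint (RintZl _ (icos s)) (RintZl _ (isin s)).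
rewrite (RintD (integrable_Zl _ (icos s)) (integrable_Zl _ (isin s))).
apply: eq_Rintegral => y _; rewrite mulrBr cosB; ring.
Qed.

(** Fubini turns the Abel mean of the squared transform into a double integral against
    the Poisson kernel; the weight is what makes the triple integral absolutely
    convergent. *)
Let abel_mean d : 0 < d ->
  Rintegral lam setT (fun s => abel d s * (cosint p s ^+ 2 + sinint p s ^+ 2)) =
  Rintegral lam setT (fun x => p x *
    Rintegral lam setT (fun y => p y * poisson d (x - y))).
Proof.
move=> d0.
pose K s x := cos (s * x) * cosint p s + sin (s * x) * sinint p s.
have iabel : lam.-integrable setT (EFin \o (abel d : mR -> R)) by exact: integrable_abel.
have mabel := @measurable_abel R d.
have mK : measurable_fun [set: mR * mR] (fun z : mR * mR => K z.1 z.2).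
  apply: measurable_funD; apply: measurable_funM.
  - exact: measurable_cos2.
  - exact: (measurableT_comp mcosint measurable_fst).
  - exact: measurable_sin2.
  - exact: (measurableT_comp msinint measurable_fst).
have Kle s x : `|K s x| <= 2 * N1.
  rewrite /K (le_trans (ler_normD _ _))// !normrM.
  have := cos_max (s * x); have := sin_max (s * x).
  have := cosint_le s; have := sinint_le s.
  have := normr_ge0 (cosint p s); have := normr_ge0 (sinint p s).
  by nra.
transitivity (Rintegral lam setT (fun s => Rintegral lam setT (fun x => abel d s * K s x * p x))).
  apply: eq_Rintegral => s _.
  have -> : abel d s * (cosint p s ^+ 2 + sinint p s ^+ 2) =
    abel d s * cosint p s * cosint p s + abel d s * sinint p s * sinint p s by ring.
  rewrite {2}/cosint {2}/sinint (RintZl _ (icos s)) (RintZl _ (isin s)).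
  rewrite (RintD (integrable_Zl _ (icos s)) (integrable_Zl _ (isin s))).
  by apply: eq_Rintegral => x _; rewrite /K; ring.
rewrite (@Rintegral_fubini _ _ mR mR R lam lam (fun z => abel d z.1 * K z.1 z.2 * p z.2)); last first.
  apply: (@integrable_le_prod _ _ mR mR R lam lam (fun s => 2 * N1 * abel d s) p) => //=.
  - exact: integrable_Zl.
  - apply: measurable_funM => //; apply: measurable_funM => //.
    exact: (measurableT_comp mabel measurable_fst).
  - move=> s x; rewrite !normrM ler_wpM2r//.
    by rewrite mulrC ler_wpM2r// -normrM (le_trans (Kle _ _))// ler_norm.
apply: eq_Rintegral => x _ /=.
transitivity (p x * Rintegral lam setT (fun s => abel d s * K s x)).
  rewrite RintZl; last first.
    have := integrable_bounded_mul (measurableT_comp mK (measurable_pair2 x))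
      (fun s => Kle s x) iabel.
    by apply: eq_integrable => // s _; rewrite /= mulrC.
  by apply: eq_Rintegral => s _; ring.
congr (_ * _).
transitivity (Rintegral lam setT (fun s => Rintegral lam setT
    (fun y => abel d s * cos (s * (x - y)) * p y))).
  apply: eq_Rintegral => s _; rewrite /K cossinE RintZl.
    by apply: eq_Rintegral => y _; rewrite mulrA.
  apply: le_integrable ip => //.
    apply/measurable_EFinP/measurable_funM => //.
    apply: (measurableT_comp (@measurable_cosM R s)).
    exact: measurable_funB.
  by move=> y _ /=; rewrite lee_fin normrM ler_piMl// cos_max.
rewrite (@Rintegral_fubini _ _ mR mR R lam lam (fun z => abel d z.1 * cos (z.1 * (x - z.2)) * p z.2)); last first.
  apply: (@integrable_le_prod _ _ mR mR R lam lam (abel d) p) => //=.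
  - apply: measurable_funM => //; apply: measurable_funM => //.
      exact: (measurableT_comp mabel measurable_fst).
    apply: (measurableT_comp (f := (cos : mR -> R))).
      by apply: continuous_measurable_fun; exact: continuous_cos.
    apply: measurable_funM; first exact: measurable_fst.
    by apply: measurable_funB => //; exact: measurable_snd.
  - by move=> s y; rewrite !normrM ler_wpM2r// ler_piMr// cos_max.
apply: eq_Rintegral => y _ /=.
rewrite -Rintegral_abel_cos// RintZl; last exact: integrable_abel_cos.
by apply: eq_Rintegral => s _; rewrite mulrC [s * _]mulrC.
Qed.

Definition autocorr (p : mR -> R) (u : R) : R :=
  Rintegral lam setT (fun x => p x * p (x + u)).

Let msq : measurable_fun [set: mR] (fun x => p x ^+ 2).
Proof. exact: measurable_funX. Qed.

Let isq : lam.-integrable setT (fun x => (p x ^+ 2)%:E).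
Proof. by apply: integrable_of_ge0_lty => // x; rewrite sqr_ge0. Qed.

Let isq_shift u : lam.-integrable setT (fun x => (p (x + u) ^+ 2)%:E).
Proof.
have := integrable_affine u (oner_neq0 R) isq.
by apply: eq_integrable => // x _; rewrite mul1r.
Qed.

Let Rsq_shift u : Rintegral lam setT (fun x => p (x + u) ^+ 2) =
  Rintegral lam setT (fun x => p x ^+ 2).
Proof.
rewrite [RHS](Rintegral_affine u (oner_neq0 R) isq) normr1 mul1r.
by apply: eq_Rintegral => x _; rewrite mul1r.
Qed.

Let mshift u : measurable_fun [set: mR] (fun x : mR => p (x + u)).
Proof. exact: measurable_shift. Qed.

Let amgm (a b : R) : `|a * b| <= 2^-1 * (a ^+ 2 + b ^+ 2).
Proof.
rewrite normrM -(real_normK (num_real a)) -(real_normK (num_real b)).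
by have := sqr_ge0 (`|a| - `|b|); nra.
Qed.

Let iautocorr u : lam.-integrable setT (fun x => (p x * p (x + u))%:E).
Proof.
have := integrable_Zl 2^-1 (integrable_D isq (isq_shift u)).
apply: le_integrable => //; first by apply/measurable_EFinP; exact: measurable_funM.
move=> x _; rewrite /= lee_fin [leRHS]ger0_norm ?amgm//.
by rewrite mulr_ge0// addr_ge0// sqr_ge0.
Qed.

(** Polarization: it makes the autocorrelation continuous at 0, because translations
    are continuous in L2. *)
Let autocorrE u : autocorr p u = Rintegral lam setT (fun x => p x ^+ 2) -
  2^-1 * Rintegral lam setT (fun x => (p (x + u) - p x) ^+ 2).
Proof.
have id : lam.-integrable setT (fun x => ((p (x + u) - p x) ^+ 2)%:E).
  have := integrable_D (integrable_D (isq_shift u) isq) (integrable_Zl (- 2) (iautocorr u)).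
  by apply: eq_integrable => // x _; congr EFin; ring.
have := RintD (integrable_D isq (isq_shift u)) (integrable_Zl (- 1) id).
rewrite -(RintD isq (isq_shift u)) -(RintZl _ id) Rsq_shift /autocorr => h.
apply: (@mulfI R 2) => //; rewrite RintZl//.
rewrite (_ : Rintegral lam setT (fun x => 2 * (p x * p (x + u))) =
  Rintegral lam setT (fun x => p x ^+ 2 + p (x + u) ^+ 2 + - 1 * (p (x + u) - p x) ^+ 2)).
  by rewrite -h; field.
by apply: eq_Rintegral => x _; ring.
Qed.

Let autocorr_le u : `|autocorr p u| <= Rintegral lam setT (fun x => p x ^+ 2).
Proof.
rewrite (le_trans (le_normr_Rintegral _ (iautocorr u)))//.
rewrite (_ : Rintegral lam setT (fun x => p x ^+ 2) =
  Rintegral lam setT (fun x => 2^-1 * (p x ^+ 2 + p (x + u) ^+ 2))).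
  apply: le_Rintegral => //.
  - exact: integrable_norm (iautocorr u).
  - exact: (integrable_Zl _ (integrable_D isq (isq_shift u))).
rewrite -RintZl; last exact: (integrable_D isq (isq_shift u)).
rewrite -(RintD isq (isq_shift u)) Rsq_shift.
by field.
Qed.

Let autocorr_cvg (u : nat -> R) : u n @[n --> \oo] --> 0 ->
  autocorr p (u n) @[n --> \oo] --> Rintegral lam setT (fun x => p x ^+ 2).
Proof.
move=> u0; under eq_fun do rewrite autocorrE.
set A := Rintegral _ _ _.
suff : A - 2^-1 * Rintegral lam setT (fun x => (p (x + u n) - p x) ^+ 2)
  @[n --> \oo] --> A - 2^-1 * 0 by rewrite mulr0 subr0.
apply: cvgB; first exact: cvg_cst.
apply: cvgM; first exact: cvg_cst.
exact: (fine_cvg (L2_translation_cvg u0 mp p2)).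
Qed.

Let poisson_scale d u : 0 < d -> d * poisson d (d * u) = poisson 1 u.
Proof.
move=> d0; rewrite /poisson.
have u0 : 0 < 1 + u ^+ 2 by rewrite ltr_wpDr ?sqr_ge0.
have du0 : 0 < d ^+ 2 + (d * u) ^+ 2 by rewrite ltr_wpDr ?sqr_ge0// exprn_gt0.
by field; rewrite !gt_eqF// expr1n.
Qed.

Let poisson_le d u : 0 < d -> `|poisson d u| <= 2 / d.
Proof.
move=> d0; rewrite ger0_norm ?poisson_ge0// /poisson.
have du0 : 0 < d ^+ 2 + u ^+ 2 by rewrite ltr_wpDr ?sqr_ge0// exprn_gt0.
rewrite ler_pdivrMr// mulrAC ler_pdivlMr//.
by have := sqr_ge0 u; nra.
Qed.

Let iaffine d x : 0 < d -> lam.-integrable setT (fun v => (p (d * v + x))%:E).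
Proof. by move=> d0; apply: integrable_affine => //; rewrite gt_eqF. Qed.

(** The substitution y = d v + x moves the small parameter d from the kernel to p, so
    that a fixed integrable weight remains when d tends to 0. *)
Let poisson_conv d x : 0 < d ->
  Rintegral lam setT (fun y => p y * poisson d (x - y)) =
  Rintegral lam setT (fun v => poisson 1 v * p (d * v + x)).
Proof.
move=> d0; have dn0 : d != 0 by rewrite gt_eqF.
have ipp : lam.-integrable setT (fun y => (p y * poisson d (x - y))%:E).
  have mpx : measurable_fun [set: mR] (fun y : mR => poisson d (x - y)).
    apply: (measurableT_comp (measurable_poisson d0)).
    exact: measurable_funB.
  have := integrable_bounded_mul mpx (fun y => poisson_le (x - y) d0) ip.
  by apply: eq_integrable => // y _; rewrite mulrC.
rewrite (Rintegral_affine x dn0 ipp) gtr0_norm// (RintZl _ (integrable_affine x dn0 ipp)).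
apply: eq_Rintegral => v _.
rewrite -(poisson_scale v d0).
have -> : x - (d * v + x) = - (d * v) by ring.
by rewrite /poisson sqrrN; ring.
Qed.

Let ipoisson : lam.-integrable setT (EFin \o (poisson 1 : mR -> R)).
Proof.
apply: integrable_of_ge0_lty.
- by apply: measurable_poisson.
- by move=> x; exact: poisson_ge0.
- by rewrite integral_poisson1 ltry.
Qed.

(** Absolute convergence comes from |a b| <= (a^2 + b^2) / 2, each square being
    integrable with the same integral after a translation. *)
Let poisson_autocorr d : 0 < d ->
  Rintegral lam setT (fun x => p x * Rintegral lam setT (fun y => p y * poisson d (x - y))) =
  Rintegral lam setT (fun v => poisson 1 v * autocorr p (d * v)).
Proof.
move=> d0.
pose F (z : mR * mR) := p z.1 * (poisson 1 z.2 * p (d * z.2 + z.1)).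
have mF : measurable_fun setT F.
  apply: measurable_funM; first exact: (measurableT_comp mp measurable_fst).
  apply: measurable_funM.
    exact: (measurableT_comp (@measurable_poisson R 1 ltr01) measurable_snd).
  apply: (measurableT_comp mp); apply: measurable_funD; last exact: measurable_fst.
  by apply: measurable_funM => //; exact: measurable_snd.
have iF : (lam \x lam)%E.-integrable setT (EFin \o F).
  apply/(@integrable21ltyP _ _ mR mR); first exact/measurable_EFinP.
  apply: (@le_lt_trans _ _ (\int[lam]_v ((Rintegral lam setT (fun x => p x ^+ 2))%:E * (poisson 1 v)%:E))%E).
    apply: ge0_le_integral => //.
    - by move=> v _; exact: integral_ge0.
    - apply: (@measurable_fun_fubini_tonelli_G _ _ mR mR R lam (abse \o (EFin \o F))) => //.
        by apply: measurableT_comp => //; exact/measurable_EFinP.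
      by move=> z; exact: abse_ge0.
    - by apply: measurable_funeM; apply/measurable_EFinP; apply: measurable_poisson.
    move=> v _.
    have -> : ((Rintegral lam setT (fun x => p x ^+ 2))%:E * (poisson 1 v)%:E =
      \int[lam]_x (poisson 1 v * (2^-1 * (p x ^+ 2 + p (x + d * v) ^+ 2)))%:E)%E.
      have i3 := integrable_Zl 2^-1 (integrable_D isq (isq_shift (d * v))).
      rewrite (integrable_EFin_fine _ (integrable_Zl (poisson 1 v) i3)); last first.
        by move=> x; rewrite mulr_ge0 ?poisson_ge0// mulr_ge0// addr_ge0// sqr_ge0.
      rewrite -RintZl// -RintZl; last exact: (integrable_D isq (isq_shift (d * v))).
      rewrite -(RintD isq (isq_shift (d * v))) Rsq_shift -EFinM; congr EFin.
      by field.
    apply: ge0_le_integral => //.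
    - apply: measurableT_comp => //; apply/measurable_EFinP.
      exact: (measurableT_comp mF (measurable_pair2 v)).
    - apply/measurable_EFinP; do 2 apply: measurable_funM => //.
      by apply: measurable_funD => //; exact: measurable_funX.
    - move=> x _; rewrite /F /= lee_fin mulrCA normrM ger0_norm ?poisson_ge0//.
      by rewrite ler_wpM2l ?poisson_ge0// addrC amgm.
  rewrite ge0_integralZl//.
  - by rewrite integral_poisson1 -EFinM ltry.
  - by apply/measurable_EFinP; apply: measurable_poisson.
  - by move=> v _; rewrite lee_fin poisson_ge0.
  - by rewrite lee_fin; apply: Rintegral_ge0 => x _; rewrite sqr_ge0.
transitivity (Rintegral lam setT (fun x => Rintegral lam setT (fun v => F (x, v)))).
  apply: eq_Rintegral => x _; rewrite poisson_conv// RintZl//.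
  apply: integrable_bounded_mul (iaffine x d0).
  - exact: measurable_poisson.
  - by move=> v; exact: poisson_le.
rewrite (@Rintegral_fubini _ _ mR mR R lam lam F iF).
apply: eq_Rintegral => v _; rewrite /autocorr RintZl//.
by apply: eq_Rintegral => x _; rewrite /F/= mulrCA addrC.
Qed.

Let mautocorr : measurable_fun [set: mR] (autocorr p : mR -> R).
Proof.
apply: (@measurable_Rintegral_param _ _ mR mR R lam (fun z => p z.2 * p (z.2 + z.1))).
apply: measurable_funM => //; apply: (measurableT_comp mp).
by apply: measurable_funD; [exact: measurable_snd|exact: measurable_fst].
Qed.

Let del n : R := n.+1%:R^-1.

Let del_gt0 n : 0 < del n. Proof. by rewrite invr_gt0. Qed.

Let del_cvg : del n @[n --> \oo] --> 0.
Proof. exact: cvg_harmonic. Qed.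

(** Approximate identity: as d tends to 0 the Poisson average of the autocorrelation
    tends to its value at 0 times the mass 2 pi of the kernel. *)
Let abel_mean_cvg :
  (\int[lam]_s (abel (del n) s * (cosint p s ^+ 2 + sinint p s ^+ 2))%:E)%E @[n --> \oo] -->
  (2 * pi * Rintegral lam setT (fun x => p x ^+ 2))%:E.
Proof.
set A := Rintegral lam setT (fun x => p x ^+ 2).
have A0 : 0 <= A by apply: Rintegral_ge0 => x _; rewrite sqr_ge0.
rewrite (_ : (fun n => _) = (fun n => \int[lam]_v (poisson 1 v * autocorr p (del n * v))%:E)%E).
  have [||||_ _] := @dominated_convergence _ _ _ lam setT measurableT
    (fun n v => (poisson 1 v * autocorr p (del n * v))%:E)
    (fun v => (poisson 1 v * A)%:E) (fun v => (A * poisson 1 v)%:E) _ _ _ (integrable_Zl A ipoisson).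
  - move=> n; apply/measurable_EFinP/measurable_funM; first exact: measurable_poisson.
    by apply: (measurableT_comp mautocorr); exact: measurable_funM.
  - by apply/measurable_EFinP/measurable_funM => //; exact: measurable_poisson.
  - apply: aeW => v _; apply: cvg_EFin; first exact: nearW.
    apply: cvgM; first exact: cvg_cst.
    apply: autocorr_cvg; rewrite -[X in _ --> X](mul0r v).
    by apply: cvgM; [exact: del_cvg|exact: cvg_cst].
  - apply: aeW => v n _; rewrite /= lee_fin normrM mulrC (ger0_norm (poisson_ge0 _ ltr01)).
    by rewrite ler_wpM2r ?poisson_ge0// autocorr_le.
  have -> : (\int[lam]_v (poisson 1 v * A)%:E = (2 * pi * A)%:E)%E.
    transitivity (\int[lam]_v (A%:E * (poisson 1 v)%:E))%E.
      by apply: eq_integral => v _; rewrite -EFinM mulrC.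
    rewrite ge0_integralZl//.
    - by rewrite integral_poisson1 -EFinM mulrC.
    - by apply/measurable_EFinP; apply: measurable_poisson.
    - by move=> v _; rewrite lee_fin poisson_ge0.
  by [].
apply/funext => n.
have iL : lam.-integrable setT (fun s => (abel (del n) s * (cosint p s ^+ 2 + sinint p s ^+ 2))%:E).
  have mcs : measurable_fun [set: mR] (fun s => cosint p s ^+ 2 + sinint p s ^+ 2).
    by apply: measurable_funD; exact: measurable_funX.
  have bcs s : `|cosint p s ^+ 2 + sinint p s ^+ 2| <= 2 * N1 ^+ 2.
    rewrite ger0_norm ?addr_ge0 ?sqr_ge0// -(real_normK (num_real (cosint p s))).
    rewrite -(real_normK (num_real (sinint p s))).
    have := cosint_le s; have := sinint_le s.
    by have := normr_ge0 (cosint p s); have := normr_ge0 (sinint p s); nra.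
  have := integrable_bounded_mul mcs bcs (integrable_abel (del_gt0 n)).
  by apply: eq_integrable => // s _; rewrite mulrC.
rewrite integrable_EFin_fine//; last first.
  by move=> s; rewrite mulr_ge0 ?abel_ge0// addr_ge0// sqr_ge0.
rewrite abel_mean// poisson_autocorr// /Rintegral fineK// integrable_fin_num//.
apply: le_integrable (integrable_Zl A ipoisson) => //.
  apply/measurable_EFinP/measurable_funM; first exact: measurable_poisson.
  by apply: (measurableT_comp mautocorr); exact: measurable_funM.
move=> v _; rewrite /= lee_fin normrM mulrC.
rewrite [leRHS]ger0_norm; last by apply: mulr_ge0 => //; exact: poisson_ge0.
by rewrite (ger0_norm (poisson_ge0 _ ltr01)) ler_wpM2r ?poisson_ge0// autocorr_le.
Qed.

(** The Abel means increase to the integral of the squared transform, by monotone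
    convergence, and their limit has just been computed in another way. *)
Lemma plancherel_line_real :
  (\int[lam]_s (cosint p s ^+ 2 + sinint p s ^+ 2)%:E =
   (2 * pi)%:E * \int[lam]_x (p x ^+ 2)%:E)%E.
Proof.
rewrite (integrable_EFin_fine (fun x => sqr_ge0 (p x)) isq).
rewrite -EFinM -(cvg_lim _ abel_mean_cvg)//.
have cs0 s : 0 <= cosint p s ^+ 2 + sinint p s ^+ 2 by rewrite addr_ge0// sqr_ge0.
have := @cvg_monotone_convergence _ _ _ lam setT measurableT
  (fun n s => (abel (del n) s * (cosint p s ^+ 2 + sinint p s ^+ 2))%:E).
move=> /(_ _ _ _)/cvg_lim => H.
rewrite H//.
- apply: eq_integral => s _; apply/esym/cvg_lim => //.
  apply: cvg_EFin; first exact: nearW.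
  have ds : - (del n * `|s|) @[n --> \oo] --> 0.
    have : - (del n * `|s|) @[n --> \oo] --> - (0 * `|s|).
      by apply: cvgN; apply: cvgM; [exact: del_cvg|exact: cvg_cst].
    by rewrite mul0r oppr0.
  have : abel (del n) s * (cosint p s ^+ 2 + sinint p s ^+ 2) @[n --> \oo] -->
      expR 0 * (cosint p s ^+ 2 + sinint p s ^+ 2).
    apply: cvgM; last exact: cvg_cst.
    exact: (cvg_comp _ _ ds (@continuous_expR R 0)).
  by rewrite expR0 mul1r.
- move=> n; apply/measurable_EFinP/measurable_funM; first exact: measurable_abel.
  by apply: measurable_funD; exact: measurable_funX.
- by move=> n s _; rewrite lee_fin mulr_ge0// abel_ge0.
- move=> s _ m n mn; rewrite lee_fin ler_wpM2r//.
  by rewrite ler_expR lerN2 ler_wpM2r// lef_pV2 ?posrE// ler_nat.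
Qed.

End core.

Section rint_opp.
Context d (T : measurableType d) (R : realType) (mu : {measure set T -> \bar R}).

Lemma RintN (f : T -> R) :
  Rintegral mu setT (fun x => - f x) = - Rintegral mu setT f.
Proof.
rewrite /Rintegral integralE [in RHS]integralE.
rewrite (_ : (fun x => (- f x)%:E)^\+ = (fun x => (f x)%:E)^\-)%E; last first.
  by apply/funext => x; rewrite funeposE funenegE.
rewrite (_ : (fun x => (- f x)%:E)^\- = (fun x => (f x)%:E)^\+)%E; last first.
  by apply/funext => x; rewrite funeposE funenegE /= opprK.
have := @integral_ge0 _ _ _ mu setT (fun x => (f x)%:E)^\+%E (fun x _ => funepos_ge0 _ x).
have := @integral_ge0 _ _ _ mu setT (fun x => (f x)%:E)^\-%E (fun x _ => funeneg_ge0 _ x).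
case: (\int[mu]_x _)%E => [a| |] //; case: (\int[mu]_x _)%E => [b| |] // _ _ /=; rewrite ?oppr0//.
by rewrite opprB.
Qed.

End rint_opp.

Section planch_line.
Context {R : realType}.
Local Notation mR := (measurableTypeR R).
Local Notation lam := (@lebesgue_measure R).

(** For the complex function a + i b, the real part of the transform is ft1 a b and its
    imaginary part is ft1 b (- a). *)
Definition ft1 (a b : mR -> R) (s : R) : R :=
  Rintegral lam setT (fun x => cos (s * x) * a x + sin (s * x) * b x).

Lemma ft1E (a b : mR -> R) (s : R) :
  lam.-integrable setT (EFin \o a) -> lam.-integrable setT (EFin \o b) ->
  ft1 a b s = cosint a s + sinint b s.
Proof.
by move=> ia ib; rewrite /cosint /sinint RintD//;
  [exact: integrable_cosM|exact: integrable_sinM].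
Qed.

Lemma cosintN (a : mR -> R) s : cosint a (- s) = cosint a s.
Proof. by apply: eq_Rintegral => x _; rewrite mulNr cosN. Qed.

Lemma sinintN (a : mR -> R) s : sinint a (- s) = - sinint a s.
Proof.
by rewrite -RintN; apply: eq_Rintegral => x _; rewrite mulNr sinN mulNr.
Qed.

Lemma sinintNf (a : mR -> R) s : sinint (fun x => - a x) s = - sinint a s.
Proof. by rewrite -RintN; apply: eq_Rintegral => x _; rewrite mulrN. Qed.

(** For a complex function the cross terms are odd in the frequency, so they disappear
    when the integrand is averaged with its reflection. *)
Lemma plancherel_line (a b : mR -> R) :
  lam.-integrable setT (EFin \o a) -> lam.-integrable setT (EFin \o b) ->
  (\int[lam]_x (a x ^+ 2)%:E < +oo)%E -> (\int[lam]_x (b x ^+ 2)%:E < +oo)%E ->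
  (\int[lam]_s (ft1 a b s ^+ 2 + ft1 b (fun x => - a x) s ^+ 2)%:E =
   (2 * pi)%:E * \int[lam]_x (a x ^+ 2 + b x ^+ 2)%:E)%E.
Proof.
move=> ia ib a2 b2.
have ma : measurable_fun setT a by apply/measurable_EFinP; exact: measurable_int ia.
have mb : measurable_fun setT b by apply/measurable_EFinP; exact: measurable_int ib.
have [mca msa] := (measurable_cosint ma, measurable_sinint ma).
have [mcb msb] := (measurable_cosint mb, measurable_sinint mb).
pose E s := (cosint a s + sinint b s) ^+ 2 + (cosint b s - sinint a s) ^+ 2.
have E0 s : (0 <= (E s)%:E)%E by rewrite lee_fin addr_ge0// sqr_ge0.
have mE : measurable_fun [set: mR] (fun s : mR => (E s)%:E).
  apply/measurable_EFinP; apply: measurable_funD; apply: measurable_funX.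
    exact: measurable_funD.
  exact: measurable_funB.
have mH (c : mR -> R) : measurable_fun setT c ->
    measurable_fun [set: mR] (fun s => (cosint c s ^+ 2 + sinint c s ^+ 2)%:E).
  move=> mc; apply/measurable_EFinP; apply: measurable_funD; apply: measurable_funX.
    exact: measurable_cosint.
  exact: measurable_sinint.
have H0 (c : mR -> R) s : (0 <= (cosint c s ^+ 2 + sinint c s ^+ 2)%:E)%E.
  by rewrite lee_fin addr_ge0// sqr_ge0.
transitivity (\int[lam]_s (E s)%:E)%E.
  apply: eq_integral => s _; rewrite !ft1E// ?sinintNf//.
  exact: integrable_N.
have refl : (\int[lam]_s (E s)%:E = \int[lam]_s (E (- s))%:E)%E.
  have N10 : (-1 : R) != 0 by rewrite oppr_eq0 oner_neq0.
  rewrite (@ge0_integral_affine _ (-1) 0 (EFin \o E) N10)// normrN1 mul1e.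
  by apply: eq_integral => s _; rewrite /= mulN1r addr0.
have mEN : measurable_fun [set: mR] (fun s : mR => (E (- s))%:E).
  by apply: (measurableT_comp mE); exact: measurable_funN.
have key : (2%:E * \int[lam]_s (E s)%:E = 2%:E * ((2 * pi)%:E * \int[lam]_x (a x ^+ 2 + b x ^+ 2)%:E))%E.
  rewrite [LHS]mule_natl mule2n [X in (_ + X)%E]refl -ge0_integralD//.
  transitivity (\int[lam]_s (2%:E * ((cosint a s ^+ 2 + sinint a s ^+ 2)%:E +
      (cosint b s ^+ 2 + sinint b s ^+ 2)%:E)))%E.
    apply: eq_integral => s _; rewrite -!EFinD -EFinM; congr EFin.
    by rewrite /E !cosintN !sinintN; ring.
  rewrite ge0_integralZl//; last 2 first.
  - by apply: emeasurable_funD; exact: mH.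
  - by move=> s _; rewrite adde_ge0// H0.
  rewrite ge0_integralD//; [|exact: mH|exact: mH].
  rewrite !plancherel_line_real// -ge0_muleDr; last 2 first.
  - by apply: integral_ge0 => x _; rewrite lee_fin sqr_ge0.
  - by apply: integral_ge0 => x _; rewrite lee_fin sqr_ge0.
  congr (_ * (_ * _))%E; rewrite -ge0_integralD//.
  - by move=> x _; rewrite lee_fin sqr_ge0.
  - exact/measurable_EFinP/measurable_funX.
  - by move=> x _; rewrite lee_fin sqr_ge0.
  - exact/measurable_EFinP/measurable_funX.
have := congr1 (fun z => ((2^-1)%:E * z)%E) key.
by rewrite !muleA -!EFinM mulVf// !mul1e mul1r.
Qed.

End planch_line.

(** * Plancherel's formula for integrable functions of several variables *)

Section tuples.
Context {R : realType}.
Local Notation mR := (measurableTypeR R).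
Local Notation lam := (@lebesgue_measure R).
Local Notation mu := (@lebesgue_tuple R).

Lemma ge0_integral_cons_prod n (F : n.+1.-tuple R -> \bar R) :
  measurable_fun setT F -> (forall x, 0 <= F x)%E ->
  (\int[mu n.+1]_x F x = \int[lam \x mu n]_z F (cons_pair z))%E.
Proof.
move=> mF F0; exact: (ge0_integral_pushforward (@measurable_cons_pair R n)).
Qed.

Lemma ge0_integral_cons n (F : n.+1.-tuple R -> \bar R) :
  measurable_fun setT F -> (forall x, 0 <= F x)%E ->
  (\int[mu n.+1]_x F x = \int[lam]_t \int[mu n]_y F (cons_pair (t, y)))%E.
Proof.
move=> mF F0; rewrite ge0_integral_cons_prod//.
rewrite (@fubini_tonelli1 _ _ mR (n.-tuple R) R lam (mu n) (F \o (@cons_pair R n)))//.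
  exact: (measurableT_comp mF (@measurable_cons_pair R n)).
by move=> z; exact: F0.
Qed.

Lemma Rintegral_cons n (F : n.+1.-tuple R -> R) : measurable_fun setT F ->
  Rintegral (mu n.+1) setT F = Rintegral (lam \x mu n)%E setT (F \o @cons_pair R n).
Proof.
move=> mF; rewrite /Rintegral integralE [in RHS]integralE.
have mE : measurable_fun setT (EFin \o F) by exact/measurable_EFinP.
rewrite (ge0_integral_cons_prod (measurable_funepos mE))//.
rewrite (ge0_integral_cons_prod (measurable_funeneg mE))//.
by congr (fine (_ - _))%E; apply: eq_integral => z _; rewrite !(funeposE, funenegE).
Qed.

Lemma integrable_cons n (F : n.+1.-tuple R -> R) :
  (mu n.+1).-integrable setT (EFin \o F) ->
  (lam \x mu n)%E.-integrable setT (EFin \o (F \o @cons_pair R n)).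
Proof.
move=> /integrableP[mF lF]; apply/integrableP; split.
  exact: (measurableT_comp mF (@measurable_cons_pair R n)).
move: lF; rewrite ge0_integral_cons_prod//; first exact: measurableT_comp.
Qed.

Lemma dott_cons n (s t : R) (x y : n.-tuple R) :
  dott (cons_pair (s, x)) (cons_pair (t, y)) = s * t + dott x y.
Proof.
rewrite /dott big_ord_recl; congr (_ + _); apply: eq_bigr => i _.
by rewrite !(tnth_nth 0).
Qed.

Lemma measurable_dott2 n : measurable_fun [set: n.-tuple R * n.-tuple R]
  (fun z : n.-tuple R * n.-tuple R => dott z.1 z.2).
Proof.
rewrite /dott; apply: measurable_sum => i; apply: measurable_funM.
  exact: (measurableT_comp (@measurable_tnth _ R n i) measurable_fst).
exact: (measurableT_comp (@measurable_tnth _ R n i) measurable_snd).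
Qed.

Lemma measurable_dott n (xi : n.-tuple R) : measurable_fun setT (dott xi).
Proof. exact: (measurableT_comp (@measurable_dott2 n) (measurable_pair1 xi)). Qed.

(** As on the line, the transform of p + i q has real part ft p q and imaginary part
    ft q (- p), so that one real formula serves for both. *)
Definition ft n (p q : n.-tuple R -> R) (xi : n.-tuple R) : R :=
  Rintegral (mu n) setT (fun x => cos (dott xi x) * p x + sin (dott xi x) * q x).

Lemma integrable_cos_dott n (xi : n.-tuple R) (p : n.-tuple R -> R) :
  (mu n).-integrable setT (EFin \o p) ->
  (mu n).-integrable setT (fun x => (cos (dott xi x) * p x)%:E).
Proof.
apply: (integrable_bounded_mul _ (fun x => cos_max (dott xi x))).
by apply: measurable_cos_comp; exact: measurable_dott.
Qed.

Lemma integrable_sin_dott n (xi : n.-tuple R) (p : n.-tuple R -> R) :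
  (mu n).-integrable setT (EFin \o p) ->
  (mu n).-integrable setT (fun x => (sin (dott xi x) * p x)%:E).
Proof.
apply: (integrable_bounded_mul _ (fun x => sin_max (dott xi x))).
by apply: measurable_sin_comp; exact: measurable_dott.
Qed.

Lemma measurable_ft n (p q : n.-tuple R -> R) :
  measurable_fun setT p -> measurable_fun setT q -> measurable_fun setT (ft p q).
Proof.
move=> mp mq; apply: (@measurable_Rintegral_param _ _ _ _ R (mu n)
  (fun z => cos (dott z.1 z.2) * p z.2 + sin (dott z.1 z.2) * q z.2)).
have md := @measurable_dott2 n.
apply: measurable_funD; apply: measurable_funM.
- exact: measurable_cos_comp.
- exact: (measurableT_comp mp measurable_snd).
- exact: measurable_sin_comp.
- exact: (measurableT_comp mq measurable_snd).
Qed.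

Lemma ftN n (p q : n.-tuple R -> R) xi :
  ft (fun x => - p x) (fun x => - q x) xi = - ft p q xi.
Proof. by rewrite -RintN; apply: eq_Rintegral => x _; rewrite !mulrN opprD. Qed.

Section step.
Variables (n : nat) (p q : n.+1.-tuple R -> R).
Hypothesis ip : (mu n.+1).-integrable setT (EFin \o p).
Hypothesis iq : (mu n.+1).-integrable setT (EFin \o q).

Definition slice (p : n.+1.-tuple R -> R) (t : R) (y : n.-tuple R) : R := p (cons_pair (t, y)).

Let mp : measurable_fun setT p.
Proof. by apply/measurable_EFinP; exact: measurable_int ip. Qed.
Let mq : measurable_fun setT q.
Proof. by apply/measurable_EFinP; exact: measurable_int iq. Qed.
Let mpc : measurable_fun setT (p \o @cons_pair R n).
Proof. exact: (measurableT_comp mp (@measurable_cons_pair R n)). Qed.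
Let mqc : measurable_fun setT (q \o @cons_pair R n).
Proof. exact: (measurableT_comp mq (@measurable_cons_pair R n)). Qed.

(** Fubini and the addition formulas of sine and cosine. The inner transform makes sense
    at almost every t, where the slices are integrable. *)
Lemma ft_cons (s : R) (eta : n.-tuple R) : ft p q (cons_pair (s, eta)) =
  ft1 (fun t => ft (slice p t) (slice q t) eta)
      (fun t => ft (slice q t) (fun y => - slice p t y) eta) s.
Proof.
pose F (z : mR * n.-tuple R) := cos (s * z.1 + dott eta z.2) * p (cons_pair z) +
  sin (s * z.1 + dott eta z.2) * q (cons_pair z).
have iF : (lam \x mu n)%E.-integrable setT (EFin \o F).
  have := integrable_cons (integrable_D (integrable_cos_dott (cons_pair (s, eta)) ip)
    (integrable_sin_dott (cons_pair (s, eta)) iq)).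
  by apply: eq_integrable => // -[t y] _ /=; rewrite dott_cons.
have mF : measurable_fun setT F by apply/measurable_EFinP; exact: measurable_int iF.
have maff : measurable_fun setT (fun x : n.+1.-tuple R => cos (dott (cons_pair (s, eta)) x) * p x + sin (dott (cons_pair (s, eta)) x) * q x).
  by apply/measurable_EFinP; apply: measurable_int; exact: (integrable_D (integrable_cos_dott (cons_pair (s, eta)) ip)
    (integrable_sin_dott (cons_pair (s, eta)) iq)).
rewrite /ft Rintegral_cons//.
transitivity (Rintegral (lam \x mu n)%E setT F).
  by apply: eq_Rintegral => -[t y] _ /=; rewrite dott_cons.
rewrite Rintegral_prod12// /ft1 /Rintegral; congr fine.
have mft (a b : n.+1.-tuple R -> R) : measurable_fun setT (a \o @cons_pair R n) ->
    measurable_fun setT (b \o @cons_pair R n) ->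
    measurable_fun [set: mR] (fun t : mR => ft (slice a t) (slice b t) eta).
  move=> ma mb; apply: (@measurable_Rintegral_param _ _ mR _ R (mu n)
    (fun z => cos (dott eta z.2) * a (cons_pair z) + sin (dott eta z.2) * b (cons_pair z))).
  have md := measurableT_comp (measurable_dott eta) (@measurable_snd _ _ mR (n.-tuple R)).
  apply: measurable_funD; apply: measurable_funM => //.
    exact: measurable_cos_comp.
  exact: measurable_sin_comp.
apply: ae_eq_integral => //.
- by apply/measurable_EFinP; apply: (@measurable_Rintegral_param _ _ mR _ R (mu n) F).
- apply/measurable_EFinP; apply: measurable_funD; apply: measurable_funM.
  + exact: measurable_cosM.
  + exact: mft.
  + exact: measurable_sinM.
  + by apply: (mft q (fun x => - p x)) => //; exact: (measurable_funN mpc).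
apply: filterS2 (ae_integrable1 (integrable_cons ip)) (ae_integrable1 (integrable_cons iq)).
move=> t ipt iqt _; congr EFin.
have i1 := integrable_D (integrable_cos_dott eta ipt) (integrable_sin_dott eta iqt).
have i2 := integrable_D (integrable_cos_dott eta iqt) (integrable_sin_dott eta (integrable_N ipt)).
rewrite (RintZl _ i1) (RintZl _ i2) (RintD (integrable_Zl _ i1) (integrable_Zl _ i2)).
apply: eq_Rintegral => y _; rewrite /F /slice /= cosD sinD; ring.
Qed.

End step.

Section joint.
Variables (n : nat) (p q : n.+1.-tuple R -> R).
Hypothesis ip : (mu n.+1).-integrable setT (EFin \o p).
Hypothesis iq : (mu n.+1).-integrable setT (EFin \o q).

Let mp : measurable_fun setT p.
Proof. by apply/measurable_EFinP; exact: measurable_int ip. Qed.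
Let mq : measurable_fun setT q.
Proof. by apply/measurable_EFinP; exact: measurable_int iq. Qed.

Lemma measurable_ft_slice : measurable_fun [set: mR * n.-tuple R]
  (fun z : mR * n.-tuple R => ft (slice p z.1) (slice q z.1) z.2).
Proof.
apply: (@measurable_Rintegral_param _ _ _ _ R (mu n) (fun w : (mR * n.-tuple R) * n.-tuple R =>
  cos (dott w.1.2 w.2) * p (cons_pair (w.1.1, w.2)) +
  sin (dott w.1.2 w.2) * q (cons_pair (w.1.1, w.2)))).
have m2 : measurable_fun [set: (mR * n.-tuple R) * n.-tuple R]
    (fun w : (mR * n.-tuple R) * n.-tuple R => (w.1.2, w.2)).
  apply/measurable_fun_pairP; split; last exact: measurable_snd.
  exact: (measurableT_comp measurable_snd measurable_fst).
have m1 : measurable_fun [set: (mR * n.-tuple R) * n.-tuple R]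
    (fun w : (mR * n.-tuple R) * n.-tuple R => (w.1.1, w.2)).
  apply/measurable_fun_pairP; split; last exact: measurable_snd.
  exact: (measurableT_comp measurable_fst measurable_fst).
have md := measurableT_comp (@measurable_dott2 n) m2.
have mc := measurableT_comp (@measurable_cons_pair R n) m1.
apply: measurable_funD; apply: measurable_funM.
- exact: measurable_cos_comp.
- exact: (measurableT_comp mp mc).
- exact: measurable_sin_comp.
- exact: (measurableT_comp mq mc).
Qed.

Lemma integrable_ft_slice (eta : n.-tuple R) :
  lam.-integrable setT (fun t : mR => (ft (slice p t) (slice q t) eta)%:E).
Proof.
apply: (@integrable_Rintegral1 _ _ mR _ R lam (mu n) (fun z =>
  cos (dott eta z.2) * p (cons_pair z) + sin (dott eta z.2) * q (cons_pair z))).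
have md := measurableT_comp (measurable_dott eta) (@measurable_snd _ _ mR (n.-tuple R)).
apply: integrable_D.
- apply: (integrable_bounded_mul _ (fun z => cos_max _) (integrable_cons ip)).
  exact: measurable_cos_comp.
- apply: (integrable_bounded_mul _ (fun z => sin_max _) (integrable_cons iq)).
  exact: measurable_sin_comp.
Qed.

End joint.

(** Induction on n: the formula on the line is applied in the first variable, for fixed
    remaining frequencies, and the induction hypothesis in the other variables, for fixed
    t. Each is legitimate almost everywhere only: slices of an integrable function are
    integrable for almost every t, and the partial transform is square integrable in t
    for almost every frequency. *)
Theorem plancherel_tuple n (p q : n.-tuple R -> R) :
  (mu n).-integrable setT (EFin \o p) -> (mu n).-integrable setT (EFin \o q) ->
  (\int[mu n]_x (p x ^+ 2 + q x ^+ 2)%:E < +oo)%E ->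
  (\int[mu n]_xi (ft p q xi ^+ 2 + ft q (fun x => - p x) xi ^+ 2)%:E =
   ((2 * pi) ^+ n)%:E * \int[mu n]_x (p x ^+ 2 + q x ^+ 2)%:E)%E.
Proof.
elim: n p q => [|n IH] p q ip iq pq2.
  have mp : measurable_fun setT p by apply/measurable_EFinP; exact: measurable_int ip.
  have mq : measurable_fun setT q by apply/measurable_EFinP; exact: measurable_int iq.
  have ft0 (a b : 0.-tuple R -> R) xi : measurable_fun setT a ->
      measurable_fun setT b -> ft a b xi = a [tuple].
    move=> ma mb; rewrite /ft /Rintegral integral_dirac//.
      by rewrite diracT mul1e /= /dott big_ord0 cos0 sin0 mul0r mul1r addr0.
    have md := measurable_dott xi.
    apply/measurable_EFinP; apply: measurable_funD; apply: measurable_funM => //.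
      exact: measurable_cos_comp.
    exact: measurable_sin_comp.
  rewrite expr0 mul1e.
  transitivity (\int[mu 0]_x (p [tuple] ^+ 2 + q [tuple] ^+ 2)%:E)%E.
    apply: eq_integral => xi _; rewrite !ft0//; exact: measurable_funN.
  apply: eq_integral => x _; suff -> : x = [tuple] by [].
  exact: tuple0.
have mp : measurable_fun setT p by apply/measurable_EFinP; exact: measurable_int ip.
have mq : measurable_fun setT q by apply/measurable_EFinP; exact: measurable_int iq.
have mNp : measurable_fun setT (fun x => - p x) by exact: measurable_funN.
have iNp : (mu n.+1).-integrable setT (EFin \o (fun x => - p x)) by exact: integrable_N.
have s0 (a b : R) : (0 <= (a ^+ 2 + b ^+ 2)%:E)%E by rewrite lee_fin addr_ge0// sqr_ge0.
pose A t eta := ft (slice p t) (slice q t) eta.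
pose B t eta := ft (slice q t) (fun y => - slice p t y) eta.
have mA : measurable_fun [set: mR * n.-tuple R] (fun z => A z.1 z.2).
  exact: measurable_ft_slice.
have mB : measurable_fun [set: mR * n.-tuple R] (fun z => B z.1 z.2).
  exact: (measurable_ft_slice iq iNp).
have iA eta : lam.-integrable setT (EFin \o (A^~ eta : mR -> R)).
  exact: integrable_ft_slice.
have iB eta : lam.-integrable setT (EFin \o (B^~ eta : mR -> R)).
  exact: (integrable_ft_slice iq iNp).
pose E xi := ft p q xi ^+ 2 + ft q (fun x => - p x) xi ^+ 2.
have mE : measurable_fun setT (fun xi => (E xi)%:E).
  by apply/measurable_EFinP; apply: measurable_funD; apply: measurable_funX;
    exact: measurable_ft.
have EE s eta : E (cons_pair (s, eta)) = ft1 (A^~ eta) (B^~ eta) s ^+ 2 +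
    ft1 (B^~ eta) (fun t => - A t eta) s ^+ 2.
  rewrite /E ft_cons// (ft_cons iq iNp); congr (_ + ft1 _ _ _ ^+ 2).
  by apply/funext => t; rewrite -ftN.
pose S (z : mR * n.-tuple R) := (A z.1 z.2 ^+ 2 + B z.1 z.2 ^+ 2)%:E.
have mS : measurable_fun setT S.
  by apply/measurable_EFinP; apply: measurable_funD; exact: measurable_funX.
have mpq : measurable_fun setT (fun x => (p x ^+ 2 + q x ^+ 2)%:E).
  by apply/measurable_EFinP; apply: measurable_funD; exact: measurable_funX.
have ipq : (mu n.+1).-integrable setT (fun x => (p x ^+ 2 + q x ^+ 2)%:E).
  apply: integrable_of_ge0_lty => //; first exact/measurable_EFinP.
  by move=> x; rewrite addr_ge0// sqr_ge0.
set V := (\int[mu n.+1]_x (p x ^+ 2 + q x ^+ 2)%:E)%E.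
have mpq2 := measurableT_comp mpq (@measurable_cons_pair R n).
have pi2 : (0 <= ((2 * pi) ^+ n)%:E :> \bar R)%E.
  by rewrite lee_fin exprn_ge0// mulr_ge0// pi_ge0.
have IS0 eta : (0 <= \int[lam]_t S (t, eta))%E.
  by apply: integral_ge0 => t _; exact: s0.
have V0 : (0 <= V)%E by apply: integral_ge0.
(* S is the squared modulus of the partial transform in the last n variables. *)
have hS : (\int[mu n]_eta \int[lam]_t S (t, eta) = ((2 * pi) ^+ n)%:E * V)%E.
  rewrite -(@fubini_tonelli _ _ mR (n.-tuple R) R lam (mu n) S mS (fun z => s0 _ _))//.
  rewrite /V ge0_integral_cons// -ge0_integralZl//; last 2 first.
  - exact: (@measurable_fun_fubini_tonelli_F _ _ mR (n.-tuple R) R (mu n) _ mpq2 (fun z => s0 _ _)).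
  - by move=> t _; exact: integral_ge0.
  apply: ge0_ae_eq_integral => //.
  - exact: (@measurable_fun_fubini_tonelli_F _ _ mR (n.-tuple R) R (mu n) S mS (fun z => s0 _ _)).
  - apply: measurable_funeM.
    exact: (@measurable_fun_fubini_tonelli_F _ _ mR (n.-tuple R) R (mu n) _ mpq2 (fun z => s0 _ _)).
  - by move=> t _; apply: integral_ge0 => y _; exact: s0.
  - by move=> t _; apply: mule_ge0 => //; apply: integral_ge0 => y _; exact: s0.
  apply: filterS3 (ae_integrable1 (integrable_cons ip)) (ae_integrable1 (integrable_cons iq))
    (ae_integrable1 (integrable_cons ipq)) => t ipt iqt ipqt _.
  rewrite /S /= IH//.
  have /integrableP[_] := ipqt; apply: le_lt_trans.
  rewrite le_eqVlt; apply/orP; left; apply/eqP.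
  by apply: eq_integral => y _; rewrite gee0_abs//; exact: s0.
have Vfin : (((2 * pi) ^+ n)%:E * V < +oo)%E.
  by rewrite lte_mul_pinfty// ge0_fin_numE.
have mIS : measurable_fun setT (fun eta => \int[lam]_t S (t, eta))%E.
  exact: (@measurable_fun_fubini_tonelli_G _ _ mR (n.-tuple R) R lam S mS (fun z => s0 _ _)).
rewrite (ge0_integral_cons mE)//; last by move=> z; exact: s0.
have mEc := measurableT_comp mE (@measurable_cons_pair R n).
rewrite (@fubini_tonelli _ _ mR (n.-tuple R) R lam (mu n) _ mEc); last first.
  by move=> z; exact: s0.
rewrite exprS EFinM -muleA -hS -ge0_integralZl//; last first.
  by rewrite lee_fin mulr_ge0// pi_ge0.
apply: ge0_ae_eq_integral => //.
- exact: (@measurable_fun_fubini_tonelli_G _ _ mR (n.-tuple R) R lam _ mEc (fun z => s0 _ _)).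
- exact: measurable_funeM.
- by move=> eta _; apply: integral_ge0 => z _; exact: s0.
- by move=> eta _; rewrite mule_ge0// lee_fin mulr_ge0// pi_ge0.
have iIS : (mu n).-integrable setT (fun eta => \int[lam]_t S (t, eta))%E.
  apply/integrableP; split => //.
  under eq_integral do rewrite gee0_abs//.
  by rewrite hS.
apply: filterS (integrable_ae measurableT iIS) => eta /(_ I) feta _.
have lS : (\int[lam]_t S (t, eta) < +oo)%E.
  by rewrite -ge0_fin_numE.
have mAe : measurable_fun setT (A^~ eta : mR -> R) by apply/measurable_EFinP; exact: measurable_int (iA eta).
have mBe : measurable_fun setT (B^~ eta : mR -> R) by apply/measurable_EFinP; exact: measurable_int (iB eta).
transitivity (\int[lam]_s (ft1 (A^~ eta) (B^~ eta) s ^+ 2 +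
    ft1 (B^~ eta) (fun t => - A t eta) s ^+ 2)%:E)%E.
  by apply: eq_integral => s _; rewrite /= EE.
rewrite plancherel_line//.
- apply: le_lt_trans lS; apply: ge0_le_integral => //.
  + by move=> t _; rewrite lee_fin sqr_ge0.
  + exact/measurable_EFinP/measurable_funX.
  + exact: (measurableT_comp mS (measurable_pair2 eta)).
  + by move=> t _; rewrite lee_fin lerDl sqr_ge0.
- apply: le_lt_trans lS; apply: ge0_le_integral => //.
  + by move=> t _; rewrite lee_fin sqr_ge0.
  + exact/measurable_EFinP/measurable_funX.
  + exact: (measurableT_comp mS (measurable_pair2 eta)).
  + by move=> t _; rewrite lee_fin lerDr sqr_ge0.
Qed.

End tuples.

(** * Completeness along rapidly converging sequences *)

Section fast.
Context {R : realType}.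

(** The sequences a k - 2 s / 2^k and a k + 2 s / 2^k are monotone in opposite
    directions and enclose the limit, which gives the rate as well. *)
Lemma fast_cauchy_cvg (a : nat -> R) (s : R) :
  (forall k, `|a k.+1 - a k| <= s / 2 ^+ k) ->
  exists2 l, a k @[k --> \oo] --> l & forall k, `|a k - l| <= 2 * s / 2 ^+ k.
Proof.
move=> ha.
have s0 : 0 <= s by have := le_trans (normr_ge0 _) (ha 0); rewrite expr0 divr1.
pose b k := a k - 2 * s / 2 ^+ k; pose c k := a k + 2 * s / 2 ^+ k.
have e2 k : s / 2 ^+ k = 2 * (s / 2 ^+ k.+1).
  by rewrite exprS; field; rewrite expf_neq0.
have bnd : nondecreasing_seq b.
  apply/nondecreasing_seqP => k; rewrite /b.
  have := ha k; rewrite ler_norml -!mulrA => /andP[h _].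
  by have := e2 k; move: h; move: (s / 2 ^+ k) (s / 2 ^+ k.+1) => u v; lra.
have cni : nonincreasing_seq c.
  apply/nonincreasing_seqP => k; rewrite /c.
  have := ha k; rewrite ler_norml -!mulrA => /andP[_ h].
  by have := e2 k; move: h; move: (s / 2 ^+ k) (s / 2 ^+ k.+1) => u v; lra.
have pos k : 0 <= 2 * s / 2 ^+ k by rewrite divr_ge0 ?mulr_ge0// exprn_ge0.
have bc k j : b k <= c j.
  have := bnd _ _ (leq_maxl k j); have := cni _ _ (leq_maxr k j).
  by rewrite /b /c => h1 h2; have := pos (maxn k j); lra.
have ubb : has_ubound (range b) by exists (c 0) => _ [k _ <-].
have cvb := nondecreasing_cvgn bnd ubb.
have bl k : b k <= sup (range b).
  by apply: ub_le_sup => //; exists k.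
have lc k : sup (range b) <= c k.
  by apply: ge_sup; [exists (b 0); exists 0%N|move=> _ [j _ <-]].
exists (sup (range b)).
  have e0 : 2 * s / 2 ^+ k @[k --> \oo] --> 0.
    have := @cvg_geometric R (2 * s) 2^-1.
    rewrite gtr0_norm// invf_lt1// ltr1n => /(_ isT).
    by under [X in X @ _ --> _]funext => k do rewrite /geometric/= exprVn.
  have : b k + 2 * s / 2 ^+ k @[k --> \oo] --> sup (range b) + 0 by apply: cvgD.
  rewrite addr0; under eq_fun do rewrite subrK; exact.
move=> k; rewrite ler_norml; have := bl k; have := lc k; rewrite /b /c.
by move=> ? ?; apply/andP; split; lra.
Qed.

End fast.

Section completeness.
Context d (T : measurableType d) (R : realType) (mu : {measure set T -> \bar R}).
Variables (u : nat -> T -> R) (C : R).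
Hypothesis mu_ : forall k, measurable_fun setT (u k).
Hypothesis C0 : 0 <= C.
Hypothesis uC : forall k, (\int[mu]_x ((u k.+1 x - u k x) ^+ 2)%:E <= (C / 8 ^+ k)%:E)%E.

(** Riesz-Fischer for a rapidly convergent sequence: the series of the squared
    increments weighted by 4^k has finite integral, hence is finite almost everywhere,
    where it controls the distance to the pointwise limit. *)
Lemma L2_fast_cauchy : exists2 v : T -> R, measurable_fun setT v &
  (\int[mu]_x ((u k x - v x) ^+ 2)%:E)%E @[k --> \oo] --> 0%E.
Proof.
pose D k x := (4 ^+ k * (u k.+1 x - u k x) ^+ 2)%:E.
have D0 k x : (0 <= D k x)%E by rewrite lee_fin mulr_ge0 ?sqr_ge0// exprn_ge0.
have mD k : measurable_fun setT (D k).
  apply/measurable_EFinP; apply: measurable_funM => //.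
  by apply: measurable_funX; exact: measurable_funB.
pose K x := (\sum_(0 <= k <oo) D k x)%E.
have mK : measurable_fun setT K.
  by apply: (ge0_emeasurable_sum (fun k x _ _ => D0 k x)) => k _.
have K0 x : (0 <= K x)%E by apply: nneseries_ge0 => k _ _.
have iK : (\int[mu]_x K x <= (2 * C)%:E)%E.
  rewrite integral_nneseries//.
  apply: lime_le; first by apply: is_cvg_nneseries => k _ _; apply: integral_ge0 => x _.
  apply: nearW => n.
  apply: (@le_trans _ _ (\sum_(0 <= k < n) (C / 2 ^+ k)%:E)%E).
    apply: lee_sum => k _; rewrite /D.
    under eq_integral do rewrite EFinM.
    rewrite ge0_integralZl; [|by []| | |]; last 3 first.
    - by apply/measurable_EFinP; apply: measurable_funX; exact: measurable_funB.
    - by move=> x _; rewrite lee_fin sqr_ge0.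
    - by rewrite lee_fin exprn_ge0.
    apply: (@le_trans _ _ ((4 ^+ k)%:E * (C / 8 ^+ k)%:E)%E).
      by apply: lee_wpmul2l => //; rewrite lee_fin exprn_ge0.
    rewrite -EFinM lee_fin le_eqVlt; apply/orP; left; apply/eqP.
    rewrite (_ : 8 = 4 * 2 :> R); last by ring.
    by rewrite exprMn; field; rewrite !expf_neq0.
  rewrite sumEFin lee_fin.
  have : \sum_(0 <= k < n) C / 2 ^+ k = 2 * C - 2 * C / 2 ^+ n.
    elim: n => [|n IHn]; first by rewrite big_nil expr0 divr1 subrr.
    by rewrite big_nat_recr//= IHn exprS; field; rewrite expf_neq0.
  by move=> ->; rewrite gerBl divr_ge0 ?mulr_ge0// exprn_ge0.
have iiK : mu.-integrable setT K.
  apply/integrableP; split => //.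
  under eq_integral do rewrite gee0_abs//.
  by rewrite (le_lt_trans iK)// ltry.
(* The upper limit is measurable and coincides with the limit where there is one. *)
pose v x := fine (limn_esup (fun k => (u k x)%:E)).
have mv : measurable_fun setT v.
  apply: measurableT_comp => //; apply: measurable_fun_limn_esup => k.
  exact/measurable_EFinP.
exists v => //.
have bound k : {ae mu, forall x, (((u k x - v x) ^+ 2)%:E <= (4 / 4 ^+ k)%:E * K x)%E}.
  apply: filterS (integrable_ae measurableT iiK) => x /(_ I) Kx.
  pose s := Num.sqrt (fine (K x)).
  have s2 : s ^+ 2 = fine (K x) by rewrite sqr_sqrtr// fine_ge0.
  have s0 : 0 <= s by exact: sqrtr_ge0.
  have hs j : `|u j.+1 x - u j x| <= s / 2 ^+ j.
    have Dj : (D j x <= K x)%E.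
      rewrite /K (@nneseriesD1 _ _ j predT (fun k _ => D0 k x))//.
      by rewrite leeDl// nneseries_ge0.
    move: Dj; rewrite -(fineK Kx) lee_fin -s2 => h.
    rewrite ler_pdivlMr ?exprn_gt0//.
    rewrite -ler_sqr ?nnegrE ?mulr_ge0 ?exprn_ge0//.
    rewrite exprMn real_normK ?num_real// -exprM mulnC exprM.
    by rewrite (_ : 2 ^+ 2 = 4) 1?mulrC//; ring.
  have [l ul hl] := fast_cauchy_cvg hs.
  have -> : v x = l.
    have ul' : (u k x)%:E @[k --> \oo] --> l%:E by apply: cvg_EFin => //; exact: nearW.
    by rewrite /v (cvg_limn_einf_sup ul').2.
  rewrite -(fineK Kx) -EFinM lee_fin -s2.
  have pos : 0 <= 2 * s / 2 ^+ k by rewrite divr_ge0 ?mulr_ge0 ?exprn_ge0.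
  have : `|u k x - l| ^+ 2 <= (2 * s / 2 ^+ k) ^+ 2 by rewrite ler_sqr ?nnegrE.
  rewrite real_normK ?num_real// => /le_trans; apply.
  rewrite le_eqVlt; apply/orP; left; apply/eqP.
  rewrite (_ : 4 = 2 ^+ 2 :> R); last by ring.
  by rewrite -exprM mulnC exprM; field; rewrite !expf_neq0.
apply: ereal_cvg0P => [k|e e0].
  by apply: integral_ge0 => x _; rewrite lee_fin sqr_ge0.
have e4 : 4 * (2 * C) * 4^-1 ^+ k @[k --> \oo] --> 0.
  have := @cvg_geometric R (4 * (2 * C)) 4^-1.
  by rewrite gtr0_norm// invf_lt1// ltr1n => /(_ isT).
have := e4; move/cvgr0Pnorm_le => /(_ e e0); apply: filterS => k hk.
apply: (@le_trans _ _ (\int[mu]_x ((4 / 4 ^+ k)%:E * K x))%E).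
  apply: ae_ge0_le_integral => //.
  - by move=> x _; rewrite lee_fin sqr_ge0.
  - by apply/measurable_EFinP; apply: measurable_funX; exact: measurable_funB.
  - by move=> x _; rewrite mule_ge0// lee_fin divr_ge0// exprn_ge0.
  - exact: measurable_funeM.
  - by apply: filterS (bound k) => x h _.
rewrite ge0_integralZl; [|by []|exact: mK|by move=> x _|by rewrite lee_fin divr_ge0// exprn_ge0].
apply: (@le_trans _ _ ((4 / 4 ^+ k)%:E * (2 * C)%:E)%E).
  by apply: lee_wpmul2l => //; rewrite lee_fin divr_ge0// exprn_ge0.
rewrite -EFinM lee_fin (le_trans _ hk)// (le_trans _ (ler_norm _))//.
by rewrite exprVn mulrAC.
Qed.

End completeness.

(** * Squared L2 norms of complex functions *)

Section normc2.
Context {R : realType}.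
Implicit Types z w : R[i].

Definition normc2 z : R := complex.Re z ^+ 2 + complex.Im z ^+ 2.

Lemma normc2_ge0 z : 0 <= normc2 z. Proof. by rewrite addr_ge0// sqr_ge0. Qed.

Lemma normc_sqr z : Normc.normc z ^+ 2 = normc2 z.
Proof. by case: z => a b; rewrite /= sqr_sqrtr// addr_ge0// sqr_ge0. Qed.

Lemma normc_ge0 z : 0 <= Normc.normc z.
Proof. by case: z => a b /=; exact: sqrtr_ge0. Qed.

Lemma ReB z w : complex.Re (z - w) = complex.Re z - complex.Re w.
Proof. by case: z w => a b [c d]. Qed.

Lemma ImB z w : complex.Im (z - w) = complex.Im z - complex.Im w.
Proof. by case: z w => a b [c d]. Qed.

Lemma ReM z w : complex.Re (z * w) =
  complex.Re z * complex.Re w - complex.Im z * complex.Im w.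
Proof. by case: z w => a b [c d]. Qed.

Lemma ImM z w : complex.Im (z * w) =
  complex.Re z * complex.Im w + complex.Im z * complex.Re w.
Proof. by case: z w => a b [c d]. Qed.

Lemma Re_normc z : `|complex.Re z| <= Normc.normc z.
Proof.
rewrite -ler_sqr ?nnegrE ?normc_ge0// real_normK ?num_real// normc_sqr.
by rewrite lerDl sqr_ge0.
Qed.

Lemma Im_normc z : `|complex.Im z| <= Normc.normc z.
Proof.
rewrite -ler_sqr ?nnegrE ?normc_ge0// real_normK ?num_real// normc_sqr.
by rewrite lerDr sqr_ge0.
Qed.

Lemma normc_le z : Normc.normc z <= `|complex.Re z| + `|complex.Im z|.
Proof.
rewrite -ler_sqr ?nnegrE ?normc_ge0 ?addr_ge0// normc_sqr /normc2 sqrrD !real_normK ?num_real//.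
by rewrite addrAC lerDl mulrn_wge0// mulr_ge0.
Qed.

Lemma normc2_eqB z w : normc2 (z - w) = normc2 (w - z).
Proof. by rewrite /normc2 !ReB !ImB; ring. Qed.

Lemma normc2M z w : normc2 (z * w) = normc2 z * normc2 w.
Proof. by rewrite /normc2 ReM ImM; ring. Qed.

(** Peter-Paul inequality. Taking e = 1 costs a factor 2; a small e is needed to compare
    the norms of two close functions. *)
Lemma normc2D_le (e : R) z w : 0 < e -> normc2 z <= (1 + e) * normc2 w + (1 + e^-1) * normc2 (z - w).
Proof.
move=> e0; rewrite /normc2 ReB ImB.
have h (a b : R) : a ^+ 2 <= (1 + e) * b ^+ 2 + (1 + e^-1) * (a - b) ^+ 2.
  rewrite -subr_ge0.
  suff -> : (1 + e) * b ^+ 2 + (1 + e^-1) * (a - b) ^+ 2 - a ^+ 2 =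
    e * (b - e^-1 * (a - b)) ^+ 2 by rewrite mulr_ge0 ?sqr_ge0// ltW.
  by field; rewrite gt_eqF.
have := h (complex.Re z) (complex.Re w); have := h (complex.Im z) (complex.Im w).
by nra.
Qed.

End normc2.

Section L2sq.
Context {R : realType} {d : nat}.
Local Notation mu := (@lebesgue_tuple R d).
Implicit Types f g : d.-tuple R -> R[i].

Definition cmeasurable f := measurable_fun setT (fun x => complex.Re (f x)) /\
  measurable_fun setT (fun x => complex.Im (f x)).

Definition L2sq f : \bar R := (\int[mu]_x (normc2 (f x))%:E)%E.

Lemma L2sq_ge0 f : (0 <= L2sq f)%E.
Proof. by apply: integral_ge0 => x _; rewrite lee_fin normc2_ge0. Qed.

Lemma Lnormc2_sqr f : ((Lnormc 2%:E f) ^+ 2 = L2sq f)%E.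
Proof.
have sqE (x : \bar R) : (0 <= x)%E -> (x ^+ 2 = x `^ 2)%E.
  case: x => [r| |]//.
    by rewrite lee_fin => r0; rewrite poweR_EFin powR_mulrn// EFin_expe.
  by move=> _; rewrite poweRyr// expe2 mulyy.
rewrite sqE; last exact: Lnorm_ge0.
rewrite /Lnormc poweR_Lnorm//; apply: eq_integral => x _ /=.
by rewrite ger0_norm ?normc_ge0// ?poweR_EFin powR_mulrn ?normc_ge0// normc_sqr.
Qed.

Lemma measurable_normc2 f : cmeasurable f -> measurable_fun setT (fun x => normc2 (f x)).
Proof. by move=> [mr mi]; apply: measurable_funD; exact: measurable_funX. Qed.

Lemma cmeasurableB f g : cmeasurable f -> cmeasurable g -> cmeasurable (fun x => f x - g x).
Proof.
move=> [m1 m2] [m3 m4]; split.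
  by under eq_fun do rewrite ReB; exact: measurable_funB.
by under eq_fun do rewrite ImB; exact: measurable_funB.
Qed.

Lemma inLp2E f : inLp 2%:E f <-> cmeasurable f /\ (L2sq f < +oo)%E.
Proof.
rewrite -Lnormc2_sqr; split.
  move=> [mr mi lf]; split=> //.
  have := @Lnorm_ge0 _ _ R mu 2%:E (EFin \o (@Normc.normc R \o f)).
  rewrite -/(Lnormc _ _); move: lf; case: (Lnormc _ _) => // r _ _.
  by rewrite -EFin_expe ltry.
move=> [[mr mi] lf]; split=> //; move: lf.
have := @Lnorm_ge0 _ _ R mu 2%:E (EFin \o (@Normc.normc R \o f)).
rewrite -/(Lnormc _ _); case: (Lnormc _ _) => [r _ _|_|//]; first exact: ltry.
by rewrite expe2 mulyy.
Qed.

Lemma Lnormc2_cvg0 (h : nat -> d.-tuple R -> R[i]) :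
  (Lnormc 2%:E (h n) @[n --> \oo] --> 0%E) <-> (L2sq (h n) @[n --> \oo] --> 0%E).
Proof.
have L0 n := @Lnorm_ge0 _ _ R mu 2%:E (EFin \o (@Normc.normc R \o h n)).
split=> hc; apply: ereal_cvg0P => [n|e e0]; [exact: L2sq_ge0| |exact: L0|].
  have s0 : 0 < Num.sqrt e by rewrite sqrtr_gt0.
  have := ereal_cvg0_lt hc s0; apply: filterS => n.
  rewrite -Lnormc2_sqr /Lnormc; move: (L0 n); case: (Lnorm _ _ _) => // r.
  rewrite lee_fin lte_fin -EFin_expe lee_fin => r0 /ltW re.
  by rewrite -[leRHS](sqr_sqrtr (ltW e0)) ler_sqr// nnegrE sqrtr_ge0.
have e20 : 0 < e ^+ 2 by rewrite exprn_gt0.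
have := ereal_cvg0_lt hc e20; apply: filterS => n.
rewrite -Lnormc2_sqr /Lnormc; move: (L0 n); case: (Lnorm _ _ _) => [r||]//.
  rewrite lee_fin -EFin_expe lte_fin lee_fin => r0 /ltW.
  by rewrite ler_sqr ?nnegrE// ltW.
Qed.

Lemma L2sq_quasi (e : R) f g : 0 < e -> cmeasurable f -> cmeasurable g ->
  (L2sq f <= (1 + e)%:E * L2sq g + (1 + e^-1)%:E * L2sq (fun x => f x - g x)%R)%E.
Proof.
move=> e0 mf mg.
have ie0 : 0 < e^-1 by rewrite invr_gt0.
have m1 : measurable_fun setT (fun x => (normc2 (g x))%:E) by apply/measurable_EFinP; exact: measurable_normc2.
have m2 : measurable_fun setT (fun x => (normc2 (f x - g x))%:E).
  by apply/measurable_EFinP; apply: measurable_normc2; exact: cmeasurableB.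
rewrite /L2sq -ge0_integralZl; [|by []|exact: m1|by move=> x _; rewrite lee_fin normc2_ge0|
  by rewrite lee_fin addr_ge0// ltW].
rewrite -ge0_integralZl; [|by []|exact: m2|by move=> x _; rewrite lee_fin normc2_ge0|
  by rewrite lee_fin addr_ge0// ltW].
have p1 x : (0 <= (1 + e)%:E * (normc2 (g x))%:E)%E by rewrite -EFinM lee_fin mulr_ge0 ?normc2_ge0// addr_ge0// ltW.
have p2 x : (0 <= (1 + e^-1)%:E * (normc2 (f x - g x))%:E)%E.
  by rewrite -EFinM lee_fin mulr_ge0 ?normc2_ge0// addr_ge0// ltW.
rewrite -ge0_integralD; [|by []|by move=> x _; exact: p1|exact: measurable_funeM|
  by move=> x _; exact: p2|exact: measurable_funeM].
apply: ge0_le_integral => //.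
- by move=> x _; rewrite lee_fin normc2_ge0.
- by apply/measurable_EFinP; exact: measurable_normc2.
- by apply: emeasurable_funD; exact: measurable_funeM.
- by move=> x _; rewrite -!EFinM -EFinD lee_fin normc2D_le.
Qed.

Lemma L2sqB_le f g : cmeasurable f -> cmeasurable g ->
  (L2sq (fun x => f x - g x)%R <= 2%:E * L2sq f + 2%:E * L2sq g)%E.
Proof.
move=> mf mg.
have m1 : measurable_fun setT (fun x => (normc2 (g x))%:E) by apply/measurable_EFinP; exact: measurable_normc2.
have m2 : measurable_fun setT (fun x => (normc2 (f x))%:E) by apply/measurable_EFinP; exact: measurable_normc2.
have p h x : (0 <= (normc2 (h x : R[i]))%:E)%E by rewrite lee_fin normc2_ge0.
rewrite /L2sq -ge0_integralZl; [|by []|exact: m2|by move=> x _; exact: p|by []].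
rewrite -ge0_integralZl; [|by []|exact: m1|by move=> x _; exact: p|by []].
rewrite -ge0_integralD; [|by []|by move=> x _; exact: mule_ge0|exact: measurable_funeM|
  by move=> x _; exact: mule_ge0|exact: measurable_funeM].
apply: ge0_le_integral => //.
- by apply/measurable_EFinP; apply: measurable_normc2; exact: cmeasurableB.
- by apply: emeasurable_funD; exact: measurable_funeM.
- move=> x _; rewrite -!EFinM -EFinD lee_fin /normc2 ReB ImB.
  have := sqr_ge0 (complex.Re (f x) + complex.Re (g x)).
  have := sqr_ge0 (complex.Im (f x) + complex.Im (g x)).
  by nra.
Qed.

End L2sq.

(** * Plancherel's formula for the L2 transform *)

Section fourier_L2.
Context {R : realType} {d : nat}.
Local Notation mu := (@lebesgue_tuple R d).
Implicit Types f g h : d.-tuple R -> R[i].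
Local Notation C := (((2 * pi) ^+ d)%:E : \bar R).

Lemma Re_fourierL1 h xi : complex.Re (fourierL1 h xi) =
  ft (fun x => complex.Re (h x)) (fun x => complex.Im (h x)) xi.
Proof.
apply: eq_Rintegral => x _; rewrite ReM /expi /= cosN sinN; ring.
Qed.

Lemma Im_fourierL1 h xi : complex.Im (fourierL1 h xi) =
  ft (fun x => complex.Im (h x)) (fun x => - complex.Re (h x)) xi.
Proof.
apply: eq_Rintegral => x _; rewrite ImM /expi /= cosN sinN; ring.
Qed.

Definition cintegrable h := mu.-integrable setT (fun x => (complex.Re (h x))%:E) /\
  mu.-integrable setT (fun x => (complex.Im (h x))%:E).

Lemma measurable_normc h : cmeasurable h -> measurable_fun setT (fun x => Normc.normc (h x)).
Proof.
move=> mh; rewrite (_ : (fun x => _) = Num.sqrt \o (fun x => normc2 (h x))).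
  apply: measurableT_comp; last exact: measurable_normc2.
  by apply: continuous_measurable_fun; exact: sqrt_continuous.
by apply/funext => x /=; rewrite /normc2; case: (h x).
Qed.

Lemma inLp1E h : inLp 1%:E h <-> cintegrable h.
Proof.
have LE : Lnormc 1%:E h = (\int[mu]_x (Normc.normc (h x))%:E)%E.
  rewrite /Lnormc Lnorm1; apply: eq_integral => x _ /=.
  by rewrite ger0_norm// normc_ge0.
split.
  move=> [mr mi]; rewrite LE => lh.
  have iN : mu.-integrable setT (fun x => (Normc.normc (h x))%:E).
    apply: integrable_of_ge0_lty => //; first exact: measurable_normc.
    by move=> x; exact: normc_ge0.
  split; apply: le_integrable iN => //; try exact/measurable_EFinP.
    by move=> x _; rewrite /= lee_fin (ger0_norm (normc_ge0 _)) Re_normc.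
  by move=> x _; rewrite /= lee_fin (ger0_norm (normc_ge0 _)) Im_normc.
move=> [ir ii].
have mr : measurable_fun setT (fun x => complex.Re (h x)) by apply/measurable_EFinP; exact: measurable_int ir.
have mi : measurable_fun setT (fun x => complex.Im (h x)) by apply/measurable_EFinP; exact: measurable_int ii.
split => //; rewrite LE.
have := integrable_D (integrable_norm ir) (integrable_norm ii).
move=> /integrableP[_]; apply: le_lt_trans; apply: ge0_le_integral => //.
- by move=> x _; rewrite lee_fin normc_ge0.
- by apply/measurable_EFinP; exact: measurable_normc.
- apply: measurableT_comp => //; apply/measurable_EFinP.
  by apply: measurable_funD; exact: measurableT_comp.
- by move=> x _; rewrite /= lee_fin ger0_norm ?addr_ge0// normc_le.
Qed.

Lemma cintegrable_cmeasurable h : cintegrable h -> cmeasurable h.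
Proof.
move=> [ir ii]; split; apply/measurable_EFinP.
  exact: measurable_int ir.
exact: measurable_int ii.
Qed.

Lemma cintegrableB f g : cintegrable f -> cintegrable g ->
  cintegrable (fun x => f x - g x).
Proof.
move=> [fr fi] [gr gi]; split.
  have := integrable_B fr gr; apply: eq_integrable => // x _; by rewrite ReB.
have := integrable_B fi gi; apply: eq_integrable => // x _; by rewrite ImB.
Qed.

Lemma cmeasurable_fourierL1 h : cmeasurable h -> cmeasurable (fourierL1 h).
Proof.
move=> [mr mi]; split.
  by under eq_fun do rewrite Re_fourierL1; exact: measurable_ft.
under eq_fun do rewrite Im_fourierL1; apply: measurable_ft => //.
exact: measurable_funN.
Qed.

Lemma ft_B (p q p' q' : d.-tuple R -> R) xi :
  mu.-integrable setT (EFin \o p) -> mu.-integrable setT (EFin \o q) ->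
  mu.-integrable setT (EFin \o p') -> mu.-integrable setT (EFin \o q') ->
  ft (fun x => p x - p' x) (fun x => q x - q' x) xi = ft p q xi - ft p' q' xi.
Proof.
move=> ip iq ip' iq'.
rewrite -[- ft p' _ _]RintN RintD.
- by apply: eq_Rintegral => x _; ring.
- by apply: integrable_D; [exact: integrable_cos_dott|exact: integrable_sin_dott].
- apply: integrable_N.
  by apply: integrable_D; [exact: integrable_cos_dott|exact: integrable_sin_dott].
Qed.

Lemma fourierL1B f g xi : cintegrable f -> cintegrable g ->
  fourierL1 (fun x => f x - g x) xi = fourierL1 f xi - fourierL1 g xi.
Proof.
move=> [fr fi] [gr gi].
have H (z w : R[i]) : complex.Re z = complex.Re w -> complex.Im z = complex.Im w -> z = w.
  by case: z w => a b [c e] /= -> ->.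
apply: H; rewrite ?ReB ?ImB !(Re_fourierL1, Im_fourierL1).
  rewrite -ft_B//; congr (ft _ _ xi); apply/funext => x; by rewrite ?ReB ?ImB.
rewrite -ft_B//; try exact: integrable_N.
by congr (ft _ _ xi); apply/funext => x; rewrite ?ReB ?ImB// opprD.
Qed.

Lemma plancherel_L1L2 h : cintegrable h -> (L2sq h < +oo)%E ->
  (L2sq (fourierL1 h) = C * L2sq h)%E.
Proof.
move=> [ir ii] h2; rewrite /L2sq.
rewrite -(plancherel_tuple ir ii)//; apply: eq_integral => xi _.
by rewrite /normc2 Re_fourierL1 Im_fourierL1.
Qed.

Lemma fourierL1_dist f g : cintegrable f -> cintegrable g ->
  (L2sq (fun x => f x - g x)%R < +oo)%E ->
  (L2sq (fun xi => fourierL1 f xi - fourierL1 g xi)%R = C * L2sq (fun x => f x - g x)%R)%E.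
Proof.
move=> cf cg fg; rewrite -plancherel_L1L2//; last exact: cintegrableB.
by congr L2sq; apply/funext => xi; rewrite fourierL1B.
Qed.

Lemma L2sqB_sym f g : L2sq (fun x => f x - g x) = L2sq (fun x => g x - f x).
Proof. by apply: eq_integral => x _; rewrite normc2_eqB. Qed.

(** Peter-Paul in both directions, with a weight eta so small that eta times the limit
    is negligible. *)
Lemma L2sq_cvg (h : nat -> d.-tuple R -> R[i]) f : (forall n, cmeasurable (h n)) -> cmeasurable f ->
  (L2sq f < +oo)%E -> L2sq (fun x => h n x - f x) @[n --> \oo] --> 0%E ->
  L2sq (h n) @[n --> \oo] --> L2sq f.
Proof.
move=> mh mf f2 hf.
have ff : L2sq f \is a fin_num by rewrite ge0_fin_numE// L2sq_ge0.
have [a a0 fa] : exists2 a, 0 <= a & L2sq f = a%:E.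
  by exists (fine (L2sq f)); rewrite ?fineK// fine_ge0// L2sq_ge0.
have bnd e : 0 < e -> \forall n \near \oo,
    [/\ (L2sq (h n) <= (a + e)%:E)%E & (a%:E <= L2sq (h n) + e%:E)%E].
  move=> e0.
  pose eta := Num.min 1 (e / (4 * (a + 1 + e))).
  have D0 : 0 < 4 * (a + 1 + e) by lra.
  have eta0 : 0 < eta by rewrite lt_min ltr01 divr_gt0.
  have etae : eta * (4 * (a + 1 + e)) <= e by rewrite -ler_pdivlMr// ge_min lexx orbT.
  have z0 : 0 < e / 4 / (1 + eta^-1).
    by rewrite !divr_gt0// addr_gt0// invr_gt0.
  have := ereal_cvg0_lt hf z0; apply: filterS => n hn.
  have i0 : 0 < 1 + eta^-1 by rewrite addr_gt0// invr_gt0.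
  have key : ((1 + eta^-1)%:E * L2sq (fun x => h n x - f x)%R <= (e / 4)%:E)%E.
    have E4 : e / 4 = (1 + eta^-1) * (e / 4 / (1 + eta^-1)) by rewrite [RHS]mulrC divfK// gt_eqF.
    by rewrite [X in (_ <= X%:E)%E]E4 EFinM; apply: lee_wpmul2l; [rewrite lee_fin ltW|exact: ltW].
  have h1 : (L2sq (h n) <= (a + e)%:E)%E.
    apply: (le_trans (L2sq_quasi eta0 (mh n) mf)).
    apply: (@le_trans _ _ ((1 + eta)%:E * a%:E + (e / 4)%:E)%E).
      by rewrite fa leeD.
    by rewrite -EFinM -EFinD lee_fin; nra.
  split => //.
  have hfin : L2sq (h n) \is a fin_num by rewrite ge0_fin_numE ?L2sq_ge0// (le_lt_trans h1)// ltry.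
  rewrite -fa; apply: (le_trans (L2sq_quasi eta0 mf (mh n))).
  rewrite L2sqB_sym; apply: (@le_trans _ _ ((1 + eta)%:E * L2sq (h n) + (e / 4)%:E)%E).
    by rewrite leeD.
  move: h1; rewrite -(fineK hfin) -EFinM -!EFinD !lee_fin => h1.
  by have : 0 <= fine (L2sq (h n)) by [rewrite fine_ge0// L2sq_ge0]; nra.
rewrite fa; apply/fine_cvgP; split.
  have := bnd 1 ltr01; apply: filterS => n [hn _].
  by rewrite ge0_fin_numE ?L2sq_ge0// (le_lt_trans hn)// ltry.
apply/cvgrPdist_le => e e0; have := bnd e e0; apply: filterS => n [h1 h2] /=.
have hfin : L2sq (h n) \is a fin_num by rewrite ge0_fin_numE ?L2sq_ge0// (le_lt_trans h1)// ltry.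
move: h1 h2; rewrite -(fineK hfin) -EFinD !lee_fin => h1 h2.
by rewrite ler_norml; apply/andP; split; lra.
Qed.

(** Only the norms along an approximating sequence are compared, so that the formula
    holds for whichever g is a Fourier transform of f. *)
Theorem plancherel_L2 f g : inLp 2%:E f -> is_fourierL2 f g -> (L2sq g = C * L2sq f)%E.
Proof.
move=> /inLp2E[mf f2] [/inLp2E[mg g2] [h [hL]]] /Lnormc2_cvg0 hf /Lnormc2_cvg0 hg.
have ch n : cintegrable (h n) by apply/inLp1E; exact: (hL n).1.
have h2 n : (L2sq (h n) < +oo)%E by have /inLp2E[] := (hL n).2.
have mh n := cintegrable_cmeasurable (ch n).
have c1 := L2sq_cvg mh mf f2 hf.
have c2 := L2sq_cvg (fun n => cmeasurable_fourierL1 (mh n)) mg g2 hg.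
have c3 : (C * L2sq (h n))%E @[n --> \oo] --> (C * L2sq f)%E by exact: cvgeZl.
have e : (fun n => L2sq (fourierL1 (h n))) = (fun n => C * L2sq (h n))%E.
  by apply/funext => n; rewrite plancherel_L1L2.
rewrite e in c2; exact: (cvg_unique _ c2 c3).
Qed.

End fourier_L2.

(** * Existence of the L2 transform *)

Section existence.
Context {R : realType} {d : nat}.
Local Notation mu := (@lebesgue_tuple R d).
Implicit Types f g h : d.-tuple R -> R[i].
Local Notation C := ((2 * pi) ^+ d : R).

(** Small values are removed, because f can fail to be integrable only through them.
    Where f vanishes the inverse is 0, and both branches give 0. *)
Definition truncate f (N : nat) : d.-tuple R -> R[i] :=
  fun x => if N%:R <= (normc2 (f x))^-1 then 0 else f x.

Lemma cmeasurable_truncate f N : cmeasurable f -> cmeasurable (truncate f N).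
Proof.
move=> mf; have [mr mi] := mf.
have mi2 : measurable_fun setT (fun x => (normc2 (f x))^-1).
  by apply: (measurableT_comp (@measurable_invr R)); exact: measurable_normc2.
have mS : measurable [set x | N%:R <= (normc2 (f x))^-1] by exact: measurable_superlevel.
have H (p : d.-tuple R -> R) : measurable_fun setT p ->
    measurable_fun setT (fun x => if N%:R <= (normc2 (f x))^-1 then 0 else p x).
  move=> mp; rewrite (_ : (fun x => _) = p \_ (~` [set x | N%:R <= (normc2 (f x))^-1])).
    apply/(measurable_restrictT _ _).1; first exact: measurableC.
    exact: measurable_funTS.
  apply/funext => x; rewrite patchE in_setC.
  by case: ifPn => h; [rewrite mem_set|rewrite memNset//; exact/negP].
split; rewrite /truncate.
  by under eq_fun do rewrite (fun_if (@complex.Re R)); exact: H.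
by under eq_fun do rewrite (fun_if (@complex.Im R)); exact: H.
Qed.

(** Where it is nonzero, the truncation exceeds a fixed level, so its modulus is bounded
    by a multiple of its square. *)
Lemma cintegrable_truncate f N : cmeasurable f -> (L2sq f < +oo)%E -> cintegrable (truncate f N).
Proof.
move=> mf f2; have [mr mi] := cmeasurable_truncate N mf.
have is2 : mu.-integrable setT (fun x => (normc2 (f x))%:E).
  apply: integrable_of_ge0_lty => //; first exact: measurable_normc2.
  by move=> x; exact: normc2_ge0.
have bound x : forall a, a ^+ 2 <= normc2 (f x) ->
    `|if N%:R <= (normc2 (f x))^-1 then 0 else a| <= (N%:R + 1) * normc2 (f x).
  move=> a ha; have s0 := normc2_ge0 (f x).
  have N0 : 0 <= N%:R :> R by [].
  case: ifPn => [_|]; first by rewrite normr0 mulr_ge0// addr_ge0.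
  rewrite -ltNge => hN.
  have [sz|sz] := eqVneq (normc2 (f x)) 0.
    have -> : a = 0.
      by apply/eqP; rewrite -sqrf_eq0 eq_le sqr_ge0 andbT -sz.
    by rewrite normr0 sz mulr0.
  have sp : 0 < normc2 (f x) by rewrite lt_neqAle eq_sym sz.
  have h1 : 1 <= N%:R * normc2 (f x) by rewrite -ler_pdivrMr// mul1r ltW.
  have h2 : `|a| ^+ 2 <= normc2 (f x) by rewrite real_normK// num_real.
  by have := sqr_ge0 (`|a| - 1); nra.
split; apply: le_integrable (integrable_Zl (N%:R + 1) is2) => //.
- exact/measurable_EFinP.
- move=> x _; rewrite /= lee_fin [leRHS]ger0_norm; last by rewrite mulr_ge0 ?normc2_ge0// addr_ge0.
  by rewrite /truncate (fun_if (@complex.Re R)); apply: bound; rewrite lerDl sqr_ge0.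
- exact/measurable_EFinP.
- move=> x _; rewrite /= lee_fin [leRHS]ger0_norm; last by rewrite mulr_ge0 ?normc2_ge0// addr_ge0.
  by rewrite /truncate (fun_if (@complex.Im R)); apply: bound; rewrite lerDr sqr_ge0.
Qed.

Lemma truncate_cvg f : cmeasurable f -> (L2sq f < +oo)%E ->
  L2sq (fun x => truncate f N x - f x) @[N --> \oo] --> 0%E.
Proof.
move=> mf f2.
have mi2 : measurable_fun setT (fun x => (normc2 (f x))^-1).
  by apply: (measurableT_comp (@measurable_invr R)); exact: measurable_normc2.
have := tail_integral_cvg0 (measurable_normc2 mf) mi2 (fun x => normc2_ge0 (f x)) f2.
apply: cvg_trans; rewrite [X in _ `=>` X @ _](_ : _ = (fun N => L2sq (fun x => truncate f N x - f x)))//.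
apply/funext => N; rewrite integral_mkcond; apply: eq_integral => x _.
rewrite patchE /truncate; case: ifPn => h.
  rewrite ifT; last by move: h; rewrite inE.
  by congr EFin; rewrite /normc2 ReB ImB /= !sub0r !sqrrN.
rewrite ifF; last by apply/negbTE; move: h; rewrite notin_setE => /negP.
by congr EFin; rewrite /normc2 ReB ImB !subrr expr0n addr0.
Qed.

Lemma L2sq_split (v w : d.-tuple R -> R) : measurable_fun setT v -> measurable_fun setT w ->
  L2sq (fun x => Complex (v x) (w x)) =
  (\int[mu]_x (v x ^+ 2)%:E + \int[mu]_x (w x ^+ 2)%:E)%E.
Proof.
move=> mv mw; rewrite -ge0_integralD//.
- by move=> x _; rewrite lee_fin sqr_ge0.
- exact/measurable_EFinP/measurable_funX.
- by move=> x _; rewrite lee_fin sqr_ge0.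
- exact/measurable_EFinP/measurable_funX.
Qed.

(** A subsequence of the truncations converges to f so fast that, by Plancherel's formula
    for integrable functions, its transforms satisfy the hypothesis of the completeness
    theorem. *)
Theorem fourierL2_exists f : inLp 2%:E f -> exists g, is_fourierL2 f g.
Proof.
move=> /inLp2E[mf f2].
have tc := truncate_cvg mf f2.
have ex k : exists N, (L2sq (fun x => truncate f N x - f x)%R <= (8^-1 ^+ k)%:E)%E.
  have p0 : 0 < 8^-1 ^+ k :> R by rewrite exprn_gt0// invr_gt0.
  have [N _ /(_ N (leqnn _)) /= hN] := ereal_cvg0_lt tc p0.
  by exists N; exact: ltW.
pose N k := sval (cid (ex k)).
pose h k := truncate f (N k).
have hk k : (L2sq (fun x => h k x - f x)%R <= (8^-1 ^+ k)%:E)%E by exact: svalP (cid (ex k)).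
have ch k : cintegrable (h k) by exact: cintegrable_truncate.
have mh k := cintegrable_cmeasurable (ch k).
have mhf k : cmeasurable (fun x => h k x - f x) by exact: cmeasurableB.
have e8 : 8^-1 ^+ k @[k --> \oo] --> (0 : R).
  apply: cvg_expr; rewrite gtr0_norm// ?invr_gt0//.
  by rewrite invf_lt1// ltr1n.
have h2 k : (L2sq (h k) < +oo)%E.
  have h1 := L2sq_quasi (@ltr01 R) (mh k) mf.
  apply: (le_lt_trans h1); rewrite lte_add_pinfty//.
    by rewrite lte_mul_pinfty.
  rewrite lte_mul_pinfty//.
  by rewrite (le_lt_trans (hk k))// ltry.
have hdiff k : (L2sq (fun x => h k.+1 x - h k x)%R <= (4 / 8 ^+ k)%:E)%E.
  rewrite (_ : (fun x => _) = (fun x => (h k.+1 x - f x) - (h k x - f x))); last first.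
    by apply/funext => x; ring.
  apply: (le_trans (L2sqB_le (mhf k.+1) (mhf k))).
  apply: (@le_trans _ _ (2%:E * (8^-1 ^+ k.+1)%:E + 2%:E * (8^-1 ^+ k)%:E)%E).
    by apply: leeD; apply: lee_wpmul2l.
  rewrite -!EFinM -EFinD lee_fin exprS exprVn.
  have : 0 <= (8 ^+ k)^-1 :> R by rewrite invr_ge0 exprn_ge0.
  by move: ((8 ^+ k)^-1) => z z0; lra.
have C0 : 0 <= C by rewrite exprn_ge0// mulr_ge0// pi_ge0.
have Fdiff k : (L2sq (fun xi => fourierL1 (h k.+1) xi - fourierL1 (h k) xi)%R <=
    (C * 4 / 8 ^+ k)%:E)%E.
  rewrite fourierL1_dist//; last by rewrite (le_lt_trans (hdiff k))// ltry.
  by rewrite -mulrA EFinM; apply: lee_wpmul2l.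
have mF k := cmeasurable_fourierL1 (mh k).
have C40 : 0 <= C * 4 by rewrite mulr_ge0.
have [v mv hv] : exists2 v : d.-tuple R -> R, measurable_fun setT v &
    (\int[mu]_x ((complex.Re (fourierL1 (h k) x) - v x) ^+ 2)%:E)%E @[k --> \oo] --> 0%E.
  apply: (L2_fast_cauchy _ C40) => k; first exact: (mF k).1.
  apply: le_trans (Fdiff k); apply: ge0_le_integral => //.
  - by move=> x _; rewrite lee_fin sqr_ge0.
  - apply/measurable_EFinP; apply: measurable_funX.
    by apply: measurable_funB; [exact: (mF _).1|exact: (mF _).1].
  - by apply/measurable_EFinP; apply: measurable_normc2; exact: cmeasurableB.
  - by move=> x _; rewrite lee_fin /normc2 ReB lerDl sqr_ge0.
have [w mw hw] : exists2 w : d.-tuple R -> R, measurable_fun setT w &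
    (\int[mu]_x ((complex.Im (fourierL1 (h k) x) - w x) ^+ 2)%:E)%E @[k --> \oo] --> 0%E.
  apply: (L2_fast_cauchy _ C40) => k; first exact: (mF k).2.
  apply: le_trans (Fdiff k); apply: ge0_le_integral => //.
  - by move=> x _; rewrite lee_fin sqr_ge0.
  - apply/measurable_EFinP; apply: measurable_funX.
    by apply: measurable_funB; [exact: (mF _).2|exact: (mF _).2].
  - by apply/measurable_EFinP; apply: measurable_normc2; exact: cmeasurableB.
  - by move=> x _; rewrite lee_fin /normc2 ImB lerDr sqr_ge0.
pose g x := Complex (v x) (w x).
have mg : cmeasurable g by [].
have cvg_g : L2sq (fun x => fourierL1 (h k) x - g x) @[k --> \oo] --> 0%E.
  rewrite (_ : (fun k => _) = (fun k => \int[mu]_x ((complex.Re (fourierL1 (h k) x) - v x) ^+ 2)%:E +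
    \int[mu]_x ((complex.Im (fourierL1 (h k) x) - w x) ^+ 2)%:E))%E.
    by rewrite -[X in _ --> X](adde0 0%E); apply: cvgeD.
  apply/funext => k; rewrite -L2sq_split.
  - by apply: eq_integral => x _; rewrite /normc2 ReB ImB.
  - by apply: measurable_funB => //; exact: (mF k).1.
  - by apply: measurable_funB => //; exact: (mF k).2.
have g2 : (L2sq g < +oo)%E.
  have [k _ /(_ k (leqnn _)) /= gk] := ereal_cvg0_lt cvg_g ltr01.
  apply: (le_lt_trans (L2sq_quasi ltr01 mg (mF k))); rewrite lte_add_pinfty//.
    rewrite lte_mul_pinfty// plancherel_L1L2// lte_mul_pinfty// ge0_fin_numE//.
  by rewrite lte_mul_pinfty// L2sqB_sym (lt_le_trans gk)// leey.
exists g; split; first exact/inLp2E.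
exists h; split.
- by move=> k; split; [exact/inLp1E|exact/inLp2E].
- apply/Lnormc2_cvg0; apply: ereal_cvg0P => [k|e e0]; first exact: L2sq_ge0.
  have := e8; move/cvgr0Pnorm_le => /(_ e e0); apply: filterS => k hke.
  by rewrite (le_trans (hk k))// lee_fin (le_trans (ler_norm _)).
- exact/Lnormc2_cvg0.
Qed.

Lemma fourierP f : inLp 2%:E f -> is_fourierL2 f (fourier f).
Proof. by move=> hf; have := xgetPex (fun=> 0) (fourierL2_exists hf). Qed.

End existence.

(** * Translates and differences *)

Section addt.
Context {R : realType}.
Local Notation mR := (measurableTypeR R).
Local Notation lam := (@lebesgue_measure R).
Local Notation mu := (@lebesgue_tuple R).

Lemma measurable_addt n (h : n.-tuple R) : measurable_fun setT (fun x => addt x h).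
Proof.
apply/measurable_fun_tnthP => i.
rewrite (_ : _ \o _ = (fun x => tnth x i + tnth h i)); last first.
  by apply/funext => x /=; rewrite tnth_mktuple.
by apply: measurable_funD => //; exact: measurable_tnth.
Qed.

Lemma addt_cons n (t s : R) (y z : n.-tuple R) :
  addt (cons_pair (t, y)) (cons_pair (s, z)) = cons_pair (t + s, addt y z).
Proof.
apply/eq_from_tnth => i; rewrite tnth_mktuple.
case: (unliftP ord0 i) => [j ->|->]; last by rewrite !tnth0.
by rewrite !tnthS tnth_mktuple.
Qed.

Lemma tuple_consE n (h : n.+1.-tuple R) : exists s z, h = cons_pair (s, z).
Proof.
by case/tupleP: h => s z; exists s, z; apply/val_inj.
Qed.

Lemma ge0_integral_addt n (h : n.-tuple R) (F : n.-tuple R -> \bar R) :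
  measurable_fun setT F -> (forall x, 0 <= F x)%E ->
  (\int[mu n]_x F (addt x h) = \int[mu n]_x F x)%E.
Proof.
elim: n h F => [|n IH] h F mF F0.
  by apply: eq_integral => x _; congr F; rewrite [LHS]tuple0 [RHS]tuple0.
have [s [z ->]] := tuple_consE h.
have mFh : measurable_fun setT (fun x => F (addt x (cons_pair (s, z)))).
  exact: (measurableT_comp mF (measurable_addt _)).
rewrite !ge0_integral_cons//.
have mFc := measurableT_comp mF (@measurable_cons_pair R n).
have mG : measurable_fun [set: mR] (fun t : mR => \int[mu n]_y F (cons_pair (t, y)))%E.
  exact: (@measurable_fun_fubini_tonelli_F _ _ mR (n.-tuple R) R (mu n) _ mFc (fun z => F0 _)).
transitivity (\int[lam]_t \int[mu n]_y F (cons_pair ((t + s)%R, y)))%E.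
  apply: eq_integral => t _.
  transitivity (\int[mu n]_y F (cons_pair ((t + s)%R, addt y z)))%E.
    by apply: eq_integral => y _; rewrite addt_cons.
  apply: (IH z (fun y => F (cons_pair (t + s, y)))) => //.
  exact: (measurableT_comp mFc (measurable_pair1 _)).
rewrite (@ge0_integral_shift _ (fun t => \int[mu n]_y F (cons_pair (t, y)))%E s mG)//.
by move=> t; apply: integral_ge0.
Qed.

Lemma Rintegral_addt n (h : n.-tuple R) (F : n.-tuple R -> R) : measurable_fun setT F ->
  Rintegral (mu n) setT (fun x => F (addt x h)) = Rintegral (mu n) setT F.
Proof.
move=> mF; have mE : measurable_fun setT (EFin \o F) by exact/measurable_EFinP.
rewrite /Rintegral integralE [in RHS]integralE.
rewrite -(ge0_integral_addt h (measurable_funepos mE))//.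
rewrite -(ge0_integral_addt h (measurable_funeneg mE))//.
by congr (fine (_ - _))%E; apply: eq_integral => x _; rewrite !(funeposE, funenegE).
Qed.

Lemma integrable_addt n (h : n.-tuple R) (F : n.-tuple R -> R) :
  (mu n).-integrable setT (fun x => (F x)%:E) ->
  (mu n).-integrable setT (fun x => (F (addt x h))%:E).
Proof.
move=> /integrableP[mF lF]; apply/integrableP; split.
  exact: (measurableT_comp mF (measurable_addt h)).
rewrite (ge0_integral_addt h (F := fun x => `|(F x)%:E|%E))//.
exact: measurableT_comp.
Qed.

Lemma dott_addt n (xi x h : n.-tuple R) : dott xi (addt x h) = dott xi x + dott xi h.
Proof.
rewrite /dott -big_split /=; apply: eq_bigr => i _.
by rewrite tnth_mktuple mulrDr.
Qed.

Lemma ft_addt n (h : n.-tuple R) (p q : n.-tuple R -> R) xi :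
  (mu n).-integrable setT (EFin \o p) -> (mu n).-integrable setT (EFin \o q) ->
  ft (fun x => p (addt x h)) (fun x => q (addt x h)) xi =
  cos (dott xi h) * ft p q xi - sin (dott xi h) * ft q (fun x => - p x) xi.
Proof.
move=> ip iq.
have i1 := integrable_D (integrable_cos_dott xi ip) (integrable_sin_dott xi iq).
have i2 := integrable_D (integrable_cos_dott xi iq) (integrable_sin_dott xi (integrable_N ip)).
rewrite -mulNr /ft (RintZl _ i1) (RintZl _ i2) (RintD (integrable_Zl _ i1) (integrable_Zl _ i2)).
rewrite -[RHS](Rintegral_addt h); last first.
  have := integrable_D (integrable_Zl (cos (dott xi h)) i1) (integrable_Zl (- sin (dott xi h)) i2).
  by move=> /measurable_int/measurable_EFinP.
apply: eq_Rintegral => x _; rewrite dott_addt.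
set a := dott xi x; set b := dott xi h.
have c2 : cos b ^+ 2 + sin b ^+ 2 = 1 by rewrite cos2Dsin2.
rewrite cosD sinD.
rewrite -[cos a in LHS]mul1r -[sin a in LHS]mul1r -c2; ring.
Qed.

End addt.

Section difference.
Context {R : realType} {d : nat}.
Local Notation mu := (@lebesgue_tuple R d).
Implicit Types f g : d.-tuple R -> R[i].
Local Notation C := ((2 * pi) ^+ d : R).

Definition translate f (h : d.-tuple R) : d.-tuple R -> R[i] := fun x => f (addt x h).

Lemma cmeasurable_translate f h : cmeasurable f -> cmeasurable (translate f h).
Proof.
move=> [mr mi]; split.
  exact: (measurableT_comp mr (measurable_addt h)).
exact: (measurableT_comp mi (measurable_addt h)).
Qed.

Lemma L2sq_translate f h : cmeasurable f -> L2sq (translate f h) = L2sq f.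
Proof.
move=> mf; rewrite /L2sq /translate (ge0_integral_addt h (F := fun x => (normc2 (f x))%:E))//.
  by apply/measurable_EFinP; exact: measurable_normc2.
by move=> x; rewrite lee_fin normc2_ge0.
Qed.

Lemma cintegrable_translate f h : cintegrable f -> cintegrable (translate f h).
Proof. by move=> [ir ii]; split; [exact: (integrable_addt h ir)|exact: (integrable_addt h ii)]. Qed.

Lemma fourierL1_translate f h xi : cintegrable f ->
  fourierL1 (translate f h) xi = expi (dott xi h) * fourierL1 f xi.
Proof.
move=> [ir ii].
have H (z w : R[i]) : complex.Re z = complex.Re w -> complex.Im z = complex.Im w -> z = w.
  by case: z w => a b [c e] /= -> ->.
apply: H; rewrite ?ReM ?ImM !(Re_fourierL1, Im_fourierL1) /=.
  by rewrite (ft_addt h xi ir ii).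
rewrite (ft_addt h xi ii (integrable_N ir)) ftN; ring.
Qed.

Lemma normc2_expi1 (t : R) : normc2 (expi t - 1) = 2 * (1 - cos t).
Proof.
rewrite /normc2 ReB ImB /= subr0.
transitivity (cos t ^+ 2 + sin t ^+ 2 + 1 - 2 * cos t); first by ring.
by rewrite cos2Dsin2; ring.
Qed.

Lemma inLp2_diff f h : inLp 2%:E f -> inLp 2%:E (fun x => translate f h x - f x).
Proof.
move=> /inLp2E[mf f2]; apply/inLp2E; split.
  by apply: cmeasurableB => //; exact: cmeasurable_translate.
apply: (le_lt_trans (L2sqB_le (cmeasurable_translate h mf) mf)).
by rewrite L2sq_translate// lte_add_pinfty// lte_mul_pinfty.
Qed.

Lemma cmeasurableM f g : cmeasurable f -> cmeasurable g -> cmeasurable (fun x => f x * g x).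
Proof.
move=> [m1 m2] [m3 m4]; split.
  by under eq_fun do rewrite ReM; apply: measurable_funB; exact: measurable_funM.
by under eq_fun do rewrite ImM; apply: measurable_funD; exact: measurable_funM.
Qed.

Lemma cmeasurable_expi1 (h : d.-tuple R) : cmeasurable (fun xi => expi (dott xi h) - 1).
Proof.
have md : measurable_fun setT (fun xi : d.-tuple R => dott xi h).
  exact: (measurableT_comp (@measurable_dott2 R d) (measurable_pair2 h)).
split.
  under eq_fun do rewrite ReB; apply: measurable_funB => //.
  exact: measurable_cos_comp.
under eq_fun do rewrite ImB; apply: measurable_funB => //.
exact: measurable_sin_comp.
Qed.

Lemma L2sq_expi1M_le (h : d.-tuple R) g : cmeasurable g ->
  (L2sq (fun xi => (expi (dott xi h) - 1) * g xi)%R <= 4%:E * L2sq g)%E.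
Proof.
move=> mg; have mm := cmeasurableM (cmeasurable_expi1 h) mg.
rewrite /L2sq -ge0_integralZl//; last 2 first.
- by apply/measurable_EFinP; exact: measurable_normc2.
- by move=> x _; rewrite lee_fin normc2_ge0.
apply: ge0_le_integral => //.
- by move=> x _; rewrite lee_fin normc2_ge0.
- by apply/measurable_EFinP; exact: measurable_normc2.
- by apply: measurable_funeM; apply/measurable_EFinP; exact: measurable_normc2.
- move=> x _; rewrite -EFinM lee_fin normc2M normc2_expi1 ler_wpM2r ?normc2_ge0//.
  by have := cos_geN1 (dott x h); lra.
Qed.

(** Translation turns into modulation on the Fourier side, for any choice of the
    approximating sequence. *)
Lemma is_fourierL2_diff f g (h : d.-tuple R) : inLp 2%:E f -> is_fourierL2 f g ->
  is_fourierL2 (fun x => translate f h x - f x) (fun xi => (expi (dott xi h) - 1) * g xi).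
Proof.
move=> /inLp2E[mf f2] [/inLp2E[mg g2] [u [uL]]] /Lnormc2_cvg0 uf /Lnormc2_cvg0 ug.
have cu n : cintegrable (u n) by apply/inLp1E; exact: (uL n).1.
have mu_ n := cintegrable_cmeasurable (cu n).
split.
  apply/inLp2E; split; first by apply: cmeasurableM => //; exact: cmeasurable_expi1.
  by apply: (le_lt_trans (L2sq_expi1M_le h mg)); rewrite lte_mul_pinfty.
exists (fun n x => translate (u n) h x - u n x); split.
- move=> n; split; last by apply: inLp2_diff; exact: (uL n).2.
  apply/inLp1E; apply: cintegrableB => //; exact: cintegrable_translate.
- apply/Lnormc2_cvg0; apply: ereal_cvg0P => [n|e e0]; first exact: L2sq_ge0.
  have e4 : 0 < e / 4 by rewrite divr_gt0.
  have := ereal_cvg0_lt uf e4; apply: filterS => n un.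
  pose w x := u n x - f x.
  have mw : cmeasurable w by exact: cmeasurableB.
  rewrite (_ : (fun x => _) = (fun x => translate w h x - w x)); last first.
    by apply/funext => x; rewrite /translate /w; ring.
  apply: (le_trans (L2sqB_le (cmeasurable_translate h mw) mw)).
  rewrite L2sq_translate//; apply: (@le_trans _ _ (2%:E * (e / 4)%:E + 2%:E * (e / 4)%:E)%E).
    by apply: leeD; apply: lee_wpmul2l => //; exact: ltW.
  by rewrite -!EFinM -EFinD lee_fin; lra.
- apply/Lnormc2_cvg0; apply: ereal_cvg0P => [n|e e0]; first exact: L2sq_ge0.
  have e4 : 0 < e / 4 by rewrite divr_gt0.
  have := ereal_cvg0_lt ug e4; apply: filterS => n un.
  have mw : cmeasurable (fun xi => fourierL1 (u n) xi - g xi).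
    by apply: cmeasurableB => //; exact: cmeasurable_fourierL1.
  rewrite (_ : (fun xi => _) = (fun xi => (expi (dott xi h) - 1) * (fourierL1 (u n) xi - g xi))); last first.
    apply/funext => xi; rewrite fourierL1B//; last exact: cintegrable_translate.
    by rewrite fourierL1_translate//; ring.
  apply: (le_trans (L2sq_expi1M_le h mw)).
  rewrite (_ : e%:E = 4%:E * (e / 4)%:E)%E; last by rewrite -EFinM; congr EFin; field.
  by apply: lee_wpmul2l => //; exact: ltW.
Qed.

(** Plancherel's formula for a difference: 2 (1 - cos s) is the squared modulus of
    exp (i s) - 1. *)
Theorem L2sq_difference f (h : d.-tuple R) : inLp 2%:E f ->
  (C%:E * L2sq (fun x => f (addt x h) - f x)%R =
   \int[mu]_xi (2 * (1 - cos (dott xi h)) * normc2 (fourier f xi))%:E)%E.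
Proof.
move=> hf; rewrite -(plancherel_L2 (inLp2_diff h hf) (is_fourierL2_diff h hf (fourierP hf))).
by apply: eq_integral => xi _; rewrite normc2M normc2_expi1.
Qed.

End difference.

(** * Power laws for truncated second moments and tails *)

(** The real-variable part of the argument. I is the spherical modulus, J t the mass of
    the spectrum beyond t, F t its second moment below t, and N its total mass. *)
Section tauber.
Context {R : realType}.
Variables (I F J : R -> R) (m M N gamma : R).
Hypotheses (m0 : 0 < m) (M0 : 0 < M) (N0 : 0 <= N) (hgamma : 0 < gamma < 2).
Hypothesis I0 : I 0 = 0.
Hypothesis I_lower : forall e, 0 < e -> m * (e ^+ 2 * F e^-1) <= I e.
Hypothesis I_upper : forall e t, 0 < e -> 0 < t -> I e <= M * (e ^+ 2 * F t + J t).
Hypothesis I_double : forall e, I (2 * e) <= 4 * I e.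
Hypothesis I_large : 0 < N -> exists T mu : R, 0 < mu /\ forall s, T <= s -> mu <= I s.
Hypothesis F_ge0 : forall t, 0 <= F t.
Hypothesis J_ge0 : forall t, 0 <= J t.
Hypothesis J_le : forall t, J t <= N.
Hypothesis F_le : forall t, 0 < t -> F t <= t ^+ 2 * N.
Hypothesis FJ_lower : forall t s, 0 < t -> t <= s -> t ^+ 2 * (J t - J s) <= F s - F t.
Hypothesis FJ_upper : forall t s, 0 < t -> t <= s -> F s - F t <= s ^+ 2 * (J t - J s).
Hypothesis J_lim : forall e t, 0 < e -> 0 < t -> exists n, J (2 ^+ n * t) <= e.

Let g (t : R) := t `^ gamma.

Let gamma0 : 0 < gamma. Proof. by case/andP: hgamma. Qed.
Let gamma2 : gamma < 2. Proof. by case/andP: hgamma. Qed.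

Let g_gt0 t : 0 < t -> 0 < g t. Proof. exact: powR_gt0. Qed.

Let gM s t : 0 < s -> 0 < t -> g (s * t) = g s * g t.
Proof. by move=> s0 t0; rewrite /g powRM// ltW. Qed.

Let gV t : 0 < t -> g t^-1 = (g t)^-1.
Proof.
by move=> t0; rewrite /g -(powR_inv1 (ltW t0)) -powRrM mulN1r powRN.
Qed.

Let g_le s t : 0 <= s -> s <= t -> g s <= g t.
Proof.
move=> s0 st; apply: (ge0_ler_powR (ltW gamma0)) => //; rewrite nnegrE//.
exact: le_trans st.
Qed.

Let g2_gt1 : 1 < g 2.
Proof.
have : (1 : R) `^ gamma < 2 `^ gamma by apply: gt0_ltr_powR; rewrite ?nnegrE// ltr1n.
by rewrite powR1.
Qed.

Let g2_lt4 : g 2 < 4.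
Proof.
have : gamma * ln 2 < 2 * ln 2 :> R by rewrite ltr_pM2r// ln_gt0// ltr1n.
rewrite -!ln_powR ltr_ln ?posrE ?powR_gt0// => /lt_le_trans; apply.
by rewrite powR_mulrn// expr2 -natrM.
Qed.

Let powR_large (r z : R) : 0 < r -> exists2 A : R, 1 <= A & z <= A `^ r.
Proof.
move=> r0; exists ((Num.max z 1) `^ r^-1).
  have h1 : 1 <= Num.max z 1 by rewrite le_max lexx orbT.
  have h2 : 0 <= r^-1 by rewrite invr_ge0 ltW.
  by have := ler_powR h1 h2; rewrite powRr0.
by rewrite -powRrM mulVf ?gt_eqF// powRr1 ?le_max ?lexx// ler01 orbT.
Qed.

Let g_mono t : 0 < t -> g t <= g (2 * t).
Proof. by move=> t0; apply: g_le; [exact: ltW|lra]. Qed.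

(** Low frequencies are controlled by summing the upper bound of the tail over dyadic
    shells; the sum is geometric because gamma < 2. *)
Let F_bound b : 0 <= b -> (forall t, 1 <= t -> J t <= b / g t) ->
  exists2 B, 0 <= B & forall t, 1 <= t -> F t <= B * t ^+ 2 / g t.
Proof.
move=> b0 Jb.
have z0 : 0 < 4 / g 2 - 1 by rewrite subr_gt0 ltr_pdivlMr ?g_gt0// mul1r.
(* The first term covers t in [1, 2]. The second is the fixed point of the recursion
   B -> (B + 4 b) g 2 / 4, by which the bound passes from t to 2 t. *)
pose B := N * g 2 + 4 * b / (4 / g 2 - 1).
have B1 : 0 <= 4 * b / (4 / g 2 - 1) by rewrite divr_ge0 ?mulr_ge0// ltW.
have B2 : 0 <= N * g 2 by rewrite mulr_ge0// ltW// g_gt0.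
have B0 : 0 <= B by rewrite addr_ge0.
exists B => //.
have step t : 1 <= t -> F t <= B * t ^+ 2 / g t ->
    F (2 * t) <= B * (2 * t) ^+ 2 / g (2 * t).
  move=> t1 Ft; have t0 : 0 < t by rewrite (lt_le_trans ltr01).
  have g0 := g_gt0 t0.
  have t2 : t <= 2 * t by lra.
  have := FJ_upper t0 t2; have := J_ge0 (2 * t); have Jt := Jb t t1 => J2 FJ.
  have sq0 : 0 <= t ^+ 2 by rewrite sqr_ge0.
  have h1 : F (2 * t) <= B * t ^+ 2 / g t + 4 * t ^+ 2 * (b / g t).
    have : (2 * t) ^+ 2 * (J t - J (2 * t)) <= 4 * t ^+ 2 * (b / g t).
      rewrite exprMn (_ : 2 ^+ 2 = 4); last by ring.
      by rewrite ler_wpM2l ?mulr_ge0//; lra.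
    by lra.
  apply: (le_trans h1); rewrite gM//.
  have -> : B * t ^+ 2 / g t + 4 * t ^+ 2 * (b / g t) = (B + 4 * b) * (t ^+ 2 / g t).
    by field; rewrite gt_eqF.
  have -> : B * (2 * t) ^+ 2 / (g 2 * g t) = (B * (4 / g 2)) * (t ^+ 2 / g t).
    by field; rewrite !gt_eqF// g_gt0.
  apply: ler_wpM2r; first by apply: divr_ge0 => //; exact: ltW.
  have : 4 * b <= B * (4 / g 2 - 1).
    have zn : 4 / g 2 - 1 != 0 by rewrite gt_eqF.
    rewrite /B [leRHS]mulrDl [X in _ + X](divfK zn) lerDr.
    by apply: mulr_ge0 => //; exact: ltW.
  by rewrite mulrBr mulr1 lerBrDl.
have base t : 1 <= t <= 2 -> F t <= B * t ^+ 2 / g t.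
  move=> /andP[t1 t2]; have t0 : 0 < t by rewrite (lt_le_trans ltr01).
  have g0 := g_gt0 t0.
  rewrite ler_pdivlMr//.
  have gt2 : g t <= g 2 by apply: g_le => //; exact: ltW.
  apply: (@le_trans _ _ (t ^+ 2 * N * g 2)).
    by apply: ler_pM; rewrite ?F_ge0 ?F_le//; exact: ltW.
  rewrite -mulrA mulrC ler_wpM2r ?sqr_ge0//.
  by rewrite /B lerDl.
have all n t : 1 <= t -> t <= 2 ^+ n.+1 -> F t <= B * t ^+ 2 / g t.
  elim: n t => [|n IH] t t1 tn; first by apply: base; rewrite t1.
  have [t2|t2] := leP t 2; first by apply: base; rewrite t1.
  have -> : t = 2 * (t / 2) by field.
  apply: step; first by lra.
  apply: IH; first by lra.
  by rewrite ler_pdivrMr// mulrC -exprS.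
move=> t t1.
have [n tn] : exists n, t <= 2 ^+ n.+1.
  exists (Num.truncn t).+1; have t0 : 0 <= t by rewrite (le_trans ler01).
  have := truncnS_gt t; move/ltW => /le_trans; apply.
  by rewrite -natrX ler_nat ltnW// (leq_trans (ltn_expl _ (ltnSn 1)))// leq_exp2l.
exact: all n t t1 tn.
Qed.

(** The upper bound of J is a sum over dyadic shells, each of which is seen by I at the
    inverse scale. For the lower bound, I is taken at the scale 1 / (A t): the part of it
    due to frequencies below t is of relative order A^(gamma - 2), hence negligible for
    A large, so that the tail beyond t has to account for the rest. *)
Let two_sided_I_J c1 c2 : 0 < c1 -> 0 < c2 ->
  (forall e, 0 <= e <= 1 -> c1 * g e <= I e /\ I e <= c2 * g e) ->
  exists b1 b2, [/\ 0 < b1, 0 < b2 & forall t, 1 <= t -> b1 / g t <= J t /\ J t <= b2 / g t].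
Proof.
move=> c10 c20 hI.
pose K := 4 * c2 / m.
have K0 : 0 < K by rewrite !divr_gt0// mulr_gt0.
have iG : 0 < 1 - (g 2)^-1 by rewrite subr_gt0 invf_lt1// g_gt0.
pose B := K / (1 - (g 2)^-1).
have B0 : 0 < B by rewrite divr_gt0.
have shell t : 1 <= t -> J t <= B / g t - B / g (2 * t) + J (2 * t).
  move=> t1; have t0 : 0 < t by rewrite (lt_le_trans ltr01).
  have g0 := g_gt0 t0.
  have t20 : 0 < 2 * t by rewrite mulr_gt0.
  have FJ := FJ_lower t0 (_ : t <= 2 * t).
  have {}FJ : t ^+ 2 * (J t - J (2 * t)) <= F (2 * t) - F t by apply: FJ; lra.
  have e0 : 0 < (2 * t)^-1 by rewrite invr_gt0.
  have e1 : 0 <= (2 * t)^-1 <= 1 by rewrite ltW//= invf_le1//; lra.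
  have := I_lower e0; rewrite invrK => Il.
  have [_ Iu] := hI _ e1.
  have h1 : m * ((2 * t)^-1 ^+ 2 * (t ^+ 2 * (J t - J (2 * t)))) <= c2 * g (2 * t)^-1.
    apply: le_trans Iu; apply: le_trans Il; rewrite ler_pM2l// ler_wpM2l ?sqr_ge0//.
    by have := F_ge0 t; lra.
  have h2 : m * ((2 * t)^-1 ^+ 2 * (t ^+ 2 * (J t - J (2 * t)))) = m / 4 * (J t - J (2 * t)).
    by field; rewrite gt_eqF.
  rewrite h2 gV// in h1.
  have h3 : J t - J (2 * t) <= K / g (2 * t).
    rewrite /K; have -> : 4 * c2 / m / g (2 * t) = (m / 4)^-1 * (c2 / g (2 * t)).
      by field; rewrite !gt_eqF// g_gt0.
    by rewrite ler_pdivlMl ?divr_gt0.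
  have h4 : K / g (2 * t) <= K / g t.
    by rewrite (ler_wpM2l (ltW K0))// lef_pV2 ?posrE ?g_gt0// g_mono.
  have h5 : B / g t - B / g (2 * t) = K / g t.
    rewrite gM// /B; have := g2_gt1; have := g_gt0 (ltr0Sn R 1) => ? ?.
    by field; rewrite !gt_eqF//= ?subr_gt0//.
  by rewrite h5; lra.
have J_up t : 1 <= t -> J t <= B / g t.
  move=> t1; have t0 : 0 < t by rewrite (lt_le_trans ltr01).
  have iter n : J t <= B / g t - B / g (2 ^+ n * t) + J (2 ^+ n * t).
    elim: n => [|n IH]; first by rewrite expr0 mul1r subrr add0r.
    have s1 : 1 <= 2 ^+ n * t by rewrite mulr_ege1// exprn_ege1// ler1n.
    by have := shell _ s1; rewrite mulrA -exprS; lra.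
  rewrite leNgt; apply/negP => h.
  have e0 : 0 < (J t - B / g t) / 2 by rewrite divr_gt0// subr_gt0.
  have [n hn] := J_lim e0 t0.
  have s0 : 0 < 2 ^+ n * t by rewrite mulr_gt0// exprn_gt0.
  have := iter n; have : 0 < B / g (2 ^+ n * t) by rewrite divr_gt0// g_gt0.
  by lra.
have [Bf Bf0 Fb] := F_bound (ltW B0) J_up.
have r0 : 0 < 2 - gamma by rewrite subr_gt0.
have [A A1 hA] := powR_large (2 * M * Bf / c1) r0.
have A0 : 0 < A by rewrite (lt_le_trans ltr01).
have gA0 := g_gt0 A0.
have hA2 : Bf / A ^+ 2 <= c1 / (2 * M * g A).
  have AE : A `^ (2 - gamma) = A ^+ 2 / g A.
    by rewrite powRB ?(gt_eqF A0) ?implybT// powR_mulrn// ltW.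
  rewrite AE ler_pdivrMr// in hA.
  rewrite ler_pdivrMr ?exprn_gt0// mulrAC ler_pdivlMr ?mulr_gt0//.
  have : 2 * M * Bf * g A <= A ^+ 2 / g A * c1 * g A by rewrite ler_wpM2r// ltW.
  have -> : A ^+ 2 / g A * c1 * g A = c1 * A ^+ 2 by field; rewrite gt_eqF.
  by lra.
exists (c1 / (2 * M * g A)), B; split=> //; first by rewrite divr_gt0// !mulr_gt0.
move=> t t1; split; last exact: J_up.
have t0 : 0 < t by rewrite (lt_le_trans ltr01).
have g0 := g_gt0 t0.
have At0 : 0 < A * t by rewrite mulr_gt0.
have e0 : 0 < (A * t)^-1 by rewrite invr_gt0.
have e1 : 0 <= (A * t)^-1 <= 1 by rewrite ltW//= invf_le1// mulr_ege1.
have [Il _] := hI _ e1; have Iu := I_upper e0 t0; have Ft := Fb t t1.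
rewrite gV// gM// in Il.
have h1 : (A * t)^-1 ^+ 2 * F t <= Bf / A ^+ 2 / g t.
  have -> : Bf / A ^+ 2 / g t = (A * t)^-1 ^+ 2 * (Bf * t ^+ 2 / g t).
    by field; rewrite !gt_eqF.
  by rewrite ler_wpM2l ?sqr_ge0.
have h2 : c1 / (2 * M * g A) / g t = c1 / (g A * g t) / M - c1 / (2 * M * g A) / g t.
  by field; rewrite !gt_eqF.
have h3 : c1 / (g A * g t) / M <= (A * t)^-1 ^+ 2 * F t + J t.
  by rewrite ler_pdivrMr// mulrC [leRHS]mulrC; apply: le_trans Iu; rewrite mulrC.
have h4 : Bf / A ^+ 2 / g t <= c1 / (2 * M * g A) / g t.
  by rewrite ler_wpM2r// invr_ge0 ltW.
by lra.
Qed.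

(** For e <= 1 / A, the shell between 1 / (A e) and 1 / e carries a fixed part of the
    mass beyond 1 / (A e), because gamma > 0 and A is large, and I sees it. For the
    remaining scales, doubling e a fixed number of times leads to the range where I is
    bounded below. *)
Let two_sided_J_I b1 b2 : 0 < b1 -> 0 < b2 ->
  (forall t, 1 <= t -> b1 / g t <= J t /\ J t <= b2 / g t) ->
  exists c1 c2, [/\ 0 < c1, 0 < c2 &
    forall e, 0 <= e <= 1 -> c1 * g e <= I e /\ I e <= c2 * g e].
Proof.
move=> b10 b20 hJ.
have [Bf Bf0 Fb] := F_bound (ltW b20) (fun t t1 => (hJ t t1).2).
have Npos : 0 < N.
  have [h _] := hJ 1 (lexx 1); apply: lt_le_trans (J_le 1); apply: lt_le_trans h.
  by rewrite divr_gt0// g_gt0.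
have [T [nu [nu0 hT]]] := I_large Npos.
have [A A1 hA] := powR_large (2 * b2 / b1) gamma0.
have A0 : 0 < A by rewrite (lt_le_trans ltr01).
have gA0 := g_gt0 A0.
have [k hk] : exists k, T * A <= 2 ^+ k.
  exists (Num.truncn (T * A)).+1.
  have := truncnS_gt (T * A); move/ltW => /le_trans; apply.
  by rewrite -natrX ler_nat ltnW// (ltn_expl _ (ltnSn 1)).
have double n e : I (2 ^+ n * e) <= 4 ^+ n * I e.
  elim: n => [|n IH]; first by rewrite !expr0 !mul1r.
  rewrite !exprS -!mulrA; apply: le_trans (I_double _) _.
  by rewrite ler_pM2l.
pose c0 := m / A ^+ 2 * (b1 / 2) * g A.
have c00 : 0 < c0 by rewrite !mulr_gt0// ?invr_gt0// ?exprn_gt0.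
pose c' := nu / 4 ^+ k.
have c'0 : 0 < c' by rewrite divr_gt0// exprn_gt0.
pose c1 := Num.min c0 c'.
exists c1, (M * (Bf + b2)); split.
- by rewrite lt_min c00.
- by rewrite mulr_gt0// ltr_wpDl.
move=> e /andP[]; rewrite le_eqVlt => /predU1P[<- _|e0 e1].
  by rewrite I0 /g powR0 ?gt_eqF// !mulr0.
have ge0 := g_gt0 e0.
have ie1 : 1 <= e^-1 by rewrite invf_ge1.
have ie0 : 0 < e^-1 by rewrite invr_gt0.
split; last first.
  apply: (le_trans (I_upper e0 ie0)); rewrite -[leRHS]mulrA ler_pM2l//.
  have [_ h1] := hJ _ ie1; have h2 := Fb _ ie1.
  rewrite gV// invrK in h1 h2; rewrite mulrDl lerD//.
  have -> : Bf * g e = e ^+ 2 * (Bf * e^-1 ^+ 2 * g e) by field; rewrite gt_eqF.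
  by rewrite ler_wpM2l ?sqr_ge0.
have [eA|eA] := leP (e * A) 1.
  apply: (@le_trans _ _ (c0 * g e)); first by rewrite (ler_wpM2r (ltW ge0))// ge_min lexx.
  pose t := (e * A)^-1.
  have eA0 : 0 < e * A by rewrite mulr_gt0.
  have t0 : 0 < t by rewrite invr_gt0.
  have t1 : 1 <= t by rewrite invf_ge1.
  have te : t <= e^-1 by rewrite lef_pV2 ?posrE// ler_peMr// ltW.
  apply: le_trans (I_lower e0); rewrite /c0.
  have FJ := FJ_lower t0 te.
  have [hl _] := hJ _ t1; have [_ hu] := hJ _ ie1.
  have gtE : (g t)^-1 = g e * g A by rewrite /t gV// invrK gM.
  rewrite gtE in hl; rewrite gV// invrK in hu.
  have h1 : b2 <= b1 / 2 * g A.
    by move: hA; rewrite -/(g A) ler_pdivrMr//; lra.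
  have h2 : b1 / 2 * g A * g e <= J t - J e^-1.
    have : b2 * g e <= b1 / 2 * g A * g e by rewrite ler_wpM2r// ltW.
    by move: hl hu; rewrite mulrA mulrC; nra.
  have h3 : m / A ^+ 2 * (b1 / 2) * g A * g e = m * (e ^+ 2 * (t ^+ 2 * (b1 / 2 * g A * g e))).
    by rewrite /t; field; rewrite !gt_eqF.
  rewrite h3 ler_pM2l// ler_wpM2l ?sqr_ge0//.
  apply: (@le_trans _ _ (t ^+ 2 * (J t - J e^-1))); first by rewrite ler_wpM2l ?sqr_ge0.
  by have := F_ge0 t; lra.
have ge1 : g e <= 1.
  by have := g_le (ltW e0) e1; rewrite {2}/g powR1.
apply: (@le_trans _ _ c').
  apply: (@le_trans _ _ (c' * g e)); first by rewrite (ler_wpM2r (ltW ge0))// ge_min lexx orbT.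
  by rewrite ler_piMr// ltW.
rewrite /c' ler_pdivrMr ?exprn_gt0// mulrC; apply: le_trans (double k e); apply: hT.
rewrite -(ler_pM2r A0); apply: (le_trans hk).
by rewrite -mulrA ler_peMr ?exprn_ge0// ltW.
Qed.

Theorem power_law_equivalence :
  (exists c1 c2, [/\ 0 < c1, 0 < c2 &
    forall e, 0 <= e <= 1 -> c1 * e `^ gamma <= I e /\ I e <= c2 * e `^ gamma]) <->
  (exists b1 b2, [/\ 0 < b1, 0 < b2 &
    forall t, 1 <= t -> b1 * t `^ (- gamma) <= J t /\ J t <= b2 * t `^ (- gamma)]).
Proof.
split.
  move=> [c1 [c2 [c10 c20 h]]].
  have [b1 [b2 [b10 b20 h']]] := two_sided_I_J c10 c20 h.
  by exists b1, b2; split => // t t1; rewrite !powRN; exact: h'.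
move=> [b1 [b2 [b10 b20 h]]].
apply: (two_sided_J_I b10 b20) => t t1.
by have := h t t1; rewrite !powRN.
Qed.

End tauber.

(** * Trigonometric inequalities, Euclidean geometry and polar coordinates *)

Section trig.
Context {R : realType}.
Implicit Types s x : R.

Lemma sin_mvt x : 0 < x -> exists2 c, 0 < c < x & sin x = cos c * x.
Proof.
move=> x0.
have cs : {within `[0, x], continuous (@sin R)}.
  by apply: continuous_subspaceT => y; exact: continuous_sin.
have [c cx] := MVT x0 (fun y _ => is_derive_sin y) cs.
by rewrite sin0 !subr0 => e; exists c => //; move: cx; rewrite in_itv.
Qed.

Lemma sqr_sin_le x : sin x ^+ 2 <= x ^+ 2.
Proof.
wlog x0 : x / 0 <= x => [H|].
  have [x0|/ltW x0] := leP 0 x; first exact: H.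
  by have := H (- x); rewrite sinN !sqrrN oppr_ge0; exact.
move: x0; rewrite le_eqVlt => /predU1P[<-|/sin_mvt[c _ ->]].
  by rewrite sin0.
rewrite exprMn ler_piMl ?sqr_ge0//.
Qed.

Lemma one_sub_cos s : 1 - cos s = 2 * sin (s / 2) ^+ 2.
Proof.
have {1}-> : s = s / 2 + s / 2 by field.
rewrite cosD -[X in X - _](cos2Dsin2 (s / 2)); ring.
Qed.

Lemma one_sub_cos_le s : 2 * (1 - cos s) <= s ^+ 2.
Proof.
by rewrite one_sub_cos; have := sqr_sin_le (s / 2); rewrite exprMn exprVn; lra.
Qed.

Lemma one_sub_cos_ge0 s : 0 <= 1 - cos s.
Proof. by rewrite subr_ge0 cos_le1. Qed.

(** By the mean value theorem sin (s / 2) is s / 2 times cos c with 0 < c < s / 2, and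
    cos c >= 1 - c^2 / 2 >= 1 / 2. *)
Lemma one_sub_cos_ge s : s ^+ 2 <= 1 -> s ^+ 2 / 4 <= 2 * (1 - cos s).
Proof.
wlog s0 : s / 0 <= s => [H|].
  have [s0|/ltW s0] := leP 0 s; first exact: H.
  by have := H (- s); rewrite cosN !sqrrN oppr_ge0; exact.
move: s0; rewrite le_eqVlt => /predU1P[<- _|s0 s1].
  by rewrite cos0 expr0n /= mul0r subrr mulr0.
have s20 : 0 < s / 2 by rewrite divr_gt0.
have [c /andP[c0 cs] e] := sin_mvt s20.
rewrite one_sub_cos e.
have c2 : c ^+ 2 <= s ^+ 2 by rewrite ler_sqr ?nnegrE; lra.
have := one_sub_cos_le c => cc.
have hc : 2^-1 <= cos c by lra.
have : (2^-1) ^+ 2 <= cos c ^+ 2 by rewrite ler_sqr ?nnegrE; lra.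
rewrite !exprMn => h.
have := sqr_ge0 s; move: h; move: (cos c ^+ 2) (s ^+ 2) => a b; nra.
Qed.

(** From 1 - cos (2 s) = 2 (1 - cos s) (1 + cos s). *)
Lemma one_sub_cos_double s : 1 - cos (2 * s) <= 4 * (1 - cos s).
Proof.
rewrite mulrDl mul1r cosD -expr2 -expr2.
have := cos2Dsin2 s; have := cos_le1 s; have := cos_geN1 s.
by move: (cos s) (sin s) => a b; nra.
Qed.

End trig.

Section geometry.
Context {R : realType}.
Local Notation mR := (measurableTypeR R).
Local Notation lam := (@lebesgue_measure R).
Local Notation mu := (@lebesgue_tuple R).

Lemma dott_ge0 n (x : n.-tuple R) : 0 <= dott x x.
Proof. by apply: sumr_ge0 => i _; rewrite -expr2 sqr_ge0. Qed.

Lemma normt_sqr n (x : n.-tuple R) : normt x ^+ 2 = dott x x.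
Proof. by rewrite sqr_sqrtr ?dott_ge0. Qed.

Lemma normt_ge0 n (x : n.-tuple R) : 0 <= normt x.
Proof. exact: sqrtr_ge0. Qed.

Lemma dott_scalet n (a : R) (x y : n.-tuple R) : dott x (scalet a y) = a * dott x y.
Proof.
by rewrite /dott mulr_sumr; apply: eq_bigr => i _; rewrite tnth_mktuple mulrCA.
Qed.

Lemma normt_scalet n (a : R) (x : n.-tuple R) : normt (scalet a x) = `|a| * normt x.
Proof.
rewrite /normt (_ : dott _ _ = a ^+ 2 * dott x x); last first.
  rewrite dott_scalet expr2 -mulrA; congr (_ * _); rewrite /dott mulr_sumr.
  by apply: eq_bigr => i _; rewrite tnth_mktuple mulrA.
by rewrite sqrtrM ?sqr_ge0// sqrtr_sqr.
Qed.

(** The squared norm of x + l y is nonnegative at the l that minimizes it. *)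
Lemma dott_CS n (x y : n.-tuple R) : dott x y ^+ 2 <= dott x x * dott y y.
Proof.
have key (l : R) : 0 <= dott x x + 2 * l * dott x y + l ^+ 2 * dott y y.
  rewrite /dott !mulr_sumr -!big_split /=; apply: sumr_ge0 => i _.
  rewrite (_ : _ + _ = (tnth x i + l * tnth y i) ^+ 2) ?sqr_ge0//; ring.
have := dott_ge0 y; rewrite le_eqVlt => /predU1P[y0|y0].
  rewrite -y0 mulr0; have [->|b0] := eqVneq (dott x y) 0; first by rewrite expr0n.
  have := key (- (dott x x + 1) / (2 * dott x y)); rewrite -y0 mulr0 addr0.
  rewrite (_ : 2 * _ * _ = - (dott x x + 1)); last by field; rewrite b0.
  by rewrite opprD addrA subrr sub0r oppr_ge0 ler10.
have := key (- dott x y / dott y y).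
have -> : dott x x + 2 * (- dott x y / dott y y) * dott x y +
    (- dott x y / dott y y) ^+ 2 * dott y y = dott x x - dott x y ^+ 2 / dott y y.
  by field; rewrite gt_eqF.
by rewrite subr_ge0 ler_pdivrMr.
Qed.

Lemma normt_addt_ge n (x h : n.-tuple R) (M : R) : 0 <= M ->
  normt x < M -> 2 * M <= normt h -> M <= normt (addt x h).
Proof.
move=> M0 xM hM; rewrite leNgt; apply/negP => xhM.
have : dott h h <= 2 * dott (addt x h) (addt x h) + 2 * dott x x.
  rewrite /dott !mulr_sumr -big_split /=; apply: ler_sum => i _.
  rewrite tnth_mktuple; have := sqr_ge0 (2 * tnth x i + tnth h i).
  by move: (tnth x i) (tnth h i) => a b; nra.
rewrite -!normt_sqr.
have := normt_ge0 x; have := normt_ge0 (addt x h).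
by move: xM hM xhM; move: (normt x) (normt h) (normt (addt x h)) => a b c; nra.
Qed.

Definition pball n : set (n.-tuple R) := [set x | 0 < normt x <= 1].

(** Radial projection to the sphere, set to 0 off the ball, so that the preimage of the
    sphere is exactly the ball. *)
Let proj n (x : n.-tuple R) : n.-tuple R := scalet (\1_(@pball n) x * (normt x)^-1) x.

Let measurable_proj n : measurable_fun setT (@proj n).
Proof.
apply/measurable_fun_tnthP => i.
rewrite (_ : _ \o _ = (fun x => \1_(@pball n) x * (normt x)^-1 * tnth x i)); last first.
  by apply/funext => x /=; rewrite tnth_mktuple.
apply: measurable_funM; last exact: measurable_tnth.
apply: measurable_funM.
  by apply: measurable_indic; exact: measurable_punctured_ball.
by apply: measurableT_comp (@measurable_normt R n); exact: measurable_invr.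
Qed.

Let proj_in n (x : n.-tuple R) : pball x -> proj x = normalize x.
Proof. by move=> Bx; rewrite /proj indicE mem_set// mul1r. Qed.

Lemma normt_normalize n (x : n.-tuple R) : 0 < normt x -> normt (normalize x) = 1.
Proof.
move=> x0; rewrite /normalize normt_scalet gtr0_norm ?invr_gt0//.
by rewrite mulVf// gt_eqF.
Qed.

Let proj_sphere n : @proj n @^-1` (sphere n) = @pball n.
Proof.
apply/seteqP; split=> x /=; rewrite /sphere /=.
  rewrite /proj normt_scalet indicE; case: (boolP (x \in _)) => [|_].
    by rewrite inE.
  by rewrite mul0r normr0 mul0r => /eqP; rewrite eq_sym oner_eq0.
by move=> Bx; rewrite proj_in// normt_normalize//; case/andP: Bx.
Qed.

Lemma measurable_sphere n : measurable (@sphere R n).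
Proof.
rewrite (_ : sphere n = setT `&` (@normt R n) @^-1` [set 1]); last by rewrite setTI.
by apply: measurable_normt.
Qed.

(** Polar coordinates, read backwards: an integral over the sphere is an integral over
    the ball of the radial extension. *)
Lemma integral_sphere n (G : n.-tuple R -> \bar R) : measurable_fun setT G ->
  (forall y, 0 <= G y)%E ->
  (\int[sphere_measure n]_(y in sphere n) G y =
   n%:R%:E * \int[mu n]_(x in @pball n) G (normalize x))%E.
Proof.
move=> mG G0.
pose m := measure_function_pushforward__canonical__measure_function_Measure (mu n) (@measurable_proj n).
pose nn : {nonneg R} := NngNum (ler0n R n).
rewrite (@eq_measure_integral _ _ _ _ (mscale nn m)); last first.
  move=> A mA AS; rewrite /= /sphere_measure /mscale /= /pushforward; congr (_ * mu n _)%E.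
  apply/seteqP; split=> x /=.
    by move=> [Bx Ax]; rewrite proj_in.
  move=> Ax; have Bx : pball x.
    by rewrite -[pball x]/((@pball n) x) -proj_sphere /=; exact: AS.
  by split => //; rewrite -proj_in.
have mS := @measurable_sphere n.
rewrite ge0_integral_mscale//; last exact: measurable_funTS.
congr (_ * _)%E; rewrite (ge0_integral_pushforward (@measurable_proj n))//; last exact: measurable_funTS.
rewrite proj_sphere; apply: eq_integral => x; rewrite inE => Bx /=.
by rewrite proj_in.
Qed.

End geometry.

(** * The averaged oscillation over the sphere *)

(** Indicator of a cube as a product over the coordinates, so that integrals factor. *)
Section cube.
Context {R : realType}.
Local Notation mR := (measurableTypeR R).
Local Notation lam := (@lebesgue_measure R).
Local Notation mu := (@lebesgue_tuple R).

Definition cube n (a : R) (x : n.-tuple R) : R :=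
  \prod_(i < n) \1_(`[- a, a]%classic : set R) (tnth x i).

Lemma cube_cons n a t (y : n.-tuple R) :
  cube a (cons_pair (t, y)) = \1_(`[- a, a]%classic : set R) t * cube a y.
Proof.
rewrite /cube big_ord_recl tnth0; congr (_ * _); apply: eq_bigr => i _.
by rewrite tnthS.
Qed.

Lemma measurable_cube n a : measurable_fun setT (@cube n a).
Proof.
rewrite /cube; apply: measurable_prod => i _.
apply: measurableT_comp; last exact: measurable_tnth.
by apply: measurable_indic; exact: measurable_itv.
Qed.

Lemma cube_ge0 n a (x : n.-tuple R) : 0 <= cube a x.
Proof. by apply: prodr_ge0 => i _. Qed.

Lemma cubeP n a (x : n.-tuple R) :
  cube a x = if [forall i, `|tnth x i| <= a] then 1 else 0.
Proof.
case: ifPn => [/forallP h|/forallPn[i hi]].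
  apply: big1 => i _; rewrite indicE mem_set//=.
  by have := h i; rewrite in_itv/= ler_norml.
apply/eqP; rewrite /cube (bigD1 i)//= indicE memNset ?mul0r//=.
by rewrite in_itv/= -ler_norml; exact/negP.
Qed.

Lemma integral_itv_quadratic (a c s b k : R) : 0 < a ->
  (\int[lam]_(t in `[(- a)%R, a]) (c * ((s + b * t) ^+ 2 + k))%:E =
   (c * (2 * a) * (s ^+ 2 + a ^+ 2 / 3 * b ^+ 2 + k))%:E)%E.
Proof.
move=> a0.
pose f t : R := c * ((s + b * t) ^+ 2 + k).
pose F t : R := c * (s ^+ 2 * t + s * b * t ^+ 2 + b ^+ 2 / 3 * t ^+ 3 + k * t).
have dF t : is_derive t (1:R) F (f t).
  by apply: is_derive_eq; rewrite /f /GRing.scale /=; field.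
have cf : continuous f.
  move=> t; apply: cvgM; first exact: cvg_cst.
  apply: cvgD; last exact: cvg_cst.
  apply: (@continuous_comp _ _ _ (fun t => s + b * t) (fun z => z ^+ 2)); last exact: exprn_continuous.
  by apply: cvgD; [exact: cvg_cst|exact: mulrl_continuous].
have cF : continuous F.
  by move=> t; apply/differentiable_continuous/derivable1_diffP; have [] := dF t.
rewrite (_ : (c * (2 * a) * (s ^+ 2 + a ^+ 2 / 3 * b ^+ 2 + k))%:E = (F a)%:E - (F (- a))%:E)%E; last first.
  by rewrite -EFinB; congr EFin; rewrite /F; field.
apply: (@continuous_FTC2 _ f F).
- by rewrite gtrN.
- exact: continuous_subspaceT.
- split.
  + by move=> t _; have [] := dF t.
  + exact: cvg_at_right_filter (cF _).
  + exact: cvg_at_left_filter (cF _).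
- by move=> t _; rewrite derive1E derive_val.
Qed.

(** The coordinates are orthogonal over a symmetric cube. The shift s carries the part of
    the linear form already integrated, which is what makes the induction go through. *)
Lemma integral_cube n (a : R) (xi : n.-tuple R) (s : R) : 0 < a ->
  (\int[mu n]_x ((s + dott xi x) ^+ 2 * cube a x)%:E =
   ((2 * a) ^+ n * (s ^+ 2 + a ^+ 2 / 3 * dott xi xi))%:E)%E.
Proof.
move=> a0; elim: n xi s => [|n IH] xi s.
  transitivity (\int[mu 0]_x (s ^+ 2)%:E)%E.
    apply: eq_integral => x _; congr EFin.
    by rewrite /cube /dott !big_ord0 mulr1 addr0.
  rewrite integral_cst// /mu /= diracT mule1; congr EFin.
  by rewrite expr0 mul1r /dott big_ord0 mulr0 addr0.
have [b [eta ->]] := tuple_consE xi.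
have md : measurable_fun setT (fun x : n.+1.-tuple R => ((s + dott (cons_pair (b, eta)) x) ^+ 2 * cube a x)%:E).
  apply/measurable_EFinP/measurable_funM; last exact: measurable_cube.
  apply: measurable_funX; apply: measurable_funD => //; exact: measurable_dott.
rewrite (ge0_integral_cons md); last first.
  by move=> x; rewrite lee_fin mulr_ge0 ?sqr_ge0 ?cube_ge0.
transitivity (\int[lam]_t (((2 * a) ^+ n * ((s + b * t) ^+ 2 + a ^+ 2 / 3 * dott eta eta)) *
    \1_(`[- a, a]%classic : set R) t)%:E)%E.
  apply: eq_integral => t _.
  rewrite mulrC EFinM -IH -ge0_integralZl//.
  - by apply: eq_integral => y _; rewrite -EFinM cube_cons dott_cons addrA; congr EFin; ring.
  - apply/measurable_EFinP/measurable_funM; last exact: measurable_cube.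
    apply: measurable_funX; apply: measurable_funD => //; exact: measurable_dott.
  - by move=> y _; rewrite lee_fin mulr_ge0 ?sqr_ge0 ?cube_ge0.
transitivity (\int[lam]_(t in `[(- a)%R, a])
    ((2 * a) ^+ n * ((s + b * t) ^+ 2 + a ^+ 2 / 3 * dott eta eta))%:E)%E.
  rewrite [RHS]integral_mkcond; apply: eq_integral => t _.
  by rewrite patchE indicE; case: ifP => _; rewrite ?mulr1 ?mulr0.
rewrite integral_itv_quadratic//; congr EFin.
rewrite dott_cons (exprS (2 * a)) -[b]/(b : R).
by move: (b : R) (dott eta eta) => w v; field.
Qed.

End cube.

(** The directions are taken from the points of the ball, as in [integral_sphere]. *)
Section sphere_kernel.
Context {R : realType} {n : nat}.
Local Notation mu := (@lebesgue_tuple R n).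
Local Notation B := (@pball R n).

Let mB : measurable B. Proof. exact: measurable_punctured_ball. Qed.

Lemma abs_tnth_le_normt (x : n.-tuple R) i : `|tnth x i| <= normt x.
Proof.
rewrite -ler_sqr ?nnegrE ?normt_ge0// real_normK ?num_real// normt_sqr.
by rewrite /dott (bigD1 i)//= -expr2 lerDl sumr_ge0// => j _; rewrite -expr2 sqr_ge0.
Qed.

Lemma pball_le : (mu B <= ((2 * 1) ^+ n)%:E)%E.
Proof.
(* The shift 1 with the zero linear form gives the volume of the cube. *)
have := integral_cube (nseq_tuple n (0 : R)) 1 (@ltr01 R).
have d0 (x : n.-tuple R) : dott (nseq_tuple n (0 : R)) x = 0.
  by apply: big1 => i _; rewrite tnth_nseq mul0r.
rewrite d0 mulr0 addr0 expr1n mulr1 => <-.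
rewrite -[X in mu X](setIT B) -integral_indic//.
apply: ge0_le_integral => //.
- exact/measurable_EFinP/measurable_indic.
- apply/measurable_EFinP/measurable_funM; last exact: measurable_cube.
  by apply: measurable_funX; apply: measurable_funD => //; exact: measurable_dott.
- move=> x _; rewrite lee_fin d0 addr0 expr1n mul1r indicE cubeP.
  have [|_] := boolP (x \in B); last by case: ifP.
  rewrite inE => /andP[_ x1]; rewrite ifT//.
  by apply/forallP => i; rewrite (le_trans (abs_tnth_le_normt x i)).
Qed.

Definition pball_volume : R := fine (mu B).

Lemma pball_volumeE : mu B = pball_volume%:E.
Proof.
by rewrite /pball_volume fineK// ge0_fin_numE// (le_lt_trans pball_le)// ltry.
Qed.

Lemma pball_volume_ge0 : 0 <= pball_volume.
Proof. by rewrite fine_ge0. Qed.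

(** Half the side of a cube contained in the unit ball: the squared norm is at most
    n / (n + 1)^2 there. *)
Definition side : R := n.+1%:R^-1.

(** By [integral_cube], the integral over that cube of the square of a linear form of unit
    norm. *)
Definition quad_const : R := (2 * side) ^+ n * (side ^+ 2 / 3).

Lemma quad_const_gt0 : 0 < quad_const.
Proof.
have s0 : 0 < side by rewrite invr_gt0.
by rewrite mulr_gt0 ?exprn_gt0 ?mulr_gt0 ?divr_gt0 ?exprn_gt0.
Qed.

Lemma measurable_dott_normalize (xi : n.-tuple R) :
  measurable_fun setT (fun x => dott xi (normalize x)).
Proof. exact: (measurableT_comp (measurable_dott xi) (@measurable_normalize R n)). Qed.

(** The ball contains a cube, over which the quadratic form is explicit; inside the unit
    ball, projecting a point to the sphere only increases the form. *)
Lemma integral_quadratic_ge (xi : n.-tuple R) :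
  ((quad_const * dott xi xi)%:E <= \int[mu]_(x in B) (dott xi (normalize x) ^+ 2)%:E)%E.
Proof.
have s0 : 0 < side by rewrite invr_gt0.
have := integral_cube xi 0 s0.
rewrite expr0n /= add0r mulrA -/quad_const => <-.
rewrite [leRHS]integral_mkcond; apply: ge0_le_integral => //.
- by move=> x _; rewrite lee_fin mulr_ge0 ?sqr_ge0 ?cube_ge0.
- apply/measurable_EFinP/measurable_funM; last exact: measurable_cube.
  by apply: measurable_funX; apply: measurable_funD => //; exact: measurable_dott.
- apply/(measurable_restrictT _ _).1 => //; apply: measurable_funTS.
  by apply/measurable_EFinP/measurable_funX; exact: measurable_dott_normalize.
move=> x _; rewrite add0r patchE cubeP.
have [/forallP h|_] := ifPn; last first.
  by rewrite mulr0; case: ifP => _; rewrite lee_fin ?sqr_ge0.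
rewrite mulr1.
have nx2 : normt x ^+ 2 <= 1.
  rewrite normt_sqr /dott.
  apply: (@le_trans _ _ (\sum_(i < n) side ^+ 2)).
    apply: ler_sum => i _; rewrite -expr2 -(real_normK (num_real (tnth x i))).
    by rewrite ler_sqr ?nnegrE// ltW.
  rewrite sumr_const card_ord -mulr_natl /side exprVn ler_pdivrMr ?exprn_gt0// mul1r.
  by rewrite -natrX ler_nat (leq_trans (leqnSn n))// expnS expn1 leq_pmull.
have nx0 := normt_ge0 x.
have nx1 : normt x <= 1 by rewrite -(@ler_pXn2r _ 2)// ?nnegrE// expr1n.
have [x0|x0] := eqVneq (normt x) 0.
  have := dott_CS xi x; rewrite -[dott x x]normt_sqr x0 expr0n/= mulr0 => h0.
  by case: ifP => _; rewrite lee_fin// (le_trans h0)// sqr_ge0.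
have xp : 0 < normt x by rewrite lt_neqAle eq_sym x0.
rewrite mem_set ?lee_fin; last by rewrite /pball /= xp.
rewrite /normalize dott_scalet exprMn ler_peMl ?sqr_ge0// exprVn.
by rewrite invf_ge1 ?exprn_gt0.
Qed.

(** A nonzero quadratic form has a positive integral over the ball, which it could not have over a
    null set. *)
Lemma pball_volume_gt0 : (0 < n)%N -> 0 < pball_volume.
Proof.
move=> n0; pose xi : n.-tuple R := nseq_tuple n 1.
have xi0 : 0 < dott xi xi.
  rewrite /dott (eq_bigr (fun=> 1)); last by move=> i _; rewrite tnth_nseq mulr1.
  by rewrite sumr_const card_ord ltr0n.
have := integral_quadratic_ge xi.
rewrite lt_neqAle pball_volume_ge0 andbT; apply: contraTneq => V0.
rewrite -ltNge null_set_integral//.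
- by rewrite lte_fin mulr_gt0// quad_const_gt0.
- apply/measurable_EFinP; apply: measurable_funTS; apply: measurable_funX.
  exact: measurable_dott_normalize.
- by rewrite -[LHS]/(mu B) pball_volumeE -V0.
Qed.

(** The squared modulus of exp (i e xi.y) - 1 at the direction y of x. *)
Definition osc (e : R) (xi x : n.-tuple R) : R :=
  2 * (1 - cos (e * dott xi (normalize x))).

Definition sphere_kernel (e : R) (xi : n.-tuple R) : R :=
  Rintegral mu B (osc e xi).

Lemma osc_ge0 e xi x : 0 <= osc e xi x.
Proof. by rewrite mulr_ge0// one_sub_cos_ge0. Qed.

Lemma osc_le4 e xi x : osc e xi x <= 4.
Proof. by have := cos_geN1 (e * dott xi (normalize x)); rewrite /osc; lra. Qed.

Lemma measurable_osc e xi : measurable_fun setT (osc e xi).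
Proof.
apply: measurable_funM => //; apply: measurable_funB => //.
apply: measurable_cos_comp; apply: measurable_funM => //.
exact: measurable_dott_normalize.
Qed.

Let ibounded (f : n.-tuple R -> R) (M : R) : measurable_fun setT f ->
  (forall x, B x -> `|f x| <= M) -> mu.-integrable B (EFin \o f).
Proof.
move=> mf fM; apply: measurable_bounded_integrable => //.
- by rewrite -[ltLHS]/(mu B) pball_volumeE ltry.
- exact: measurable_funTS.
- by exists M; split=> [|y My x Bx]; [exact: num_real|exact: (le_trans (fM x Bx) (ltW My))].
Qed.

Lemma integrable_osc e xi : mu.-integrable B (EFin \o osc e xi).
Proof.
apply: (@ibounded _ 4); first exact: measurable_osc.
by move=> x _; rewrite ger0_norm ?osc_ge0// osc_le4.
Qed.

Lemma integral_osc e xi : (\int[mu]_(x in B) (osc e xi x)%:E = (sphere_kernel e xi)%:E)%E.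
Proof. by rewrite /sphere_kernel /Rintegral fineK// integrable_fin_num//; exact: integrable_osc. Qed.

Lemma sphere_kernel_ge0 e xi : 0 <= sphere_kernel e xi.
Proof. by apply: Rintegral_ge0 => x _; exact: osc_ge0. Qed.

Let sphere_kernel_le_cst e xi (M : R) : (forall x, B x -> osc e xi x <= M) ->
  sphere_kernel e xi <= pball_volume * M.
Proof.
move=> h; rewrite -lee_fin -integral_osc mulrC EFinM -pball_volumeE.
rewrite -[X in (_ <= X)%E](@integral_cst _ _ _ mu B)//.
apply: ge0_le_integral => //.
- by move=> x _; rewrite lee_fin osc_ge0.
- by apply/measurable_EFinP; apply: measurable_funTS; exact: measurable_osc.

Qed.

Lemma sphere_kernel_le4 e xi : sphere_kernel e xi <= pball_volume * 4.
Proof. by apply: sphere_kernel_le_cst => x _; exact: osc_le4. Qed.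

Lemma dott_normalize_le xi (x : n.-tuple R) : B x ->
  dott xi (normalize x) ^+ 2 <= normt xi ^+ 2.
Proof.
case/andP => x0 _; rewrite (le_trans (dott_CS _ _))//.
by rewrite -!normt_sqr normt_normalize// expr1n mulr1.
Qed.

Lemma sphere_kernel_le_sqr e xi : sphere_kernel e xi <= pball_volume * (e ^+ 2 * normt xi ^+ 2).
Proof.
apply: sphere_kernel_le_cst => x Bx; apply: (le_trans (one_sub_cos_le _)).
by rewrite exprMn ler_wpM2l ?sqr_ge0// dott_normalize_le.
Qed.

Lemma sphere_kernel_ge_sqr e xi : e ^+ 2 * normt xi ^+ 2 <= 1 ->
  quad_const / 4 * (e ^+ 2 * normt xi ^+ 2) <= sphere_kernel e xi.
Proof.
move=> h; rewrite -lee_fin -integral_osc.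
apply: (@le_trans _ _ (\int[mu]_(x in B) ((e ^+ 2 / 4)%:E * (dott xi (normalize x) ^+ 2)%:E))%E).
  rewrite ge0_integralZl//; last 3 first.
  - apply/measurable_EFinP; apply: measurable_funTS; apply: measurable_funX.
    exact: measurable_dott_normalize.
  - by move=> x _; rewrite lee_fin sqr_ge0.
  - by rewrite lee_fin divr_ge0 ?sqr_ge0.
  apply: (@le_trans _ _ ((e ^+ 2 / 4)%:E * (quad_const * dott xi xi)%:E)%E).
    by rewrite -EFinM lee_fin normt_sqr le_eqVlt; apply/orP; left; apply/eqP; field.
  apply: lee_wpmul2l; first by rewrite lee_fin divr_ge0 ?sqr_ge0.
  exact: integral_quadratic_ge.
apply: ge0_le_integral => //.
- by move=> x _; rewrite -EFinM lee_fin mulr_ge0 ?divr_ge0 ?sqr_ge0.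
- apply: measurable_funeM; apply/measurable_EFinP; apply: measurable_funTS; apply: measurable_funX.
  exact: measurable_dott_normalize.
- by apply/measurable_EFinP; apply: measurable_funTS; exact: measurable_osc.
move=> x Bx; rewrite -EFinM lee_fin.
rewrite mulrAC -exprMn; apply: one_sub_cos_ge; rewrite exprMn.
by apply: le_trans h; rewrite ler_wpM2l ?sqr_ge0// dott_normalize_le.
Qed.

Lemma sphere_kernel_double e xi : sphere_kernel (2 * e) xi <= 4 * sphere_kernel e xi.
Proof.
rewrite /sphere_kernel -RintegralZl//; last exact: integrable_osc.
apply: le_Rintegral => //.
- exact: integrable_osc.
- by apply: (integrableZl mB 4 (integrable_osc e xi)).
- move=> x _; rewrite /osc -mulrA; have := one_sub_cos_double (e * dott xi (normalize x)).
  by lra.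
Qed.

Lemma sphere_kernel0 xi : sphere_kernel 0 xi = 0.
Proof.
apply/eqP; rewrite eq_le sphere_kernel_ge0 andbT (le_trans (sphere_kernel_le_sqr 0 xi))//.
by rewrite expr0n /= mul0r mulr0.
Qed.

Lemma measurable_osc2 e : measurable_fun [set: n.-tuple R * n.-tuple R]
  (fun z : n.-tuple R * n.-tuple R => osc e z.1 z.2).
Proof.
apply: measurable_funM => //; apply: measurable_funB => //.
apply: measurable_cos_comp; apply: measurable_funM => //.
apply: (measurableT_comp (@measurable_dott2 R n) (_ : measurable_fun setT (fun z : n.-tuple R * n.-tuple R => (z.1, normalize z.2)))).
apply/measurable_fun_pairP; split; first exact: measurable_fst.
exact: (measurableT_comp (@measurable_normalize R n) measurable_snd).
Qed.

Lemma measurable_sphere_kernel e : measurable_fun setT (sphere_kernel e).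
Proof.
rewrite (_ : sphere_kernel e = fun xi => Rintegral mu setT (fun x => osc e xi x * \1_B x)).
  apply: (@measurable_Rintegral_param _ _ _ _ R mu (fun z => osc e z.1 z.2 * \1_B z.2)).
  apply: measurable_funM; first exact: measurable_osc2.
  have mi : measurable_fun setT (\1_B : n.-tuple R -> R) by exact: measurable_indic.
  exact: (measurableT_comp mi (@measurable_snd _ _ (n.-tuple R) (n.-tuple R))).
apply/funext => xi; rewrite /sphere_kernel Rintegral_mkcond; apply: eq_Rintegral => x _.
by rewrite patchE indicE; case: ifP => _; rewrite ?mulr1 ?mulr0.
Qed.

End sphere_kernel.

(** * Distant translates *)

Section far_translation.
Context {R : realType} {d : nat}.
Local Notation mu := (@lebesgue_tuple R d).

(** A translate by at least 2 M moves the part of f inside the ball of radius M outside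
    of it, so f and its translate are nearly disjoint. Precisely, the mass E of f is at
    most twice the squared norm of the difference plus three times the tail of f beyond
    M, and M is chosen to make this tail at most E / 6. *)
Lemma L2sq_difference_lower_bound (f : d.-tuple R -> R[i]) : inLp 2%:E f -> (0 < L2sq f)%E ->
  exists T delta : R, 0 < delta /\ forall h, T <= normt h ->
    (delta%:E <= L2sq (fun x => f (addt x h) - f x)%R)%E.
Proof.
move=> hf E0; have [mf fy] := (inLp2E f).1 hf.
pose w x := normc2 (f x).
have w0 x : 0 <= w x by exact: normc2_ge0.
have mw : measurable_fun setT w by exact: measurable_normc2.
have iw : mu.-integrable setT (fun x => (w x)%:E) by exact: integrable_of_ge0_lty.
pose E := Rintegral mu setT w.
have EE : L2sq f = E%:E by exact: integrable_EFin_fine.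
have {E0}E0 : 0 < E by move: E0; rewrite EE lte_fin.
have e6 : 0 < E / 6 by rewrite divr_gt0.
have [M _ hM] := ereal_cvg0_lt (tail_integral_cvg0 mw (@measurable_normt R d) w0 fy) e6.
pose S := [set x : d.-tuple R | M%:R <= normt x].
have mS : measurable S by apply: measurable_superlevel; exact: measurable_normt.
pose t x : R := \1_S x * w x.
have mI : measurable_fun setT (\1_S : d.-tuple R -> R) by exact: measurable_indic.
have mt : measurable_fun setT t by exact: measurable_funM.
have it : mu.-integrable setT (fun x => (t x)%:E).
  apply: (@integrable_bounded_mul _ _ _ _ 1) => // x.
  by rewrite indicE; case: (_ \in _); rewrite ?normr1 ?normr0.
have t0 x : 0 <= t x by rewrite mulr_ge0.
have tE : Rintegral mu setT t <= E / 6.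
  rewrite -lee_fin -integrable_EFin_fine//; apply/ltW; have := hM M (leqnn M).
  rewrite /= integral_mkcond; congr (_ < _)%E; apply: eq_integral => x _.
  by rewrite patchE /t indicE -/S; case: ifP => _; rewrite ?mul1r ?mul0r.
exists (2 * M%:R), (E / 4); split; first by rewrite divr_gt0.
move=> h hh.
have ith := integrable_addt h it.
have [mD Dy] := (inLp2E _).1 (inLp2_diff h hf).
pose D x := normc2 (translate f h x - f x).
have D0 x : 0 <= D x by exact: normc2_ge0.
have iD : mu.-integrable setT (fun x => (D x)%:E).
  by apply: integrable_of_ge0_lty => //; exact: measurable_normc2.
have -> : L2sq (fun x => f (addt x h) - f x) = (Rintegral mu setT D)%:E.
  exact: integrable_EFin_fine.
rewrite lee_fin.
have i1 := integrable_Zl 2 iD; have i2 := integrable_Zl 2 ith.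
have i12 := integrable_D i1 i2; have i123 := integrable_D i12 it.
have : E <= Rintegral mu setT (fun x => 2 * D x + 2 * t (addt x h) + t x).
  apply: le_Rintegral => // x _.
  have [Mx|xM] := leP M%:R (normt x).
    have -> : t x = w x by rewrite /t indicE mem_set// mul1r.
    by rewrite lerDr addr_ge0// mulr_ge0.
  have -> : t (addt x h) = w (addt x h).
    rewrite /t indicE mem_set ?mul1r//; exact: normt_addt_ge xM hh.
  have := normc2D_le (f x) (f (addt x h)) (@ltr01 R).
  rewrite normc2_eqB invr1 -/(D x) -/(w x) -/(w (addt x h)).
  by have := t0 x; lra.
rewrite -RintD// -RintD// -RintZl// -RintZl// Rintegral_addt//.
by move: tE; lra.
Qed.

End far_translation.

(** * The spherical modulus of continuity *)

Section spherical_modulus.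
Context {R : realType} {d : nat}.
Local Notation mu := (@lebesgue_tuple R d).
Local Notation B := (@pball R d).
Variable f : d.-tuple R -> R[i].
Hypothesis hf : inLp 2%:E f.

Definition spectral_density (xi : d.-tuple R) : R := normc2 (fourier f xi).
Definition spectral_tail (t : R) : R :=
  Rintegral mu setT (fun xi => \1_[set xi | t <= normt xi] xi * spectral_density xi).
Definition spectral_moment (t : R) : R :=
  Rintegral mu setT (fun xi =>
    (\1_(~` [set xi | t <= normt xi]) xi * normt xi ^+ 2) * spectral_density xi).
Definition spectral_mass : R := Rintegral mu setT spectral_density.
Definition spherical_const : R := d%:R / (2 * pi) ^+ d.
Definition spherical_modulus (e : R) : R :=
  spherical_const * Rintegral mu setT (fun xi => sphere_kernel e xi * spectral_density xi).

Local Notation W := spectral_density.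
Local Notation A t := [set xi : d.-tuple R | t <= normt xi].

Let C0 : 0 < (2 * pi : R) ^+ d.
Proof. by rewrite exprn_gt0// mulr_gt0// pi_gt0. Qed.

Let W0 xi : 0 <= W xi. Proof. exact: normc2_ge0. Qed.

Let inL : inLp 2%:E (fourier f). Proof. by have [] := fourierP hf. Qed.

Let mW : measurable_fun setT W.
Proof. by apply: measurable_normc2; have [] := (inLp2E _).1 inL. Qed.

Let iW : mu.-integrable setT (fun xi => (W xi)%:E).
Proof. by apply: integrable_of_ge0_lty => //; have [] := (inLp2E _).1 inL. Qed.

Let mA t : measurable (A t).
Proof. by apply: measurable_superlevel; exact: measurable_normt. Qed.

Let mI (S : set (d.-tuple R)) : measurable S -> measurable_fun setT (\1_S : d.-tuple R -> R).
Proof. by move=> mS; exact: measurable_indic. Qed.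

Lemma integrable_spectral_tail t : mu.-integrable setT (fun xi => (\1_(A t) xi * W xi)%:E).
Proof.
apply: (@integrable_bounded_mul _ _ _ _ 1) => //.
by move=> x; rewrite indicE; case: (_ \in _); rewrite ?normr1 ?normr0.
Qed.

Lemma indic_tail t xi : \1_(A t) xi = (if t <= normt xi then 1 else 0) :> R.
Proof.
rewrite indicE; case: ifPn => h; first by rewrite mem_set.
by rewrite memNset//; exact/negP.
Qed.

Lemma indic_tailC t xi : \1_(~` A t) xi = (if t <= normt xi then 0 else 1) :> R.
Proof.
rewrite indicE; case: ifPn => h; first by rewrite memNset//=; exact.
by rewrite mem_set//=; exact/negP.
Qed.

Lemma integrable_spectral_moment t :
  mu.-integrable setT (fun xi => (\1_(~` A t) xi * normt xi ^+ 2 * W xi)%:E).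
Proof.
apply: (@integrable_bounded_mul _ _ _ _ (t ^+ 2)) => //.
  apply: measurable_funM; first by apply: mI; apply: measurableC.
  by apply: measurable_funX; exact: measurable_normt.
move=> x; rewrite indic_tailC; case: (leP t (normt x)) => h; first by rewrite mul0r normr0 sqr_ge0.
rewrite mul1r ger0_norm ?sqr_ge0// ler_sqr ?nnegrE ?normt_ge0// ltW//.
exact: le_lt_trans (normt_ge0 x) h.
Qed.

Lemma integrable_spherical e : mu.-integrable setT (fun xi => (sphere_kernel e xi * W xi)%:E).
Proof.
apply: (@integrable_bounded_mul _ _ _ _ (@pball_volume R d * 4)) => //; first exact: measurable_sphere_kernel.
by move=> x; rewrite ger0_norm ?sphere_kernel_ge0// sphere_kernel_le4.
Qed.

Lemma spectral_tailE t :
  (\int[mu]_(xi in A t) ((Normc.normc (fourier f xi)) ^+ 2)%:E = (spectral_tail t)%:E)%E.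
Proof.
rewrite integral_mkcond -(integrable_EFin_fine _ (integrable_spectral_tail t)); last first.
  by move=> x; rewrite mulr_ge0.
apply: eq_integral => x _.
by rewrite patchE indicE normc_sqr; case: ifP => _; rewrite ?mul1r ?mul0r.
Qed.

Let diff_kernel e y xi : R := 2 * (1 - cos (dott xi (scalet e y))) * W xi.

Let diff_kernel_ge0 e y xi : (0 <= (diff_kernel e y xi)%:E)%E.
Proof. by rewrite lee_fin !mulr_ge0// one_sub_cos_ge0. Qed.

Let L2sq_diffE e y : (L2sq (fun x => f (addt x (scalet e y)) - f x)%R =
  ((2 * pi) ^+ d)^-1%:E * \int[mu]_xi (diff_kernel e y xi)%:E)%E.
Proof. by rewrite -L2sq_difference// muleA -EFinM mulVf ?gt_eqF// mul1e. Qed.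

Lemma measurable_L2sq_difference e :
  measurable_fun setT (fun y => L2sq (fun x => f (addt x (scalet e y)) - f x)).
Proof.
rewrite (funext (L2sq_diffE e)); apply: measurable_funeM.
apply: (@measurable_fun_fubini_tonelli_F _ _ _ _ R mu
  (fun z => (diff_kernel e z.1 z.2)%:E) _ (fun z => diff_kernel_ge0 e z.1 z.2)).
apply/measurable_EFinP/measurable_funM; last exact: (measurableT_comp mW measurable_snd).
apply: measurable_funM => //; apply: measurable_funB => //; apply: measurable_cos_comp.
under eq_fun do rewrite dott_scalet.
apply: measurable_funM => //.
apply: (measurableT_comp (@measurable_dott2 R d) (_ : measurable_fun setT (fun z : d.-tuple R * d.-tuple R => (z.2, z.1)))).
by apply/measurable_fun_pairP; split; [exact: measurable_snd|exact: measurable_fst].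
Qed.

(** Plancherel's formula for each translate, then Tonelli: integrating over the direction
    of the translation replaces its multiplier by the averaged one. *)
Lemma spherical_modulusE e :
  (\int[sphere_measure d]_(y in sphere d) L2sq (fun x => f (addt x (scalet e y)) - f x)%R =
   (spherical_modulus e)%:E)%E.
Proof.
rewrite (integral_sphere (measurable_L2sq_difference e)); last by move=> y; exact: L2sq_ge0.
have mB : measurable B by exact: measurable_punctured_ball.
pose p (z : d.-tuple R * d.-tuple R) : \bar R := (osc e z.1 z.2 * \1_B z.2 * W z.1)%:E.
have p0 z : (0 <= p z)%E by rewrite lee_fin !mulr_ge0// osc_ge0.
have mp : measurable_fun setT p.
  apply/measurable_EFinP/measurable_funM; last exact: (measurableT_comp mW measurable_fst).
  apply: measurable_funM; first exact: measurable_osc2.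
  exact: (measurableT_comp (mI mB) (@measurable_snd _ _ (d.-tuple R) (d.-tuple R))).
transitivity (d%:R%:E * (((2 * pi) ^+ d)^-1%:E * \int[mu]_x \int[mu]_xi p (xi, x)))%E.
  congr (_ * _)%E; rewrite integral_mkcond -ge0_integralZl//; last 3 first.
  - exact: (@measurable_fun_fubini_tonelli_G _ _ _ _ R mu p mp p0).
  - by move=> x _; apply: integral_ge0.
  - by rewrite lee_fin invr_ge0 ltW.
  apply: eq_integral => x _; rewrite patchE; case: ifPn => [xB|xB].
    rewrite L2sq_diffE; congr (_ * _)%E; apply: eq_integral => xi _.
    by rewrite /p /diff_kernel /osc /= indicE xB mulr1 dott_scalet.
  by rewrite integral0_eq ?mule0// => xi _; rewrite /p /= indicE (negbTE xB) mulr0 mul0r.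
rewrite -(@fubini_tonelli _ _ _ _ R mu mu p mp p0) /spherical_modulus /spherical_const.
rewrite !EFinM -muleA; congr (_ * (_ * _))%E.
rewrite -(integrable_EFin_fine _ (integrable_spherical e)); last first.
  by move=> x; rewrite mulr_ge0// sphere_kernel_ge0.
apply: eq_integral => xi _; rewrite /p /=.
under eq_integral do rewrite mulrC EFinM.
rewrite ge0_integralZl//; last 3 first.
- apply/measurable_EFinP/measurable_funM; last exact: mI.
  exact: measurable_osc.
- by move=> x _; rewrite lee_fin mulr_ge0// osc_ge0.
- by rewrite lee_fin.
rewrite mulrC EFinM; congr (_ * _)%E; rewrite -integral_osc [RHS]integral_mkcond.
by apply: eq_integral => x _; rewrite patchE indicE; case: ifP => _; rewrite ?mulr1 ?mulr0.
Qed.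

End spherical_modulus.

(** * Spectral inequalities and the equivalence *)

Section spectral_inequalities.
Context {R : realType} {d : nat}.
Local Notation mu := (@lebesgue_tuple R d).
Variable f : d.-tuple R -> R[i].
Hypothesis hf : inLp 2%:E f.
Local Notation W := (spectral_density f).
Local Notation I := (spherical_modulus f).
Local Notation F := (spectral_moment f).
Local Notation J := (spectral_tail f).
Local Notation N := (spectral_mass f).
Local Notation c := (@spherical_const R d).
Local Notation V := (@pball_volume R d).

Let C0 : 0 < (2 * pi : R) ^+ d.
Proof. by rewrite exprn_gt0// mulr_gt0// pi_gt0. Qed.

Lemma spherical_const_ge0 : 0 <= c.
Proof. by rewrite divr_ge0// ltW. Qed.

Lemma spherical_const_gt0 : (0 < d)%N -> 0 < c.
Proof. by move=> d0; rewrite divr_gt0// ltr0n. Qed.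

Let W0 xi : 0 <= W xi. Proof. exact: normc2_ge0. Qed.

Let iW : mu.-integrable setT (fun xi => (W xi)%:E).
Proof.
have [inL _] := fourierP hf; have [mF Fy] := (inLp2E _).1 inL.
by apply: integrable_of_ge0_lty => //; exact: measurable_normc2.
Qed.

Let iJ t := integrable_spectral_tail hf t.
Let iF t := integrable_spectral_moment hf t.
Let iI e := integrable_spherical hf e.

Lemma spectral_tail_ge0 t : 0 <= J t.
Proof. by apply: Rintegral_ge0 => x _; rewrite mulr_ge0. Qed.

Lemma spectral_moment_ge0 t : 0 <= F t.
Proof. by apply: Rintegral_ge0 => x _; apply: mulr_ge0 => //; apply: mulr_ge0 => //; exact: sqr_ge0. Qed.

Lemma spectral_mass_ge0 : 0 <= N.
Proof. by apply: Rintegral_ge0 => x _; exact: W0. Qed.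

Lemma spherical_modulus0 : I 0 = 0.
Proof.
have k0 : (fun xi => sphere_kernel 0 xi * W xi) = fun=> 0.
  by apply/funext => xi; rewrite sphere_kernel0 mul0r.
by rewrite /spherical_modulus k0 Rintegral_cst// mul0r mulr0.
Qed.

Lemma spherical_modulus_double e : I (2 * e) <= 4 * I e.
Proof.
rewrite /spherical_modulus mulrCA ler_wpM2l ?spherical_const_ge0// RintZl//.
apply: Rint_le => //; first exact: integrable_Zl.
by move=> xi; rewrite mulrA ler_wpM2r// sphere_kernel_double.
Qed.

Lemma spherical_modulus_lower e : 0 < e ->
  c * (@quad_const R d / 4) * (e ^+ 2 * F e^-1) <= I e.
Proof.
move=> e0; rewrite /spherical_modulus -mulrA ler_wpM2l ?spherical_const_ge0//.
rewrite mulrA RintZl//; apply: Rint_le => //; first exact: integrable_Zl.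
move=> xi; rewrite mulrA ler_wpM2r// indic_tailC.
case: (leP e^-1 (normt xi)) => h; first by rewrite mul0r mulr0 sphere_kernel_ge0.
rewrite mul1r -[X in X <= _]mulrA; apply: sphere_kernel_ge_sqr.
rewrite -exprMn exprn_ile1 ?mulr_ge0 ?normt_ge0 ?(ltW e0)//.
by rewrite -ler_pdivlMl// mulr1 ltW.
Qed.

Lemma spherical_modulus_upper e t : 0 < e -> 0 < t ->
  I e <= c * (4 * V) * (e ^+ 2 * F t + J t).
Proof.
move=> e0 t0; rewrite /spherical_modulus -mulrA ler_wpM2l ?spherical_const_ge0//.
rewrite [e ^+ 2 * _]RintZl// RintD//; last exact: integrable_Zl.
rewrite RintZl; last by apply: integrable_D => //; exact: integrable_Zl.
apply: Rint_le => //.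
  by apply: integrable_Zl; apply: integrable_D => //; exact: integrable_Zl.
have V0 := @pball_volume_ge0 R d.
move=> xi; rewrite indic_tailC indic_tail [e ^+ 2 * _]mulrA -mulrDl mulrA ler_wpM2r//.
case: (leP t (normt xi)) => h.
  by rewrite mul0r mulr0 add0r mulr1 mulrC sphere_kernel_le4.
rewrite mul1r addr0 (le_trans (sphere_kernel_le_sqr _ _))//.
rewrite ler_wpM2r ?mulr_ge0 ?normt_ge0 ?(ltW e0)//; lra.
Qed.

Lemma spectral_tail_le t : J t <= N.
Proof.
apply: Rint_le => // xi; rewrite indic_tail.
by case: ifP => _; rewrite ?mul1r ?mul0r.
Qed.

Lemma spectral_moment_le t : 0 < t -> F t <= t ^+ 2 * N.
Proof.
move=> t0; rewrite RintZl//; apply: Rint_le => //; first exact: integrable_Zl.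
move=> xi; rewrite ler_wpM2r// indic_tailC.
case: (leP t (normt xi)) => h; first by rewrite mul0r sqr_ge0.
by rewrite mul1r ler_sqr ?nnegrE ?normt_ge0 ?ltW.
Qed.

Lemma tail_moment_lower t s : 0 < t -> t <= s -> t ^+ 2 * (J t - J s) <= F s - F t.
Proof.
move=> t0 ts; rewrite RintB// RintB// RintZl; last exact: integrable_B.
apply: Rint_le => //; [exact/integrable_Zl/integrable_B|exact: integrable_B|].
move=> xi; rewrite -!mulrBl mulrA ler_wpM2r// !indic_tailC !indic_tail.
case: (leP t (normt xi)) => h1; case: (leP s (normt xi)) => h2.
- by rewrite !subrr mulr0 mul0r.
- by rewrite !subr0 mulr1 mul1r ler_sqr ?nnegrE ?normt_ge0// ltW.
- by have := lt_le_trans h1 (le_trans ts h2); rewrite ltxx.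
- by rewrite !subrr mulr0 mul0r.
Qed.

Lemma tail_moment_upper t s : 0 < t -> t <= s -> F s - F t <= s ^+ 2 * (J t - J s).
Proof.
move=> t0 ts; rewrite RintB// RintB// RintZl; last exact: integrable_B.
apply: Rint_le => //; [exact: integrable_B|exact/integrable_Zl/integrable_B|].
move=> xi; rewrite -!mulrBl [leRHS]mulrA ler_wpM2r// !indic_tailC !indic_tail.
case: (leP t (normt xi)) => h1; case: (leP s (normt xi)) => h2.
- by rewrite !subrr mulr0 mul0r.
- rewrite !subr0 mulr1 mul1r ler_sqr ?nnegrE ?normt_ge0// ltW//.
  exact: lt_le_trans ts.
- by have := lt_le_trans h1 (le_trans ts h2); rewrite ltxx.
- by rewrite !subrr mulr0 mul0r.
Qed.

Lemma spectral_tail_lim e t : 0 < e -> 0 < t -> exists n, J (2 ^+ n * t) <= e.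
Proof.
move=> e0 t0; have [inL _] := fourierP hf; have [mF Fy] := (inLp2E _).1 inL.
have [M _ hM] := ereal_cvg0_lt
  (tail_integral_cvg0 (measurable_normc2 mF) (@measurable_normt R d) W0 Fy) e0.
have := hM M (leqnn M); rewrite /= => h.
pose n := Num.Def.archi_bound (M%:R / t); exists n.
have tn : M%:R <= 2 ^+ n * t.
  rewrite -ler_pdivrMr//; apply: (@le_trans _ _ n%:R).
    by apply/ltW/archi_boundP; rewrite divr_ge0// ltW.
  by rewrite -natrX ler_nat ltnW// ltn_expl.
rewrite -lee_fin -spectral_tailE//; apply: le_trans (ltW h).
under eq_integral do rewrite normc_sqr.
apply: ge0_subset_integral => //.
- by apply: measurable_superlevel; exact: measurable_normt.
- by apply: measurable_superlevel; exact: measurable_normt.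
- by apply: measurable_funTS; apply/measurable_EFinP; exact: measurable_normc2.
- by move=> x _; rewrite lee_fin normc2_ge0.
- by move=> x /=; exact: le_trans.
Qed.

(** A positive spectral mass means that f is not 0, hence that its distant translates stay
    away from it. *)
Lemma spherical_modulus_far : (0 < d)%N -> 0 < N ->
  exists T m : R, 0 < m /\ forall s, T <= s -> m <= I s.
Proof.
move=> d0 N0; have [mf fy] := (inLp2E f).1 hf.
have E0 : (0 < L2sq f)%E.
  have := plancherel_L2 hf (fourierP hf).
  rewrite (_ : L2sq (fourier f) = N%:E); last exact: integrable_EFin_fine.
  rewrite lt_neqAle L2sq_ge0 andbT => + ; apply: contraPneq => <-.
  by rewrite mule0 => -[] /eqP; rewrite gt_eqF.
have [T [delta [del0 hT]]] := L2sq_difference_lower_bound hf E0.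
have V0 := @pball_volume_gt0 R d d0.
exists (Num.max T 0), (d%:R * (delta * V)); split; first by rewrite !mulr_gt0// ltr0n.
move=> s; rewrite ge_max => /andP[Ts s0]; rewrite -lee_fin -spherical_modulusE//.
have mB : measurable (@pball R d) by exact: measurable_punctured_ball.
apply: (@le_trans _ _ (\int[sphere_measure d]_(y in sphere d) delta%:E)%E).
  rewrite (@integral_sphere _ d (fun=> delta%:E))//; last by move=> y; rewrite lee_fin ltW.
  by rewrite integral_cst// -[X in (_ * (_ * X))%E]/(mu (@pball R d)) pball_volumeE -!EFinM.
apply: ge0_le_integral.
- exact: measurable_sphere.
- by move=> y _; rewrite lee_fin ltW.
- exact: measurable_cst.
- by apply: measurable_funTS; exact: measurable_L2sq_difference.
- by move=> y y1; apply: hT; rewrite normt_scalet ger0_norm// y1 mulr1.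
Qed.

End spectral_inequalities.

Theorem corollary1p5 (R : realType) (d : nat) (hd : (0 < d)%N)
    (f : d.-tuple R -> R[i]) (hf : inLp 2%:E f)
    (gamma : R) (hgamma : 0 < gamma < 2) :
  (exists c1 c2 : R, [/\ 0 < c1, 0 < c2 &
     forall eps : R, 0 <= eps <= 1 ->
       let I := (\int[sphere_measure d]_(y in sphere d)
         (Lnormc 2%:E (fun x => f (addt x (scalet eps y)) - f x)%R) ^+ 2)%E in
       ((c1 * eps `^ gamma)%:E <= I)%E /\ (I <= (c2 * eps `^ gamma)%:E)%E])
  <->
  (exists b1 b2 : R, [/\ 0 < b1, 0 < b2 &
     forall t : R, 1 <= t ->
       let J := (\int[lebesgue_tuple d]_(xi in [set xi | (t <= normt xi)%R])
         ((Normc.normc (fourier f xi)) ^+ 2)%:E)%E in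
       ((b1 * t `^ (- gamma))%:E <= J)%E /\ (J <= (b2 * t `^ (- gamma))%:E)%E]).
Proof.
have IE e : (\int[sphere_measure d]_(y in sphere d)
    (Lnormc 2%:E (fun x => f (addt x (scalet e y)) - f x)%R) ^+ 2 =
    (spherical_modulus f e)%:E)%E.
  by rewrite -spherical_modulusE//; apply: eq_integral => y _; rewrite Lnormc2_sqr.
have c0 := @spherical_const_gt0 R d hd.
have m0 : 0 < @spherical_const R d * (@quad_const R d / 4).
  by rewrite mulr_gt0// divr_gt0// quad_const_gt0.
have M0 : 0 < @spherical_const R d * (4 * @pball_volume R d).
  by rewrite mulr_gt0// mulr_gt0// pball_volume_gt0.
have := power_law_equivalence m0 M0 (spectral_mass_ge0 f) hgamma
  (spherical_modulus0 f) (spherical_modulus_lower hf) (spherical_modulus_upper hf)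
  (spherical_modulus_double hf) (spherical_modulus_far hf hd) (spectral_moment_ge0 f)
  (spectral_tail_ge0 f) (spectral_tail_le hf) (spectral_moment_le hf)
  (tail_moment_lower hf) (tail_moment_upper hf) (spectral_tail_lim hf).
move=> [IJ JI]; split=> [[c1 [c2 [c10 c20 h]]]|[b1 [b2 [b10 b20 h]]]].
  have [|b1 [b2 [b10 b20 h']]] := IJ.
    by exists c1, c2; split=> // e e01; move: (h e e01); rewrite /= IE !lee_fin.
  by exists b1, b2; split=> // t t1 /=; rewrite spectral_tailE// !lee_fin; exact: h'.
have [|c1 [c2 [c10 c20 h']]] := JI.
  by exists b1, b2; split=> // t t1; move: (h t t1); rewrite /= spectral_tailE// !lee_fin.
by exists c1, c2; split=> // e e01 /=; rewrite IE !lee_fin; exact: h'.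
Qed.
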